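(* Let $\mathbb{T}^2=\mathbb{R}^2/(2\pi\mathbb{Z}^2)$ be the flat torus and let $V\in L^2(\mathbb{T}^2)$ be real-valued. (i) If $\Sigma\subset\mathbb{T}^2$ is a (smooth, compact) curve segment with nonvanishing geodesic curvature, or a segment of a closed geodesic, then there is a constant $C$, independent of $\lambda$ and $e_\lambda$, such that for all $\lambda\ge10$ and every eigenfunction $e_\lambda$ of $H_V$ with $H_Ve_\lambda=\lambda^2e_\lambda$, $$\|e_\lambda\|_{L^2(\Sigma)}\le C\,\|e_\lambda\|_{L^2(\mathbb{T}^2)}.$$ (ii) If $\Sigma\subset\mathbb{T}^2$ is a geodesic segment (of finite length), then there is a constant $C$, independent of $\lambda$ and $e_\lambda$, such that for all $\lambda\ge10$ and every eigenfunction $e_\lambda$ of $H_V$ with $H_Ve_\lambda=\lambda^2e_\lambda$, $$\|e_\lambda\|_{L^2(\Sigma)}\le C\,\sqrt{\log\lambda}\;\|e_\lambda\|_{L^2(\mathbb{T}^2)}.$$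
   Context: $H_V=-\Delta+V$, where $\Delta$ is the Laplacian of the flat metric on $\mathbb{T}^2$. For $V\in L^2(\mathbb{T}^2)$ real-valued (hence in the Kato class), $H_V$ is self-adjoint, bounded from below, with discrete spectrum and continuous eigenfunctions, so restrictions to $\Sigma$ make sense; $L^2(\Sigma)$ is taken with respect to arc length. *)

(* Defs.v *)
From HB Require Import structures.
From mathcomp Require Import all_boot all_order all_algebra.
From mathcomp Require Import all_classical all_reals all_analysis.
From mathcomp Require Export complex.

Set Implicit Arguments.
Unset Strict Implicit.
Unset Printing Implicit Defensive.

Import Order.TTheory GRing.Theory Num.Theory.
Import numFieldNormedType.Exports.

Local Open Scope classical_set_scope.
Local Open Scope ring_scope.
Local Open Scope complex_scope.

Section Torus.
Variable R : realType.

(* The torus is the plane modulo 2 pi Z^2: functions on it are functions on the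
   plane that are 2 pi-periodic in both variables, and are integrated over the
   fundamental square; curves in it are given by a lift to the plane. *)

Definition period_lattice (v : R * R) : Prop :=
  exists m n : int, v = (2 * pi * m%:~R, 2 * pi * n%:~R).

Definition torus_periodic (A : Type) (u : R * R -> A) : Prop :=
  forall x v : R * R, period_lattice v -> u (x + v) = u x.

Definition area :
    {measure set (measurableTypeR R * measurableTypeR R) -> \bar R} :=
  (@lebesgue_measure R \x @lebesgue_measure R)%E.

Definition square : set (R * R) := `[0, 2 * pi] `*` `[0, 2 * pi].

Definition L2_torus (u : R * R -> R) : Prop :=
  [/\ torus_periodic u,
      measurable_fun [set: measurableTypeR R * measurableTypeR R] u &
      (\int[area]_(x in square) (u x ^+ 2)%:E < +oo)%E].

(* Values in R[i] are handled through their real and imaginary parts. *)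
Definition L2_torusC (u : R * R -> R[i]) : Prop :=
  L2_torus (fun x => complex.Re (u x)) /\ L2_torus (fun x => complex.Im (u x)).

Definition normL2_torus (u : R * R -> R[i]) : R :=
  Num.sqrt (\int[area]_(x in square) (Normc.normc (u x) ^+ 2)).

(* phi is C^oo: all its iterated directional derivatives, in arbitrary
   directions, are differentiable. *)
Definition smooth (phi : R * R -> R) : Prop :=
  forall (s : seq (R * R)) (x : R * R),
    differentiable (foldr (fun v (f : R * R -> R) => 'D_v f) phi s) x.

Definition laplacian (phi : R * R -> R) (x : R * R) : R :=
  'D_(1, 0) ('D_(1, 0) phi) x + 'D_(0, 1) ('D_(0, 1) phi) x.

Definition distr_laplacian (u g : R * R -> R) : Prop :=
  forall phi : R * R -> R, smooth phi -> torus_periodic phi ->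
    \int[area]_(x in square) (u x * laplacian phi x) =
    \int[area]_(x in square) (g x * phi x).

Definition distr_laplacianC (u g : R * R -> R[i]) : Prop :=
  distr_laplacian (fun x => complex.Re (u x)) (fun x => complex.Re (g x)) /\
  distr_laplacian (fun x => complex.Im (u x)) (fun x => complex.Im (g x)).

(* The graph of the operator H_V = - Delta + V in L^2.  For V in L^2 of the
   two-dimensional torus, multiplication by V is (- Delta)-bounded with relative
   bound 0, so that the domain of the self-adjoint operator H_V is that of
   Delta, i.e. H^2 = {u in L^2 | Delta u in L^2}. *)
Definition schrodinger (V : R * R -> R) (u f : R * R -> R[i]) : Prop :=
  [/\ L2_torusC u, L2_torusC f &
      exists g : R * R -> R[i],
        [/\ L2_torusC g, distr_laplacianC u g &
            {ae area, forall x, f x = - g x + (V x)%:C * u x}]].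

(* Eigenfunctions are represented by their continuous representatives, which is
   what gives a meaning to their restriction to a curve. *)
Definition eigenfunction (V : R * R -> R) (E : R) (e : R * R -> R[i]) : Prop :=
  [/\ continuous (fun x => complex.Re (e x)),
      continuous (fun x => complex.Im (e x)),
      exists x, e x != 0 &
      schrodinger V e (fun x => E%:C * e x)].

Definition speed (gam : R -> R * R) (t : R) : R :=
  Num.sqrt (derive1 (fst \o gam) t ^+ 2 + derive1 (snd \o gam) t ^+ 2).

(* Signed geodesic curvature for the flat metric. *)
Definition curvature (gam : R -> R * R) (t : R) : R :=
  (derive1 (fst \o gam) t * derive1n 2 (snd \o gam) t
   - derive1 (snd \o gam) t * derive1n 2 (fst \o gam) t) / speed gam t ^+ 3.

(* Smoothness on the compact interval [a, b] means smoothness on an open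
   interval that contains it. *)
Definition smooth_near (a b : R) (f : R -> R) : Prop :=
  exists c d : R, [/\ c < a, b < d &
    forall (n : nat) (t : R), c < t < d -> derivable (derive1n n f) t 1].

Definition regular_segment (gam : R -> R * R) (a b : R) : Prop :=
  [/\ a < b, smooth_near a b (fst \o gam), smooth_near a b (snd \o gam) &
      forall t, a <= t <= b -> speed gam t != 0].

Definition curved_segment (gam : R -> R * R) (a b : R) : Prop :=
  regular_segment gam a b /\ (forall t, a <= t <= b -> curvature gam t != 0).

(* The Christoffel symbols of the flat metric vanish, so that the geodesic
   equation is gam'' = 0. *)
Definition geodesic (gam : R -> R * R) : Prop :=
  forall t : R,
    [/\ derivable (fst \o gam) t 1 /\ derivable (snd \o gam) t 1,
        derivable (derive1 (fst \o gam)) t 1 /\ derivable (derive1 (snd \o gam)) t 1,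
        derive1n 2 (fst \o gam) t = 0 /\ derive1n 2 (snd \o gam) t = 0 &
        speed gam t != 0].

Definition closed_geodesic (gam : R -> R * R) : Prop :=
  geodesic gam /\
  exists2 T : R, 0 < T & forall t, period_lattice (gam (t + T) - gam t).

Definition geodesic_segment (gam : R -> R * R) (a b : R) : Prop :=
  geodesic gam /\ a < b.

Definition closed_geodesic_segment (gam : R -> R * R) (a b : R) : Prop :=
  closed_geodesic gam /\ a < b.

(* The L^2 norm, for arc length, of the restriction of u to gam([a, b]). *)
Definition normL2_curve (gam : R -> R * R) (a b : R) (u : R * R -> R[i]) : R :=
  Num.sqrt (\int[lebesgue_measure]_(t in `[a, b])
              (Normc.normc (u (gam t)) ^+ 2 * speed gam t)).

End Torus.

(* Main.v *)
(* Let u be the real or imaginary part of an eigenfunction, c_n its Fourier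
   coefficients, and p_N the l^2 norm of (c_n) over the circle |n|^2 = N.  The
   equation reads (|n|^2 - lam^2) c_n = - (V u)^(n).  For k <> 0, few points n of
   an annulus A <= |n|^2 < A + K have n - k in the same annulus; this gives an L^4
   bound for trigonometric polynomials with frequencies in the annulus and, by
   duality, an l^2 bound for the coefficients there of a product W u, in terms of
   the L^2 norm of W and the L^4 norm of u.  Summing over annuli that grow
   geometrically around lam^2, and using that V is bounded up to a small error in
   L^2, one gets sum_N p_N <= C |u|_2, with room for weights that grow like a small
   power of |N - lam^2|.

   It remains to restrict the part T_N of u with frequencies on one circle.  Let
   |T_N| <= B_N p_N in L^2(Sigma).  By the Schur test, B_N^2 is at most the maximum
   over n of the sum over m of |int_Sigma e^(i (n - m) . x)|, up to a factor.  On a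
   curved segment the integral is O(|n - m|^(-1/2)), and the points of the circle
   other than n are, with one exception, at distance N^(1/6) / 2 at least, while
   there are O(N^(1/12)) of them.  On a closed geodesic only the m on the normal to
   the geodesic through n matter.  On a geodesic with direction v one may insert a
   weight, the integral is then O(1 / (1 + ((n - m) . v)^2)), and a strip of
   width |v| / 16 contains O(log N) points of the circle.  The last two counts of
   lattice points rest on the Vandermonde determinant of the powers of points of
   the circle, a nonzero Gaussian integer. *)
From HB Require Import structures.
From mathcomp Require Import all_boot all_order all_algebra.
From mathcomp Require Import all_classical all_reals all_analysis.
From mathcomp Require Import measurable_realfun.
From mathcomp Require Import zify ring lra.
Require Import Defs.

Set Implicit Arguments.
Unset Strict Implicit.
Unset Printing Implicit Defensive.

Import Order.TTheory GRing.Theory Num.Theory.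
Import numFieldNormedType.Exports.

Local Open Scope classical_set_scope.
Local Open Scope ring_scope.

(** * Lattice points in annuli and on circles *)

(** The L^4 norm of u is not given by its L^2 norm. It is bounded by the sum of the p_N, since every
    single circle has an L^4 bound with an absolute constant; the coefficient equation in turn
    bounds this sum by the L^4 norm. The loop closes because the unbounded part of V makes its gain
    less than one, and the unknown may be subtracted because a continuous u has finite L^4 norm
    beforehand. Exponents: an annulus of width K holds O(K^(3/2)) pairs for each difference k, so
    the squared l^2 norm of the coefficients of the product is O(K^(3/4)), and Cauchy-Schwarz over K
    circles gives O(K^(7/8)). Against a divisor of size K this gains K^(-1/8). With K = 2^(16 j) the
    gain is 2^(-2 j), and a factor 2^j of it is left to the weights, which are needed because on a
    general geodesic B_N^2 grows like log N, also for N far from lam^2. A curve has area zero, so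
    L^2 convergence of the Fourier series says nothing about restrictions. Uniform convergence is
    proved, by absolute summability of the coefficients with a bound that may depend on lam. *)

Definition nsq (z : int * int) : nat := (`|z.1| ^ 2 + `|z.2| ^ 2)%N.

Arguments nsq z%_R.

Lemma nsqE z : (nsq z)%:Z = z.1 ^+ 2 + z.2 ^+ 2.
Proof. by rewrite /nsq PoszD -!abszX !abszE !ger0_norm ?sqr_ge0. Qed.

Lemma nsqN z : nsq (- z) = nsq z.
Proof. by rewrite /nsq /= !abszN. Qed.

Lemma nsq_eq0 z : (nsq z == 0%N) = (z == 0).
Proof. by case: z => x y; rewrite /nsq /= addn_eq0 !expn_eq0 !absz_eq0 !andbT. Qed.

Lemma size_int_spread (s : seq int) (m : nat) : uniq s ->
  (forall x y, x \in s -> y \in s -> (`|x - y| < m)%N) -> (size s <= m)%N.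
Proof.
move=> us sm.
have [->//|s_n0] := eqVneq s [::].
have [x0 x0s x0min] : exists2 x0, x0 \in s & forall x, x \in s -> x0 <= x.
  elim: s s_n0 {us sm} => // x [|y s] IH _.
    by exists x; rewrite ?mem_head// => z; rewrite inE => /eqP ->.
  have [//|z zs zmin] := IH.
  have [xz|zx] := leP x z.
    exists x; rewrite ?mem_head// => t; rewrite inE => /orP[/eqP->//|/zmin].
    exact: le_trans.
  exists z; first by rewrite inE zs orbT.
  move=> t; rewrite inE => /orP[/eqP->|/zmin//]; exact: ltW.
rewrite -(size_map (fun x => `|x - x0|%N)) -[leqRHS](size_iota 0).
apply: uniq_leq_size.
  rewrite map_inj_in_uniq// => x y xs ys.
  by have := x0min _ xs; have := x0min _ ys; lia.
by move=> _ /mapP[x xs ->]; rewrite mem_iota /= add0n sm.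
Qed.

Lemma size_fibers (T : eqType) (f : T -> nat) (K c : nat) (s : seq T) :
  (forall x, x \in s -> (f x < K)%N) ->
  (forall i, (size [seq x <- s | f x == i] <= c)%N) -> (size s <= K * c)%N.
Proof.
elim: K s => [|K IH] s fK fc.
  by case: s fK {fc} => // x s /(_ x (mem_head _ _)).
rewrite -(count_predC (fun x => f x == K)) -!size_filter mulSn leq_add//.
apply: IH => [x|i].
  by rewrite mem_filter /= => /andP[xK /fK]; lia.
apply: leq_trans (fc i); rewrite -filter_predI !size_filter.
by apply: sub_count => x /= /andP[].
Qed.

(** Lagrange's identity |k|^2 |n|^2 = (n.k)^2 + t^2, with t the cross product of n and k, reduces
    everything to t: on a common line the norms differ by (t^2 - t'^2) / |k|^2, and (t - t')^2 <=
    |t^2 - t'^2| when t and t' have the same sign. *)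
Lemma same_line_close (k n n' : int * int) (K : nat) : k != 0 ->
  n.1 * k.1 + n.2 * k.2 = n'.1 * k.1 + n'.2 * k.2 ->
  (0 <= n.1 * k.2 - n.2 * k.1) = (0 <= n'.1 * k.2 - n'.2 * k.1) ->
  (`|(nsq n)%:Z - (nsq n')%:Z| < K)%N -> (nsq (n - n') < K)%N.
Proof.
rewrite -nsq_eq0 -lt0n -ltz_nat => k0 dk sg; rewrite -!ltz_nat => nK.
rewrite -(ltr_pM2l k0) in nK *; rewrite -(ltr_pM2l k0).
apply: le_lt_trans nK; rewrite abszE -[X in X * `|_|]gtr0_norm// -normrM.
move: k0; rewrite !nsqE.
set t := n.1 * k.2 - n.2 * k.1 in sg *; set t' := n'.1 * k.2 - n'.2 * k.1 in sg *.
move=> k0.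
have -> : (k.1 ^+ 2 + k.2 ^+ 2) * (n.1 ^+ 2 + n.2 ^+ 2 - (n'.1 ^+ 2 + n'.2 ^+ 2))
   = t ^+ 2 - t' ^+ 2 + ((n.1 * k.1 + n.2 * k.2) ^+ 2 - (n'.1 * k.1 + n'.2 * k.2) ^+ 2).
  by rewrite /t /t'; ring.
have -> : (k.1 ^+ 2 + k.2 ^+ 2) * ((n - n').1 ^+ 2 + (n - n').2 ^+ 2)
   = (t - t') ^+ 2 + ((n.1 * k.1 + n.2 * k.2) - (n'.1 * k.1 + n'.2 * k.2)) ^+ 2.
  by rewrite /t /t' /=; ring.
rewrite dk !subrr expr0n !addr0.
clearbody t t'; rewrite ler_normr; move: sg.
by case: (leP 0 t) => t0 /esym sg; apply/orP; case: (leP t t') => tt'; [right|left|left|right]; nia.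
Qed.

(** Both p - q and p' - q' have the parity of r, so rounding their halves down loses nothing. This
    is what limits n.k to K values instead of 2 K. *)
Fact half_eq (A K p q p' q' r : nat) (P P' : int) :
  (A <= p < A + K)%N -> (A <= q < A + K)%N ->
  (A <= p' < A + K)%N -> (A <= q' < A + K)%N ->
  2 * P = p%:Z - q%:Z + r%:Z -> 2 * P' = p'%:Z - q'%:Z + r%:Z ->
  (p + K - 1 - q)./2 = (p' + K - 1 - q')./2 -> P = P'.
Proof. lia. Qed.

(* The scalar product n.k is pinned down to K values by |n|^2 and |n - k|^2; on
   each line n.k = v the annulus leaves two segments of length at most sqrt K. *)
Lemma window_count (k : int * int) (A K m : nat) (s : seq (int * int)) :
  k != 0 -> uniq s -> (K <= m ^ 2)%N ->
  (forall n, n \in s -> (A <= nsq n < A + K)%N /\ (A <= nsq (n - k) < A + K)%N) ->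
  (size s <= 2 * K * m)%N.
Proof.
move=> k0 us Km sA.
(* Here n.k = (|n|^2 - |n - k|^2 + |k|^2) / 2. The shift by K - 1 keeps the truncated subtraction
   exact, so [f] is below K; [g] adds the side of the line. *)
pose f (n : int * int) : nat := (nsq n + K - 1 - nsq (n - k))./2.
pose g (n : int * int) : nat := (2 * f n + (0 <= n.1 * k.2 - n.2 * k.1)%R)%N.
apply: (@size_fibers _ g) => [n /sA [] h1 h2|i].
  by rewrite /g /f; case: (0 <= _); lia.
set s' := [seq _ <- _ | _].
have s'P n n' : n \in s' -> n' \in s' ->
    n.1 * k.1 + n.2 * k.2 = n'.1 * k.1 + n'.2 * k.2 /\ (nsq (n - n') < K)%N.
  rewrite !mem_filter => /andP[/eqP gn ns] /andP[/eqP gn' n's].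
  have [fE sE] : f n = f n' /\ (0 <= n.1 * k.2 - n.2 * k.1) = (0 <= n'.1 * k.2 - n'.2 * k.1).
    by move: gn gn'; rewrite /g; case: (0 <= _); case: (0 <= _); lia.
  have [h1 h2] := sA _ ns; have [h3 h4] := sA _ n's.
  have dE : n.1 * k.1 + n.2 * k.2 = n'.1 * k.1 + n'.2 * k.2.
    have h (z : int * int) : 2 * (z.1 * k.1 + z.2 * k.2) = (nsq z)%:Z - (nsq (z - k))%:Z + (nsq k)%:Z.
      by rewrite !nsqE /=; ring.
    by apply: (half_eq h1 h2 h3 h4 (h n) (h n') fE).
  split => //; apply: (same_line_close k0) => //; lia.
have us' : uniq s' by rewrite filter_uniq.
have lt_m (x y : int * int) : (nsq (x - y) < K)%N ->
    (`|x.1 - y.1| < m)%N /\ (`|x.2 - y.2| < m)%N.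
  rewrite /nsq /= => h; rewrite -![(_ < m)%N](@ltn_exp2r _ _ 2)//; lia.
have k12 : (k.1 != 0) || (k.2 != 0).
  by move: k0; case: k {f g s' s'P us' sA lt_m} => a b; rewrite xpair_eqE negb_and.
(* If k.1 is nonzero, the second coordinate determines a point on the line n.k = v, and it varies by
   less than m. The other case exchanges the coordinates. *)
case/orP: k12 => kn0.
  rewrite -(size_map snd); apply: size_int_spread.
    rewrite map_inj_in_uniq// => -[x y] [x' y'] h h' /= yy'; subst y'.
    have [/= /addIr /(mulIf kn0) -> _//] := s'P _ _ h h'.
  by move=> _ _ /mapP[n ns ->] /mapP[n' n's ->]; have [_ /lt_m []] := s'P _ _ ns n's.
rewrite -(size_map fst); apply: size_int_spread.
  rewrite map_inj_in_uniq// => -[x y] [x' y'] h h' /= yy'; subst x'.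
  have [/= /addrI /(mulIf kn0) -> _//] := s'P _ _ h h'.
by move=> _ _ /mapP[n ns ->] /mapP[n' n's ->]; have [_ /lt_m []] := s'P _ _ ns n's.
Qed.

(** The exponent of N in the squared modulus of the determinant of the diagonal matrix [d] below;
    the truncated subtraction discards the rows k > r. *)
Fact sum_subn (r n : nat) : (r <= n)%N -> (\sum_(k < n) 2 * (r - k) = r * r.+1)%N.
Proof.
elim: r n => [|r IH] n rn; first by rewrite big1.
by case: n rn => // n rn; rewrite big_ord_recl /= subn0 IH//; lia.
Qed.

(** * Clusters of lattice points on a circle *)

Section CirclePoints.
Let R := rat.
Local Notation C := R[i].

Let nrm (z : C) : R := complex.Re z ^+ 2 + complex.Im z ^+ 2.

Let nrmM z w : nrm (z * w) = nrm z * nrm w.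
Proof. by case: z => a b; case: w => c d; rewrite /nrm /=; ring. Qed.

Let nrm1 : nrm 1 = 1.
Proof. by rewrite /nrm /=; ring. Qed.

Let nrmX z n : nrm (z ^+ n) = nrm z ^+ n.
Proof. by elim: n => [|n IH]; rewrite ?expr0 ?nrm1// !exprS nrmM IH. Qed.

Let nrm_prod I (s : seq I) (P : pred I) (F : I -> C) :
  nrm (\prod_(i <- s | P i) F i) = \prod_(i <- s | P i) nrm (F i).
Proof. exact: (big_morph nrm nrmM nrm1). Qed.

Let toC (n : int * int) : C := Complex n.1%:~R n.2%:~R.
Let gauss (z : C) := exists n, z = toC n.

Let gaussM z w : gauss z -> gauss w -> gauss (z * w).
Proof.
move=> [n ->] [m ->]; exists (n.1 * m.1 - n.2 * m.2, n.1 * m.2 + n.2 * m.1).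
by rewrite /toC /= !(rmorphB, rmorphD, rmorphM)/=; apply/eqP; rewrite eq_complex /= !eqxx.
Qed.

Let gaussD z w : gauss z -> gauss w -> gauss (z + w).
Proof.
move=> [n ->] [m ->]; exists (n + m).
by rewrite /toC /= !rmorphD; apply/eqP; rewrite eq_complex /= !eqxx.
Qed.

Let gauss1 : gauss 1.
Proof. by exists (1, 0). Qed.

Let gauss0 : gauss 0.
Proof. by exists (0, 0). Qed.

Let gaussN1 : gauss (- 1).
Proof. by exists (-1, 0); apply/eqP; rewrite eq_complex /= oppr0 !eqxx. Qed.

Let gaussX z n : gauss z -> gauss (z ^+ n).
Proof. by move=> gz; elim: n => [|n IH]; rewrite ?expr0// exprS; exact: gaussM. Qed.

Let gauss_det n (M : 'M[C]_n) : (forall i j, gauss (M i j)) -> gauss (\det M).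
Proof.
move=> gM; rewrite /determinant.
apply: (big_ind gauss) => // s _; apply: gaussM; first exact: gaussX.
by apply: (big_ind gauss).
Qed.

Let nrm_toC n : nrm (toC n) = (nsq n)%:R.
Proof. by rewrite -[RHS]/((nsq n)%:Z%:~R) nsqE rmorphD !rmorphXn. Qed.

(* The matrix with rows ..., conj z ^ 2, conj z, 1, z, z ^ 2, ... is a Vandermonde
   matrix up to powers of N, since conj z = N / z; its determinant is a nonzero
   Gaussian integer. *)
Lemma circle_points_spread (r N D : nat) (z : 'I_(2 * r).+1 -> int * int) :
  (0 < r)%N -> injective z -> (forall i, nsq (z i) = N) ->
  (forall i j, (nsq (z i - z j) <= D)%N) -> (N ^ r <= D ^ (2 * r).+1)%N.
Proof.
move=> r0 zI zN zD.
have [->|N0] := posnP N; first by rewrite exp0n.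
pose n := (2 * r).+1.
pose w i := toC (z i).
pose w' i := toC ((z i).1, - (z i).2).
pose M : 'M[C]_n := \matrix_(k, i) (if (r <= k)%N then w i ^+ (k - r) else w' i ^+ (r - k)).
pose d : 'rV[C]_n := \row_k (N%:R ^+ (r - k)).
pose e : 'rV[C]_n := \row_i (w i ^+ r).
have ww' i : w i * w' i = N%:R.
  rewrite -(zN i) -(rmorph_nat (@real_complex R)) /=.
  have -> : (nsq (z i))%:R = (nsq (z i))%:Z%:~R :> R by [].
  rewrite nsqE rmorphD !rmorphXn; apply/eqP; rewrite eq_complex /= rmorphN.
  by apply/andP; split; apply/eqP; rewrite /= ?rmorphN; ring.
(* Multiplying column i by w_i^r turns (conj w_i)^(r - k) into N^(r - k) w_i^k; the truncated
   exponent makes the factor 1 in the rows k >= r. *)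
have ME : M *m diag_mx e = diag_mx d *m Vandermonde n (\row_i w i).
  apply/matrixP => k i; rewrite mul_mx_diag mul_diag_mx !mxE.
  case: leqP => rk.
    by rewrite (eqP (_ : r - k == 0)%N) ?subn_eq0// expr0 mul1r -exprD subnK.
  rewrite -(ww' i) exprMn [w i ^+ (r - k) * _]mulrC -mulrA -exprD subnK//; exact: ltnW.
have gD : gauss (\det M).
  by apply: gauss_det => k i; rewrite mxE; case: ifP => _; apply: gaussX;
    [exists (z i)|exists ((z i).1, - (z i).2)].
have := congr1 (fun A => nrm (\det A)) ME.
rewrite !det_mulmx !det_diag det_Vandermonde !nrmM !nrm_prod.
under eq_bigr do rewrite mxE nrmX nrm_toC zN.
rewrite prodr_const card_ord.
under [in RHS]eq_bigr do rewrite mxE nrmX.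
have nN : nrm N%:R = N%:R ^+ 2.
  have zN' : nsq ((z ord0).1, - (z ord0).2) = N by rewrite -(zN ord0) /nsq /= abszN.
  by rewrite -(ww' ord0) nrmM !nrm_toC zN zN' expr2.
rewrite nN prodrXr.
rewrite -!exprM big_distrr /= sum_subn; last by rewrite /n leqW ?leq_pmull.
have nrm_w (i j : 'I_n) : nrm ((\row_k w k) 0 j - (\row_k w k) 0 i) = (nsq (z j - z i))%:R.
  rewrite !mxE -nrm_toC; congr nrm.
  by apply/eqP; rewrite eq_complex /= !rmorphB !eqxx.
under eq_bigr => i _ do (rewrite nrm_prod; under eq_bigr => j _ do rewrite nrm_w).

(* In squared moduli the identity now reads |det M|^2 N^(r n) = N^(r (r + 1)) P, with P the product
   of |z_j - z_i|^2 over all pairs. *)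
set P := \prod_(i < n) _ => detE.
have P0 : P != 0.
  rewrite prodf_seq_neq0; apply/allP => i _; apply/implyP => _.
  rewrite prodf_seq_neq0; apply/allP => j _; apply/implyP => ij.
  rewrite pnatr_eq0 nsq_eq0 subr_eq0; apply/eqP => /zI ji; move: ij; rewrite ji ltnn//.
(* There are n (n - 1) / 2 = r n pairs, because n = 2 r + 1. *)
have PD : P <= D%:R ^+ (r * n).
  have -> : (r * n = \sum_(i < n) \sum_(j < n | (i < j)%N) 1)%N.
    rewrite (exchange_big_dep xpredT)//=.
    under eq_bigr => j _.
      rewrite (big_ord_narrow (ltnW (ltn_ord j))) sum1_card card_ord.
      over.
    rewrite -(big_mkord xpredT id) bin2_sum bin2.
    by rewrite (_ : n * n.-1 = (r * n).*2)%N ?doubleK// /n; lia.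
  rewrite expr_sum; apply: ler_prod => i _.
  rewrite prodr_ge0//= expr_sum; apply: ler_prod => j _.
  by rewrite ler0n expr1 ler_nat zD.
have N0' : 0 < N%:R :> R by rewrite ltr0n.
(* The points are distinct, so the determinant is nonzero, and the norm of a nonzero Gaussian
   integer is at least 1. What remains is N^(r r) <= D^(r n), and an r-th root. *)
have det1 : 1 <= nrm (\det M).
  have : nrm (\det M) != 0.
    apply: contra_eq_neq detE => ->; rewrite mul0r eq_sym mulf_neq0//.
    by rewrite expf_neq0// gt_eqF.
  by have [m ->] := gD; rewrite nrm_toC pnatr_eq0 -lt0n ler1n.
have : N%:R ^+ (r * n) <= N%:R ^+ (r * r.+1) * D%:R ^+ (r * n) :> R.
  apply: (le_trans (y := N%:R ^+ (r * r.+1) * P)); last first.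
    by rewrite ler_pM2l// exprn_gt0.
  by rewrite -detE ler_peMl// exprn_ge0// ltW.
rewrite (_ : r * n = r * r.+1 + r * r)%N; last by rewrite -mulnDr; congr (_ * _)%N; rewrite /n; lia.
rewrite exprD ler_pM2l ?exprn_gt0// -!natrX ler_nat.
move=> h; rewrite -(@leq_exp2r _ _ r)// -!expnM.
by rewrite (_ : (2 * r).+1 * r = r * r.+1 + r * r)%N // -mulnDr mulnC; congr (_ * _)%N; lia.
Qed.
End CirclePoints.

(** For r = 1 this excludes three points in an arc of length about N^(1/6); for r of the size of log
    N it counts points in arcs of length about N^(1/4). Both cases are used. *)
Lemma circle_seq_spread (r N D : nat) (s : seq (int * int)) :
  (0 < r)%N -> uniq s -> (forall n, n \in s -> nsq n = N) ->
  (forall n m, n \in s -> m \in s -> (nsq (n - m) <= D)%N) ->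
  (D ^ (2 * r).+1 < N ^ r)%N -> (size s <= 2 * r)%N.
Proof.
move=> r0 us sN sD; rewrite ltnNge; apply: contraNT; rewrite -ltnNge => rs.
have ins (i : 'I_(2 * r).+1) : nth 0 s i \in s.
  by rewrite mem_nth// (leq_trans (ltn_ord i)).
apply: (@circle_points_spread r N D (fun i => nth 0 s i)) => //.
- move=> i j /eqP; rewrite nth_uniq ?(leq_trans (ltn_ord _))// => /eqP; exact: val_inj.
- by move=> i; exact: sN.
- by move=> i j; exact: sD.
Qed.

(** Take r with N < 2^r. Then D^(2 r + 1) < (16 D^2)^r <= N^r, because D <= N < 16^r. *)
Lemma cluster_log (N D : nat) (s : seq (int * int)) :
  (0 < N)%N -> uniq s -> (forall n, n \in s -> nsq n = N) ->
  (forall n m, n \in s -> m \in s -> (nsq (n - m) <= D)%N) ->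
  (16 * D ^ 2 <= N)%N -> (size s <= 2 * (trunc_log 2 N).+1)%N.
Proof.
move=> N0 us sN sD DN; apply: (circle_seq_spread _ us sN sD) => //.
set r := (trunc_log 2 N).+1.
have [->|D0] := posnP D; first by rewrite exp0n// expn_gt0 N0.
apply: (@leq_trans ((16 * D ^ 2) ^ r)); last by rewrite leq_exp2r.
rewrite expnMn -expnM expnS ltn_pmul2r ?expn_gt0 ?D0//.
apply: (@leq_ltn_trans N); first by nia.
apply: (leq_trans (@trunc_log_ltn 2 N isT)); by rewrite leq_exp2r.
Qed.

(** Cut out of the box [-N, N]^2, which is large enough since |x| <= x^2 for integers. *)
Definition circle (N : nat) : seq (int * int) :=
  let r := [seq k%:Z - N%:Z | k <- iota 0 (2 * N).+1] in
  [seq z <- [seq (x, y) | x <- r, y <- r] | nsq z == N].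

Lemma mem_circle N z : (z \in circle N) = (nsq z == N).
Proof.
rewrite mem_filter; apply: andb_idr => /eqP zN.
have h x : (`|x| ^ 2 <= N)%N -> x \in [seq k%:Z - N%:Z | k <- iota 0 (2 * N).+1].
  by move=> xN; apply/mapP; exists `|(x + N%:Z)%R|%N; rewrite ?mem_iota; nia.
by case: z zN => x y zN; apply: allpairs_f; apply: h; rewrite -zN ?leq_addr ?leq_addl.
Qed.

Lemma uniq_circle N : uniq (circle N).
Proof.
have ur : uniq [seq k%:Z - N%:Z | k <- iota 0 (2 * N).+1].
  by rewrite map_inj_uniq ?iota_uniq// => i j /addIr [].
by apply: filter_uniq; rewrite allpairs_uniq// => -[a b] [c d].
Qed.

(** * Gaussian factorization and the divisor bound *)

Definition gmul (z w : int * int) : int * int :=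
  (z.1 * w.1 - z.2 * w.2, z.1 * w.2 + z.2 * w.1).

Lemma nsq_gmul z w : nsq (gmul z w) = (nsq z * nsq w)%N.
Proof. by apply/eqP; rewrite -eqz_nat PoszM !nsqE /=; apply/eqP; ring. Qed.

Lemma gmulCA z w v : gmul z (gmul w v) = gmul w (gmul z v).
Proof. by congr (_, _); rewrite /=; ring. Qed.

Lemma Euclid_dvdzM (p : nat) (x y : int) : prime p ->
  (p%:Z %| x * y)%Z = (p%:Z %| x)%Z || (p%:Z %| y)%Z.
Proof. by move=> pp; rewrite !dvdzE abszM Euclid_dvdM. Qed.

(** Thue's argument. With k^2 < p < (k + 1)^2, two of the (k + 1)^2 pairs (i, j) give the same
    residue of i y - j x; their difference z is nonzero and |z|^2 <= 2 k^2 < 2 p. Then p divides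
    |z|^2 x^2, hence |z|^2, which must equal p. *)
Lemma sum2sq_of_dvd (p : nat) (x y : int) : prime p ->
  (p%:Z %| x ^+ 2 + y ^+ 2)%Z -> ~~ (p%:Z %| x)%Z -> exists z, nsq z = p.
Proof.
move=> pp pxy px.
have p0 := prime_gt0 pp.
have [k k1 k2] : exists2 k, (k ^ 2 < p)%N & (p < k.+1 ^ 2)%N.
  have ex : exists k, (p < k.+1 ^ 2)%N by exists p; lia.
  case: (ex_minnP ex) => k pk kmin; exists k => //.
  rewrite ltnNge; apply/negP => h.
  have {h} /predU1P[h|h] : (p == k ^ 2)%N || (p < k ^ 2)%N by rewrite -leq_eqVlt.
    by move: pp; rewrite h expnS expn1; case: k {pk kmin h} => [|[|k]] //; move=> /primeP[_ /(_ k.+2 (dvdn_mulr _ (dvdnn _)))]; rewrite eqn_leq; nia.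
  by case: k {pk} kmin h => // k /(_ k) kmin /kmin; rewrite ltnn.
pose f (ij : 'I_k.+1 * 'I_k.+1) : 'I_p :=
  Ordinal (ltn_pmod `|((ij.1%:Z * y - ij.2%:Z * x) %% p%:Z)%Z|%N p0).
have : ~~ injectiveb f.
  apply/injectiveP => /leq_card; rewrite card_prod !card_ord.
  by rewrite leqNgt mulnn k2.
move=> /injectivePn[[i j] [[i' j']] ne /(congr1 val) /= fE].
pose z : int * int := (i%:Z - i'%:Z, j%:Z - j'%:Z).
have z0 : z != 0.
  apply: contra ne => /eqP[]; rewrite xpair_eqE => h1 h2.
  by apply/andP; split; apply/eqP/val_inj => /=; clear -h1 h2; lia.
have zlt : (nsq z < 2 * p)%N.
  have hi (a b : 'I_k.+1) : (`|a%:Z - b%:Z| ^ 2 <= k ^ 2)%N.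
    by rewrite leq_exp2r//; have := ltn_ord a; have := ltn_ord b; clear; lia.
  by rewrite /nsq /=; move: (hi i i') (hi j j') k1; clear; lia.
have pz : (p%:Z %| z.1 * y - z.2 * x)%Z.
  rewrite (_ : _ - _ = (i%:Z * y - j%:Z * x) - (i'%:Z * y - j'%:Z * x)); last by rewrite /=; ring.
  rewrite -eqz_mod_dvd; move: fE.
  set X := _ - _; set X' := i'%:Z * _ - _.
  have pz0 : p%:Z != 0 by rewrite eqz_nat -lt0n.
  have lt_p Y : (`|(Y %% p%:Z)%Z| < p)%N.
    by have := modz_ge0 Y pz0; have := @ltz_pmod Y p%:Z; clear -p0; lia.
  rewrite !modn_small//.
  by have := modz_ge0 X pz0; have := modz_ge0 X' pz0; clear; lia.
have : (p%:Z %| (nsq z)%:Z * x ^+ 2)%Z.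
  rewrite nsqE (_ : _ * _ = z.1 ^+ 2 * (x ^+ 2 + y ^+ 2) - (z.1 * y - z.2 * x) * (z.1 * y + z.2 * x)); last by ring.
  by apply: rpredB; [exact: dvdz_mull|exact: dvdz_mulr].
rewrite !Euclid_dvdzM// (negPf px) !orbF => /dvdzP[q zq].
exists z; move: z0; rewrite -nsq_eq0 -lt0n => z0.
have : 0 < q * p%:Z by rewrite -zq.
have : q * p%:Z < 2 * p%:Z by rewrite -zq -PoszM ltz_nat.
rewrite ltr_pM2r ?ltz_nat// pmulr_lgt0 ?ltz_nat// => q2 q0.
by move: zq; rewrite (_ : q = 1) ?mul1r => [[]|]//; clear -q0 q2; lia.
Qed.

(** For q or for its conjugate, p divides the real part of conj(q) z; by Lagrange's identity it then
    divides the imaginary part, and v is conj(q) z / p. *)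
Lemma gauss_prime_dvd (p : nat) (q z : int * int) : prime p -> nsq q = p ->
  (p %| nsq z)%N -> exists v, z = gmul q v \/ z = gmul (q.1, - q.2) v.
Proof.
move=> pp qp pz.
have pz0 : p%:Z != 0 by rewrite eqz_nat -lt0n prime_gt0.
have qE : q.1 ^+ 2 + q.2 ^+ 2 = p%:Z by rewrite -nsqE qp.
have zE : (p%:Z %| z.1 ^+ 2 + z.2 ^+ 2)%Z by rewrite -nsqE dvdzE.
have key (q' : int * int) : q'.1 ^+ 2 + q'.2 ^+ 2 = p%:Z ->
    (p%:Z %| q'.1 * z.1 + q'.2 * z.2)%Z -> exists v, z = gmul q' v.
  move=> q'E /dvdzP[a aE].
  have : (p%:Z %| (q'.1 * z.2 - q'.2 * z.1) ^+ 2)%Z.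
    rewrite (_ : _ ^+ 2 = p%:Z * (z.1 ^+ 2 + z.2 ^+ 2) - (q'.1 * z.1 + q'.2 * z.2) ^+ 2).
      by apply: rpredB; [exact: dvdz_mulr|rewrite aE exprMn expr2 mulrA; exact: dvdz_mull].
    by rewrite -q'E; ring.
  rewrite Euclid_dvdzM// orbb => /dvdzP[b bE]; exists (a, b).
  case: z zE aE bE {pz} => x y /= _ aE bE; congr (_, _); apply: (mulIf pz0).
    rewrite mulrBl -!mulrA -aE -bE -q'E; ring.
  rewrite mulrDl -!mulrA -aE -bE -q'E; ring.
have : (p%:Z %| (q.1 * z.1 + q.2 * z.2) * (q.1 * z.1 + (- q.2) * z.2))%Z.
  rewrite (_ : _ * _ = q.1 ^+ 2 * (z.1 ^+ 2 + z.2 ^+ 2) - p%:Z * z.2 ^+ 2); last by rewrite -qE; ring.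
  by apply: rpredB; [exact: dvdz_mull|exact: dvdz_mulr].
rewrite Euclid_dvdzM// => /orP[/(key q qE)[v ->]|h].
  by exists v; left.
by have [|v ->] := key (q.1, - q.2) _ h; [rewrite /= sqrrN|exists v; right].
Qed.

(** Each use of [gauss_prime_dvd] removes one factor q or conj(q), and by commutativity only the
    number i of factors q has to be remembered. This covers the circle by a + 1 images of the circle
    of M. *)
Lemma circle_split (p a M : nat) (q z : int * int) : prime p -> nsq q = p ->
  nsq z = (p ^ a * M)%N -> exists i w, [/\ (i <= a)%N, nsq w = M &
    z = iter i (gmul q) (iter (a - i) (gmul (q.1, - q.2)) w)].
Proof.
move=> pp qp; elim: a z => [|a IH] z zE.
  by exists 0%N, z; rewrite zE mul1n.
have q'p : nsq (q.1, - q.2) = p by rewrite -qp /nsq /= abszN.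
have [|v [] vE] := @gauss_prime_dvd p q z pp qp.
- by rewrite zE expnS -mulnA dvdn_mulr.
- have [|i [w [ia wM v'E]]] := IH v.
    apply/eqP; rewrite -(eqn_pmul2l (prime_gt0 pp)) -{1}qp -nsq_gmul -vE zE.
    by rewrite expnS mulnA.
  by exists i.+1, w; rewrite /= -v'E.
have [|i [w [ia wM v'E]]] := IH v.
  apply/eqP; rewrite -(eqn_pmul2l (prime_gt0 pp)) -{1}q'p -nsq_gmul -vE zE.
  by rewrite expnS mulnA.
exists i, w; split=> //; first exact: leqW.
rewrite subSn//= vE v'E; move: (iter (a - i) _ w) => X.
by elim: i {ia v'E} => //= i <-; exact: gmulCA.
Qed.

(** If p is a norm, [circle_split] gives the covering. Otherwise [sum2sq_of_dvd] makes both
    coordinates of each point divisible by p: dividing by p lowers a by 2, and for a = 1 the circle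
    is empty since p does not divide M. *)
Lemma circle_prime_pow (p a M : nat) : prime p -> ~~ (p %| M)%N ->
  (size (circle (p ^ a * M)) <= a.+1 * size (circle M))%N.
Proof.
move=> pp pM; have p0 := prime_gt0 pp.
have [[q qp]|nq] := pselect (exists q, nsq q = p).
  pose F i w := iter i (gmul q) (iter (a - i) (gmul (q.1, - q.2)) w).
  rewrite -(size_iota 0 a.+1) -(size_allpairs F).
  apply: uniq_leq_size (uniq_circle _) _ => z; rewrite mem_circle => /eqP.
  move=> /(circle_split pp qp) [i [w [ia wM ->]]].
  by apply: (allpairs_f F); rewrite ?mem_iota// mem_circle wM.
have div z : (p %| nsq z)%N -> exists v, z = (p%:Z * v.1, p%:Z * v.2).
  move=> pz; have pzE : (p%:Z %| z.1 ^+ 2 + z.2 ^+ 2)%Z by rewrite -nsqE dvdzE.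
  have : (p%:Z %| z.1)%Z.
    by apply/negPn/negP => h; apply: nq; exact: (sum2sq_of_dvd pp pzE).
  have : (p%:Z %| z.2)%Z.
    by apply/negPn/negP => h; apply: nq; apply: (@sum2sq_of_dvd p z.2 z.1) => //; rewrite addrC.
  move=> /dvdzP[b bE] /dvdzP[c cE]; exists (c, b).
  by case: z bE cE {pz pzE} => x y /= -> ->; rewrite ![p%:Z * _]mulrC.
have [k] := ubnP a; elim: k a => // k IH [_|[_|a ak]].
- by rewrite mul1n mul1n.
- case E : (circle _) => [//|z s].
  have : nsq z == (p ^ 1 * M)%N by rewrite -mem_circle E mem_head.
  move=> /eqP zE; have [|v vE] := div z; first by rewrite zE expn1 dvdn_mulr.
  move: zE; rewrite vE /nsq /= !abszM !expnMn -mulnDr expn1 expnS expn1 -mulnA.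
  move=> /eqP; rewrite eqn_pmul2l// => /eqP ME.
  by move: pM; rewrite -ME dvdn_mulr.
apply: (@leq_trans (size (circle (p ^ a * M)))); last first.
  by apply: leq_trans (IH a _) _; [lia|rewrite leq_mul2r; lia].
rewrite -(size_map (fun v => (p%:Z * v.1, p%:Z * v.2)) (circle (p ^ a * M))).
apply: uniq_leq_size (uniq_circle _) _ => z; rewrite mem_circle => /eqP zE.
have [|v vE] := div z; first by rewrite zE expnS -mulnA dvdn_mulr.
rewrite vE; apply: (map_f (fun v => (p%:Z * v.1, p%:Z * v.2))); rewrite mem_circle.
move: zE; rewrite vE /nsq /= !abszM !expnMn -mulnDr -[a.+2]addn2 expnD [(p ^ a * _)%N]mulnC -mulnA.
by move=> /eqP; rewrite eqn_pmul2l// expn_gt0 p0.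
Qed.

(** With q the quotient of a by m, a + 1 <= m (q + 1) <= m 2^q. *)
Lemma exp_poly_bound (m a : nat) : (0 < m)%N -> (a.+1 ^ m <= m ^ m * 2 ^ a)%N.
Proof.
move=> m0; apply: (@leq_trans (m ^ m * 2 ^ (a %/ m * m))); last first.
  by rewrite leq_mul2l leq_exp2l// leq_divM orbT.
rewrite expnM -expnMn leq_exp2r//.
apply: (@leq_trans (m * (a %/ m).+1)); first by rewrite mulnC ltn_ceil.
by rewrite leq_mul2l ltn_expl ?orbT.
Qed.

(** Remove the full power p^a of one prime at a time. A prime p >= 2^m costs nothing, since (a +
    1)^m <= 2^(m a) <= p^a; a smaller one costs m^m by [exp_poly_bound]. Fewer than 2^m primes are
    small, so C does not depend on N. *)
Lemma circle_size_bound (m : nat) : (0 < m)%N -> exists C : nat, forall N, (0 < N)%N ->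
  (size (circle N) ^ m <= C * N)%N.
Proof.
move=> m0.
pose K := (m ^ m)%N.
pose P := (2 ^ m)%N.
have K0 : (0 < K)%N by rewrite expn_gt0 m0.
suff h n N : (N < n)%N -> (0 < N)%N ->
    (size (circle N) ^ m <= size (circle 1) ^ m * K ^ (size [seq p <- primes N | (p < P)%N]) * N)%N.
  exists (size (circle 1) ^ m * K ^ P)%N => N N0.
  apply: leq_trans (h N.+1 N (leqnn _) N0) _.
  rewrite leq_mul2r leq_mul2l leq_pexp2l ?orbT//.
  rewrite -[leqRHS](size_iota 0); apply: uniq_leq_size.
    by rewrite filter_uniq// primes_uniq.
  by move=> p; rewrite mem_filter mem_iota => /andP[].
elim: n N => // n IH N Nn N0.
have [N1|N1] := leqP N 1.
  have -> : N = 1%N by lia.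
  by rewrite muln1 leq_pmulr// expn_gt0 K0.
pose p := pdiv N; have pp : prime p := pdiv_prime N1.
have [M pM NE] := pfactor_coprime pp N0.
set a := logn p N in NE.
have a0 : (0 < a)%N by rewrite logn_gt0 pi_pdiv.
have M0 : (0 < M)%N by move: N0; rewrite NE; case: M {pM NE}.
have pa : (1 < p ^ a)%N by rewrite -(exp1n a) ltn_exp2r// prime_gt1.
have MN : (M < N)%N by rewrite NE ltn_Pmulr.
have pnM : ~~ (p %| M)%N by rewrite -prime_coprime.
have step : (size (circle N) ^ m <= a.+1 ^ m * size (circle M) ^ m)%N.
  by rewrite -expnMn leq_exp2r// NE mulnC; exact: circle_prime_pow.
apply: leq_trans step _.
have primesN : perm_eq (primes N) (p :: primes M).
  apply: uniq_perm; rewrite ?primes_uniq//=.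
    by rewrite primes_uniq andbT mem_primes; apply: contra pnM => /and3P[].
  move=> q; rewrite NE primesM// ?expn_gt0 ?prime_gt0// inE orbC.
  by rewrite primesX// primes_prime// inE.
have sz : size [seq q <- primes N | (q < P)%N] = ((p < P)%N + size [seq q <- primes M | (q < P)%N])%N.
  by rewrite (perm_size (perm_filter _ primesN)) /=; case: ifP.
rewrite sz {1}NE.
apply: leq_trans (leq_mul (leqnn _) (IH M _ M0)) _; first by lia.
have key : (a.+1 ^ m <= K ^ (p < P)%N * p ^ a)%N.
  case: ltnP => pP.
    rewrite expn1; apply: leq_trans (exp_poly_bound a m0) _; rewrite leq_mul2l leq_exp2r ?prime_gt1//.
    by rewrite orbT.
  rewrite expn0 mul1n.
  apply: (@leq_trans (P ^ a)); last by rewrite leq_exp2r.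
  by rewrite /P -expnM mulnC expnM leq_exp2r// ltn_expl.
rewrite expnD.
move: key; set X := (a.+1 ^ m)%N; set Y := (K ^ _)%N; set Z := (p ^ a)%N.
set S1 := (size _ ^ m)%N; set S2 := (K ^ _)%N => key.
rewrite (_ : S1 * (Y * S2) * (M * Z) = Y * Z * (S1 * S2 * M))%N; last by ring.
exact: leq_mul.
Qed.

(** * Sums over the points of a circle *)

Section LatticeSums.
Variable R : realType.

(** This is |k|^(1/2), since [nsq] is the squared norm; its inverse is the decay given by a nonzero
    curvature. *)
Definition root4 (k : int * int) : R := Num.sqrt (Num.sqrt (nsq k)%:R).

Lemma root4X k : root4 k ^+ 4 = (nsq k)%:R.
Proof. by rewrite (exprM _ 2 2) !sqr_sqrtr ?sqrtr_ge0 ?ler0n. Qed.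

Lemma root4_ge1 k : k != 0 -> 1 <= root4 k.
Proof.
move=> k0; rewrite -(@ler_pXn2r _ 4) ?nnegrE ?sqrtr_ge0// expr1n root4X ler1n lt0n.
by rewrite nsq_eq0.
Qed.

Fact nsq_sub_le (n m m' : int * int) :
  (nsq (m - m') <= 2 * (nsq (n - m) + nsq (n - m')))%N.
Proof.
rewrite -lez_nat PoszM PoszD !nsqE /=.
have h (a b c : int) : (b - c) ^+ 2 <= 2 * ((a - b) ^+ 2 + (a - c) ^+ 2).
  rewrite -subr_ge0 (_ : _ - _ = (2 * a - b - c) ^+ 2) ?sqr_ge0//; ring.
have := h n.1 m.1 m'.1; have := h n.2 m.2 m'.2; lia.
Qed.

(* At most one m lies within N^(1/6)/2 of n; all other points of the circle are
   so far away that the divisor bound on their number suffices. *)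
Lemma circle_root4_sum : exists C : R, 0 <= C /\ forall (N : nat) n,
  nsq n = N -> \sum_(m <- circle N | m != n) (root4 (n - m))^-1 <= C.
Proof.
have [C CP] := @circle_size_bound 12 isT.
(* The 1 is for the single close point. For the others, with exponent 12, size^12 <= C N <= 64 C |n
   - m|^6 = 64 C [root4]^12, so each term is at most 64 C / size. *)
exists (1 + (64 * C)%:R); split; first by rewrite addr_ge0.
move=> N n nN.
have r0 k : 0 <= (root4 k)^-1 by rewrite invr_ge0 sqrtr_ge0.
rewrite (bigID (fun m => (64 * nsq (n - m) ^ 3 < N)%N))/= lerD//.
  rewrite -big_filter; set s := [seq _ <- _ | _].
  have ss : (size s <= 1)%N.
    rewrite leqNgt; apply/negP; case E : s => [//|m [//|m' s']] _.
    have sP x : x \in s -> [/\ nsq x = N, x != n & (64 * nsq (n - x) ^ 3 < N)%N].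
      by rewrite mem_filter mem_circle => /andP[/andP[? ?] /eqP ?].
    have [m1 m2 m3] : [/\ nsq m = N, m != n & (64 * nsq (n - m) ^ 3 < N)%N].
      by apply: sP; rewrite E mem_head.
    have [m1' m2' m3'] : [/\ nsq m' = N, m' != n & (64 * nsq (n - m') ^ 3 < N)%N].
      by apply: sP; rewrite E !inE eqxx orbT.
    have mm' : m != m'.
      have : uniq s by rewrite filter_uniq// uniq_circle.
      by rewrite E /= inE negb_or => /andP[/andP[]].
    (* The squared distance of m and m' is at most twice the sum of those to n, hence at most D; and
       64 max^3 < N says D^3 < N, against the case r = 1 for the three points. *)
    pose D := (4 * maxn (nsq (n - m)) (nsq (n - m')))%N.
    have := @circle_seq_spread 1 N D [:: n; m; m']; rewrite /= => /(_ isT).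
    rewrite !inE negb_or eq_sym m2 eq_sym m2' mm' => /(_ isT).
    have sy a b : nsq (a - b) = nsq (b - a) by rewrite -nsqN opprB.
    have nn0 a : nsq (a - a) = 0%N by apply/eqP; rewrite nsq_eq0 subrr.
    have d1 : (nsq (n - m) <= D)%N by rewrite /D; lia.
    have d2 : (nsq (n - m') <= D)%N by rewrite /D; lia.
    have d3 : (nsq (m - m') <= D)%N by have := nsq_sub_le n m m'; rewrite /D; lia.
    have D3 : (D ^ (2 * 1).+1 < N ^ 1)%N.
      rewrite /D expn1; move: (nsq _) (nsq _) m3 m3' => a b.
      by rewrite expnMn; case: (leqP a b) => _.
    move=> h; suff : (3 <= 2)%N by [].
    apply: (h _ _ D3) => [x|x y]; rewrite !inE.
      by move=> /or3P[] /eqP->.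
    by move=> /or3P[] /eqP-> /or3P[] /eqP->; rewrite ?nn0// sy.
  rewrite -[leRHS]/(1%:R); apply: (@le_trans _ _ ((size s)%:R)); last by rewrite ler_nat.
  rewrite -sum1_size natr_sum big_seq [leRHS]big_seq ler_sum// => m.
  rewrite mem_filter => /andP[/andP[mn _] _].
  by rewrite invf_le1 ?root4_ge1 ?(lt_le_trans ltr01)// ?root4_ge1// subr_eq0 eq_sym.
rewrite -big_filter; set s := [seq _ <- _ | _].
have [->|s0] := eqVneq s [::]; first by rewrite big_nil.
have sz : (0 < size s)%N by rewrite lt0n size_eq0.
have sle : (size s <= size (circle N))%N by rewrite size_filter count_size.
have N0 : (0 < N)%N.
  rewrite lt0n; apply/eqP => N0; move: s0; rewrite -size_eq0 -lt0n -has_predT.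
  move=> /hasP[m]; rewrite mem_filter mem_circle N0 nsq_eq0 => /andP[/andP[mn _] /eqP m0] _.
  by move: mn; rewrite m0 eq_sym -nsq_eq0 nN N0.
apply: (@le_trans _ _ (\sum_(m <- s) ((64 * C)%:R / (size s)%:R))).
  rewrite big_seq [leRHS]big_seq; apply: ler_sum => m.
  rewrite mem_filter mem_circle -leqNgt => /andP[/andP[mn Nm] /eqP mN].
  have rp : 0 < root4 (n - m) by rewrite (lt_le_trans ltr01)// root4_ge1// subr_eq0 eq_sym.
  rewrite -[leLHS]mul1r ler_pdivrMr// mulrAC ler_pdivlMr ?ltr0n// mul1r.
  rewrite -(@ler_pXn2r _ 12) ?nnegrE ?mulr_ge0 ?ler0n ?(ltW rp)//.
  rewrite exprMn (exprM (root4 _) 4 3) root4X -!natrX -natrM ler_nat.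
  apply: (@leq_trans (C * N)).
    by apply: leq_trans (CP N N0); rewrite leq_exp2r.
  apply: (@leq_trans (C * (64 * nsq (n - m) ^ 3))); first by rewrite leq_mul2l Nm orbT.
  rewrite mulnA leq_mul2r; apply/orP; right.
  have [->|C0] := posnP C; first by rewrite muln0.
  by rewrite mulnC -[leqLHS]expn1 leq_pexp2l// muln_gt0.
by rewrite big_const_seq count_predT iter_addr_0 -[X in X <= _]mulr_natr divfK// pnatr_eq0 -lt0n.
Qed.

(** On one side of the direction v, the cross products satisfy (cr n - cr m)^2 <= |(cr n)^2 - (cr
    m)^2|, which on a circle is a difference of squares of scalar products, at most 2 eta |v| sqrt
    N. Hence |v|^2 |n - m|^2 <= eta^2 + 2 eta |v| sqrt N, and eta <= |v| / 16 leaves |n - m|^2 <=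
    sqrt N / 4, the range of [cluster_log]. *)
Lemma strip_count (v : R * R) (eta : R) (N : nat) (s : seq (int * int)) :
  256 * eta ^+ 2 <= v.1 ^+ 2 + v.2 ^+ 2 -> 0 <= eta -> (0 < N)%N -> uniq s ->
  (forall n, n \in s -> nsq n = N) ->
  (forall n m, n \in s -> m \in s ->
     `|(n - m).1%:~R * v.1 + (n - m).2%:~R * v.2| <= eta) ->
  0 < v.1 ^+ 2 + v.2 ^+ 2 ->
  (size s <= 4 * (trunc_log 2 N).+1)%N.
Proof.
move=> etav eta0 N0 us sN sE v0.
pose cr (n : int * int) := n.1%:~R * v.2 - n.2%:~R * v.1.
suff half (b : bool) : (size [seq n <- s | (0 <= cr n)%R == b] <= 2 * (trunc_log 2 N).+1)%N.
  rewrite -(count_predC (fun n => (0 <= cr n) == true)) -!size_filter.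
  rewrite (_ : 4 = 2 + 2)%N// mulnDl leq_add ?half//.
  rewrite (eq_filter (a2 := fun n => (0 <= cr n) == false)) ?half// => n /=.
  by case: (0 <= _).
set s' := [seq _ <- _ | _].
have s's n : n \in s' -> n \in s by rewrite mem_filter => /andP[].
have key n m : n \in s' -> m \in s' -> (16 * nsq (n - m) ^ 2 <= N)%N.
  move=> ns' ms'; have /sN nN := s's _ ns'; have /sN mN := s's _ ms'.
  have := sE _ _ (s's _ ns') (s's _ ms').
  have : (0 <= cr n) = (0 <= cr m).
    by move: ns' ms'; rewrite !mem_filter => /andP[/eqP-> _] /andP[/eqP-> _].
  have sqE (k : int * int) : (nsq k)%:R = k.1%:~R ^+ 2 + k.2%:~R ^+ 2 :> R.
    by rewrite -[LHS]/((nsq k)%:Z%:~R) nsqE rmorphD !rmorphXn.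
  pose dt (k : int * int) : R := k.1%:~R * v.1 + k.2%:~R * v.2.
  rewrite -[X in `|X|]/(dt _) => crE dE.
  have dtB : dt (n - m) = dt n - dt m by rewrite /dt /= !rmorphB /=; ring.
  have crB : cr (n - m) = cr n - cr m by rewrite /cr /= !rmorphB /=; ring.
  set nu := v.1 ^+ 2 + v.2 ^+ 2 in etav v0.
  have lag k : nu * (nsq k)%:R = dt k ^+ 2 + cr k ^+ 2.
    by rewrite sqE /nu /dt /cr; ring.
  pose L : R := Num.sqrt N%:R.
  pose V : R := Num.sqrt nu.
  have L0 : 1 <= L by rewrite -sqrtr1 ler_wsqrtr// ler1n.
  have V0 : 0 < V by rewrite sqrtr_gt0.
  have L2 : L ^+ 2 = N%:R by rewrite sqr_sqrtr.
  have V2 : V ^+ 2 = nu by rewrite sqr_sqrtr// ltW.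
  have lagn := lag n; have lagm := lag m; have lagnm := lag (n - m).
  rewrite nN in lagn; rewrite mN in lagm; rewrite dtB crB in lagnm.
  rewrite dtB in dE.
  have etaV : 16 * eta <= V.
    by rewrite -(@ler_pXn2r _ 2) ?nnegrE ?mulr_ge0// ?(ltW V0)// exprMn V2; apply: le_trans etav; rewrite -natrX.
  have dn k : dt k ^+ 2 <= nu * N%:R -> `|dt k| <= V * L.
    move=> h; rewrite -(@ler_pXn2r _ 2) ?nnegrE ?mulr_ge0 ?(ltW V0)//; last by rewrite sqrtr_ge0.
    by rewrite exprMn V2 L2 real_normK ?num_real.
  have dn1 : `|dt n| <= V * L by apply: dn; rewrite lagn lerDl sqr_ge0.
  have dm1 : `|dt m| <= V * L by apply: dn; rewrite lagm lerDl sqr_ge0.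
  have crle : (cr n - cr m) ^+ 2 <= `|cr n ^+ 2 - cr m ^+ 2|.
    rewrite ler_normr; clear -crE; move: (cr n) (cr m) crE => x y.
    case: (leP 0 x) => x0 /esym xy; apply/orP; case: (leP x y) => tt'; [right|left|left|right]; nra.
  have cr2 : cr n ^+ 2 - cr m ^+ 2 = (dt m - dt n) * (dt m + dt n).
    by move: lagn lagm; lra.
  have dE2 : `|(dt m - dt n) * (dt m + dt n)| <= eta * (2 * (V * L)).
    rewrite normrM ler_pM// ?normr_ge0// 1?distrC//.
    by apply: le_trans (ler_normD _ _) _; lra.
  have q1 : nu * (nsq (n - m))%:R <= eta ^+ 2 + eta * (2 * (V * L)).
    rewrite lagnm lerD//; last by rewrite (le_trans crle)// cr2.
    by rewrite -(@real_normK _ (dt n - dt m)) ?num_real// ler_pXn2r ?nnegrE.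
  have q2 : nu * (nsq (n - m))%:R <= nu * (L / 4).
    apply: le_trans q1 _; rewrite -V2.
    have a1 : eta ^+ 2 <= V ^+ 2 / 256 by clear -eta0 etaV V0; nra.
    have a2 : 16 * eta * (V * L) <= V * (V * L).
      by rewrite ler_wpM2r// mulr_ge0// ltW// (lt_le_trans ltr01).
    have a3 : V ^+ 2 <= V ^+ 2 * L by rewrite ler_peMr// sqr_ge0.
    have a4 := sqr_ge0 V.
    by clear -a1 a2 a3 a4; lra.
  have q3 : (nsq (n - m))%:R <= L / 4 by move: q2; rewrite ler_pM2l.
  rewrite -(ler_nat R) natrM natrX -L2.
  have q0 : 0 <= (nsq (n - m))%:R :> R by [].
  clear -q3 q0 L0; nra.
(* The bound for squared distances is the largest integer D with 16 D^2 <= N. *)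
have ex0 : exists d, (16 * d ^ 2 <= N)%N by exists 0%N.
have exb d : (16 * d ^ 2 <= N)%N -> (d <= N)%N by clear; nia.
case: (ex_maxnP ex0 exb) => D DN Dmax.
apply: (@cluster_log N D) => //; first by rewrite filter_uniq.
- by move=> n /s's /sN.
by move=> n m ns ms; apply: Dmax; exact: key.
Qed.
End LatticeSums.

(** * Integrals over sets of finite measure *)

Lemma quad_disc (R : realFieldType) (a b c : R) :
  (forall t, 0 <= a * t ^+ 2 + 2 * b * t + c) -> b ^+ 2 <= a * c.
Proof.
move=> h; have c0 : 0 <= c by have := h 0; rewrite expr0n /= !mulr0 !add0r.
have [a0|a0|a0] := ltgtP a 0.
- pose t := (c + 1 + 2 * `|b|) / (- a) + 1.
  have aE : a * t = - (c + 1 + 2 * `|b|) + a.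
    by rewrite /t mulrDr mulr1 invrN mulrN mulrN [a * _]mulrC divfK// lt_eqF.
  have t1 : 1 <= t by rewrite lerDr divr_ge0 ?oppr_ge0 ?(ltW a0)// !addr_ge0// mulr_ge0.
  have := h t; rewrite (_ : _ + c = t * (a * t + 2 * b) + c); last by ring.
  have bb := ler_norm b; rewrite aE => ?; exfalso; nra.
- have := h (- b / a); rewrite (_ : _ + c = c - b ^+ 2 / a); last first.
    by field; rewrite gt_eqF.
  by rewrite subr_ge0 ler_pdivrMr// mulrC.
- subst a; rewrite mul0r; have [->|b0] := eqVneq b 0; first by rewrite expr0n.
  have := h (- (c + 1) / (2 * b)); rewrite mul0r add0r.
  rewrite [2 * b * _]mulrC divfK ?mulf_neq0// ?pnatr_eq0//; lra.
Qed.

Section FiniteIntegral.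
Context d (T : measurableType d) (R : realType) (mu : {measure set T -> \bar R}).
Variables (D : set T) (mD : measurable D) (muD : (mu D < +oo)%E).
Local Notation igb f := (mu.-integrable D (EFin \o f)).
Local Notation I f := (\int[mu]_(x in D) f x).

Implicit Types f g : T -> R.

(** Measurability is recorded apart because it does not follow from that of the square. *)
Definition sqint (f : T -> R) :=
  measurable_fun D f /\ igb (fun x => f x ^+ 2).

Lemma igbD f g : igb f -> igb g -> igb (fun x => f x + g x).
Proof.
move=> hf hg; have := integrableD mD hf hg.
by apply: eq_integrable => // x _ /=; rewrite EFinD.
Qed.

Lemma igbZ k f : igb f -> igb (fun x => k * f x).
Proof.
move=> hf; have := integrableZl mD k hf.
by apply: eq_integrable => // x _ /=; rewrite EFinM.
Qed.

Lemma igbN f : igb f -> igb (fun x => - f x).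
Proof. by move=> /(igbZ (-1)); apply: eq_integrable => // x _ /=; rewrite mulN1r. Qed.

Lemma igbB f g : igb f -> igb g -> igb (fun x => f x - g x).
Proof. by move=> hf /igbN; exact: igbD. Qed.

Lemma igb_cst (c : R) : igb (cst c).
Proof.
apply: measurable_bounded_integrable => //; exists `|c|; split; first exact: num_real.
by move=> M cM x _ /=; exact: ltW.
Qed.

Lemma igb_sum (J : Type) (s : seq J) (h : J -> T -> R) :
  (forall j, igb (h j)) -> igb (fun x => \sum_(j <- s) h j x).
Proof.
move=> hh; elim: s => [|j s IH].
  by have := igb_cst 0; apply: eq_integrable => // x _ /=; rewrite big_nil.
by have := igbD (hh j) IH; apply: eq_integrable => // x _ /=; rewrite big_cons.
Qed.

Lemma igb_measurable f : igb f -> measurable_fun D f.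
Proof. by move=> /measurable_int /measurable_EFinP. Qed.

Lemma igb_le f g : measurable_fun D f -> (forall x, D x -> `|f x| <= g x) ->
  igb g -> igb f.
Proof.
move=> mf fg; apply: (le_integrable mD (g := EFin \o g)); first exact/measurable_EFinP.
by move=> x Dx /=; rewrite lee_fin (le_trans (fg _ Dx))// ler_norm.
Qed.

Lemma igb_bounded f (M : R) : measurable_fun D f -> (forall x, D x -> `|f x| <= M) -> igb f.
Proof. by move=> mf fM; apply: igb_le mf fM (igb_cst M). Qed.

Lemma I_D f g : igb f -> igb g -> I (fun x => f x + g x) = I f + I g.
Proof. exact: RintegralD. Qed.

Lemma I_B f g : igb f -> igb g -> I (fun x => f x - g x) = I f - I g.
Proof. exact: RintegralB. Qed.

Lemma I_Z k f : igb f -> I (fun x => k * f x) = k * I f.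
Proof. by move=> hf; rewrite RintegralZl. Qed.

Lemma I_sum (J : Type) (s : seq J) (h : J -> T -> R) : (forall j, igb (h j)) ->
  I (fun x => \sum_(j <- s) h j x) = \sum_(j <- s) I (h j).
Proof.
move=> hh; elim: s => [|j s IH].
  rewrite big_nil; under eq_Rintegral do rewrite big_nil.
  by rewrite Rintegral_cst// mul0r.
rewrite big_cons -IH -I_D//; last exact: igb_sum.
by apply: eq_Rintegral => x _; rewrite big_cons.
Qed.

Lemma I_le f g : igb f -> igb g -> (forall x, D x -> f x <= g x) -> I f <= I g.
Proof. exact: le_Rintegral. Qed.

Lemma I_ge0 f : (forall x, D x -> 0 <= f x) -> 0 <= I f.
Proof. exact: Rintegral_ge0. Qed.

Lemma eq_I f g : (forall x, D x -> f x = g x) -> I f = I g.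
Proof. by move=> fg; apply: eq_Rintegral => x /[!inE]; exact: fg. Qed.

Lemma sqint_mul f g : sqint f -> sqint g -> igb (fun x => f x * g x).
Proof.
move=> [mf hf] [mg hg]; apply: igb_le (igbD hf hg); first exact: measurable_funM.
move=> x _; rewrite normrM -(real_normK (num_real (f x))) -(real_normK (num_real (g x))).
by move: `|f x| `|g x| (normr_ge0 (f x)) (normr_ge0 (g x)) => u v; nra.
Qed.

Lemma sqint_bounded f (M : R) : measurable_fun D f -> (forall x, D x -> `|f x| <= M) ->
  sqint f.
Proof.
move=> mf fM; split => //; apply: (@igb_bounded _ (M ^+ 2)) => [|x Dx].
  exact: measurable_funX.
by rewrite normrX lerXn2r// ?nnegrE ?(le_trans (normr_ge0 _) (fM _ Dx))// fM.
Qed.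

Lemma sqint_igb f : sqint f -> igb f.
Proof.
move=> hf; have h1 : sqint (cst 1) by apply: (@sqint_bounded _ 1) => // x _; rewrite normr1.
by have := sqint_mul hf h1; apply: eq_integrable => // x _ /=; rewrite mulr1.
Qed.

Lemma I_cauchy f g : sqint f -> sqint g ->
  I (fun x => f x * g x) ^+ 2 <= I (fun x => f x ^+ 2) * I (fun x => g x ^+ 2).
Proof.
move=> hf hg; apply: quad_disc => t.
have fg := sqint_mul hf hg.
have -> : I (fun x => f x ^+ 2) * t ^+ 2 + 2 * I (fun x => f x * g x) * t + I (fun x => g x ^+ 2)
  = I (fun x => (t * f x + g x) ^+ 2).
  rewrite (@eq_I (fun x => (t * f x + g x) ^+ 2)
    (fun x => t ^+ 2 * f x ^+ 2 + (2 * t) * (f x * g x) + g x ^+ 2)); last by move=> x _; ring.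
  rewrite I_D ?I_D ?I_Z//; try exact: igbD (igbZ _ _) (igbZ _ _).
  - by rewrite [t ^+ 2 * _]mulrC -!mulrA [t * _]mulrC.
  - exact: hf.2.
  - by apply: igbZ; exact: hf.2.
  - exact: igbZ.
  - by apply: igbD; apply: igbZ => //; exact: hf.2.
  - exact: hg.2.
by apply: I_ge0 => x _; exact: sqr_ge0.
Qed.
End FiniteIntegral.

(** * Trigonometric polynomials on the torus *)

Lemma Rintegral_FTC (R : realType) (F f : R -> R) (a b : R) : a < b ->
  (forall x, a <= x <= b -> is_derive x 1 F (f x)) ->
  (forall x, a <= x <= b -> {for x, continuous f}) ->
  \int[@lebesgue_measure R]_(x in `[a, b]%classic) f x = F b - F a.
Proof.
move=> ab dF cf.
have cF x : a <= x <= b -> F y @[y --> x] --> F x.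
  move=> /dF dFx; apply: differentiable_continuous; apply/derivable1_diffP.
  exact: ex_derive.
have aab : a <= a <= b by rewrite lexx ltW.
have bab : a <= b <= b by rewrite lexx ltW.
rewrite /Rintegral (@continuous_FTC2 _ f F a b)//.
- apply: continuous_in_subspaceT => x /[!inE]/=; rewrite in_itv/=; exact: cf.
- split.
  + move=> x /[!in_itv]/= /andP[ax xb]; have := dF x; rewrite !ltW// => /(_ isT) h.
    exact: ex_derive.
  + exact/cvg_at_right_filter/cF.
  + exact/cvg_at_left_filter/cF.
move=> x /[!in_itv]/= /andP[ax xb]; rewrite derive1E; have := dF x; rewrite !ltW// => /(_ isT) h.
exact: derive_val.
Qed.

Section TorusTrig.
Variable R : realType.

Lemma sin_period (k : int) (x : R) : sin (x + 2 * pi * k%:~R) = sin x.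
Proof.
have h (n : nat) (y : R) : sin (y + 2 * pi * n%:R) = sin y.
  by rewrite (_ : 2 * pi * n%:R = pi *+ 2 *+ n) ?(periodicn (@sinD2pi R))// -mulr_natr -[pi *+ 2]mulr_natr; ring.
case: k => n; first exact: h.
by rewrite -[RHS](h n.+1) -[in LHS](h n.+1) NegzE rmorphN /= mulrN subrK h.
Qed.

Lemma cos_period (k : int) (x : R) : cos (x + 2 * pi * k%:~R) = cos x.
Proof. by rewrite -!sinDpihalf addrAC sin_period. Qed.

Lemma Rintegral_cos_period (k : int) (c : R) : k != 0 ->
  \int[@lebesgue_measure R]_(x in `[0, 2 * pi]%classic) cos (c + k%:~R * x) = 0.
Proof.
move=> k0; have k0' : k%:~R != 0 :> R by rewrite intr_eq0.
have dF x : 0 <= x <= 2 * pi ->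
    is_derive x 1 (fun y : R => sin (c + k%:~R * y) / k%:~R) (cos (c + k%:~R * x)).
  move=> _; apply: is_derive_eq.
  by rewrite /GRing.scale /=; field.
have cf x : 0 <= x <= 2 * pi -> {for x, continuous (fun y : R => cos (c + k%:~R * y))}.
  move=> _; apply: continuous_comp; last exact: continuous_cos.
  by apply: cvgD; [exact: cvg_cst|apply: cvgM; [exact: cvg_cst|exact: cvg_id]].
rewrite (Rintegral_FTC _ dF cf) ?mulr_gt0 ?pi_gt0//.
by rewrite [k%:~R * (2 * pi)]mulrC sin_period mulr0 addr0 subrr.
Qed.

Definition dotp (k : int * int) (x : R * R) : R := k.1%:~R * x.1 + k.2%:~R * x.2.

Local Notation plane := (measurableTypeR R * measurableTypeR R)%type.

Lemma dotp_measurable k (D : set plane) : measurable_fun D (dotp k : plane -> R).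
Proof.
apply: measurable_funS (subsetT _) _ => //.
apply: measurable_funD; apply: measurable_funM => //.
Qed.

Lemma cos_dotp_measurable k (D : set plane) :
  measurable_fun D (fun x : plane => cos (dotp k x)).
Proof.
apply: measurableT_comp; last exact: dotp_measurable.
by apply: continuous_measurable_fun; exact: continuous_cos.
Qed.

Lemma sin_dotp_measurable k (D : set plane) :
  measurable_fun D (fun x : plane => sin (dotp k x)).
Proof.
apply: measurableT_comp; last exact: dotp_measurable.
by apply: continuous_measurable_fun; exact: continuous_sin.
Qed.

Lemma measurable_square : measurable (@square R : set plane).
Proof. by apply: measurableX; exact: measurable_itv. Qed.

Lemma area_square : area R (@square R) = ((2 * pi) ^+ 2)%:E.
Proof.
have mI : measurable (`[0, 2 * pi] : set (measurableTypeR R)) by exact: measurable_itv.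
apply: etrans (product_measure1E (@lebesgue_measure R) (@lebesgue_measure R) mI mI) _.
have LI : lebesgue_measure (`[0, 2 * pi] : set R) = (2 * pi)%:E.
  by rewrite lebesgue_measure_itv/= lte_fin mulr_gt0 ?pi_gt0// oppr0 adde0.
by transitivity ((2 * pi)%:E * (2 * pi)%:E : \bar R)%E; [congr (_ * _)%E; exact: LI|rewrite -EFinM].
Qed.

Lemma area_square_fin : (area R (@square R) < +oo)%E.
Proof. by rewrite area_square ltry. Qed.

Local Notation igb f := ((area R).-integrable (@square R) (EFin \o f)).
Local Notation I f := (\int[area R]_(x in @square R) f x).

(** Fubini for the extension by zero. The alternative is there because a nonzero frequency has a
    nonzero coordinate, but not a prescribed one. *)
Lemma Rintegral_square0 (f : R * R -> R) : measurable_fun setT (f : plane -> R) ->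
  (exists M, forall x, `|f x| <= M) ->
  (forall x : R, 0 <= x <= 2 * pi -> \int[@lebesgue_measure R]_(y in `[0, 2 * pi]) f (x, y) = 0) \/
  (forall y : R, 0 <= y <= 2 * pi -> \int[@lebesgue_measure R]_(x in `[0, 2 * pi]) f (x, y) = 0) ->
  I f = 0.
Proof.
move=> mf [M fM] h.
have igbf : igb f.
  apply: (igb_bounded measurable_square area_square_fin (M := M)) => //.
  exact: measurable_funS mf.
rewrite /Rintegral integral_mkcond.
have/(integrable_mkcond _ measurable_square) igf := igbf.
(* The real integral is [fine] of the extended one, which also sends infinity to 0; finiteness has
   to be checked before the slice is known to vanish. *)
have sliceE (g : R -> R) : (forall x, `|g x| <= M) ->
    measurable_fun setT g -> \int[@lebesgue_measure R]_(y in `[0, 2 * pi]) g y = 0 ->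
    (\int[@lebesgue_measure R]_(y in `[0%R, (2 * pi)%R]) (g y)%:E)%E = 0%E.
  move=> gM mg g0; rewrite -[LHS]fineK; first by rewrite -[fine _]/(Rintegral _ _ _) g0.
  apply: integrable_fin_num => //; apply: igb_bounded; last by move=> x _; exact: gM.
  - exact: measurable_itv.
  - suff : (lebesgue_measure (`[0%R, (2 * pi)%R] : set R) < +oo)%E by [].
    by rewrite lebesgue_measure_itv/=; case: ifP => _; rewrite -?EFinD ltry.
  - exact: measurable_funS mg.
have sq (x y : R) : @square R (x, y) <-> (0 <= x <= 2 * pi) /\ (0 <= y <= 2 * pi).
  by rewrite /square /= !in_itv.
case: h => h.
  rewrite -(integral12_prod_meas1 igf).
  rewrite integral0_eq// => x _; rewrite /fubini_F.
  have [x0|x0] := boolP (0 <= x <= 2 * pi); last first.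
    rewrite integral0_eq// => y _; rewrite patchE memNset// => /sq[xx _].
    by rewrite xx in x0.
  rewrite -[RHS](sliceE (fun y => f (x, y))) ?h//; last exact: measurableT_comp mf (pair1_measurable _).
  rewrite [RHS]integral_mkcond; apply: eq_integral => y _; rewrite !patchE.
  case: ifPn => [/set_mem/sq[_ yy]|yy]; first by rewrite mem_set//= in_itv.
  rewrite memNset//= in_itv => /= y0; apply/negP: yy; rewrite mem_set//; exact/sq.
rewrite -(integral21_prod_meas1 igf).
rewrite integral0_eq// => x _; rewrite /fubini_G.
have [x0|x0] := boolP (0 <= x <= 2 * pi); last first.
  rewrite integral0_eq// => y _; rewrite patchE memNset// => /sq[_ xx].
  by rewrite xx in x0.
rewrite -[RHS](sliceE (fun y => f (y, x))) ?h//; last exact: measurableT_comp mf (pair2_measurable _).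
rewrite [RHS]integral_mkcond; apply: eq_integral => y _; rewrite !patchE.
case: ifPn => [/set_mem/sq[yy _]|yy]; first by rewrite mem_set//= in_itv.
rewrite memNset//= in_itv => /= y0; apply/negP: yy; rewrite mem_set//; exact/sq.
Qed.

Lemma Rintegral_cos (k : int * int) : I (fun x => cos (dotp k x)) = (k == 0)%:R * (2 * pi) ^+ 2.
Proof.
have [->|k0] := eqVneq k 0.
  rewrite mul1r; under eq_Rintegral do rewrite /dotp /= !mul0r addr0 cos0.
  by rewrite Rintegral_cst// ?area_square ?mul1r//; exact: measurable_square.
rewrite mul0r; apply: Rintegral_square0.
- by apply: cos_dotp_measurable.
- by exists 1 => x; rewrite ler_norml cos_geN1 cos_le1.
have k12 : (k.1 != 0) || (k.2 != 0).
  by move: k0; case: k => a b; rewrite xpair_eqE negb_and.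
case/orP: k12 => h; [right|left] => x _; rewrite /dotp /=.
  by under eq_Rintegral do rewrite addrC; rewrite Rintegral_cos_period.
by rewrite Rintegral_cos_period.
Qed.

Lemma Rintegral_sin (k : int * int) : I (fun x => sin (dotp k x)) = 0.
Proof.
have [->|k0] := eqVneq k 0.
  under eq_Rintegral do rewrite /dotp /= !mul0r addr0 sin0.
  by rewrite Rintegral_cst ?mul0r//; exact: measurable_square.
apply: Rintegral_square0.
- by apply: sin_dotp_measurable.
- by exists 1 => x; rewrite ler_norml sin_geN1 sin_le1.
have k12 : (k.1 != 0) || (k.2 != 0).
  by move: k0; case: k => a b; rewrite xpair_eqE negb_and.
have sE (x : R) : sin x = cos (- (pi / 2) + x) by rewrite addrC cosBpihalf.
case/orP: k12 => h; [right|left] => x _; rewrite /dotp /=.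
  by under eq_Rintegral do rewrite sE addrCA addrC; rewrite Rintegral_cos_period.
by under eq_Rintegral do rewrite sE addrA; rewrite Rintegral_cos_period.
Qed.
End TorusTrig.

Lemma weighted_sum_sqr (R : realFieldType) (J : Type) (s : seq J) (p x : J -> R) :
  (forall j, 0 <= p j) ->
  (\sum_(j <- s) p j * x j) ^+ 2 <= (\sum_(j <- s) p j) * (\sum_(j <- s) p j * x j ^+ 2).
Proof.
move=> p0; apply: quad_disc => t.
have -> : (\sum_(j <- s) p j) * t ^+ 2 + 2 * (\sum_(j <- s) p j * x j) * t +
    \sum_(j <- s) p j * x j ^+ 2 = \sum_(j <- s) p j * (t + x j) ^+ 2.
  rewrite mulr_suml mulr_sumr mulr_suml -!big_split /=.
  by apply: eq_bigr => j _; ring.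
by apply: sumr_ge0 => j _; rewrite mulr_ge0// sqr_ge0.
Qed.

Lemma sum_sqr_le_size (R : realFieldType) (J : Type) (s : seq J) (x : J -> R) :
  (\sum_(j <- s) x j) ^+ 2 <= (size s)%:R * \sum_(j <- s) x j ^+ 2.
Proof.
have := @weighted_sum_sqr R J s (fun _ => 1) x (fun _ => ler01).
under eq_bigr do rewrite mul1r.
under [X in _ * X]eq_bigr do rewrite mul1r.
by rewrite big_const_seq count_predT iter_addr_0.
Qed.

Lemma sum_fibers (V : nmodType) (J K : eqType) (p : seq J) (r : seq K)
    (f : J -> K) (F : J -> V) :
  uniq r -> (forall j, j \in p -> f j \in r) ->
  \sum_(j <- p) F j = \sum_(k <- r) \sum_(j <- p | f j == k) F j.
Proof.
move=> ur fr; rewrite (exchange_big_dep xpredT)//= big_seq [RHS]big_seq.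
apply: eq_bigr => j jp; rewrite big_mkcond (bigD1_seq (f j)) ?fr//= eqxx.
by rewrite big1 ?addr0// => k; rewrite eq_sym => /negPf ->.
Qed.

Section TrigPoly.
Variable R : realType.
Local Notation I f := (\int[area R]_(x in @square R) f x).
Local Notation igb f := ((area R).-integrable (@square R) (EFin \o f)).
Local Notation plane := (measurableTypeR R * measurableTypeR R)%type.
Local Notation A := ((2 * pi) ^+ 2 : R).
Implicit Types (s : seq (int * int)) (a b : int * int -> R).

Let mD : measurable (@square R : set plane) := @measurable_square R.
Let muD := @area_square_fin R.

Definition trigp (s : seq (int * int)) (a b : int * int -> R) (x : R * R) : R :=
  \sum_(n <- s) (a n * cos (dotp n x) + b n * sin (dotp n x)).

Definition energy (s : seq (int * int)) (a b : int * int -> R) : R :=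
  \sum_(n <- s) (a n ^+ 2 + b n ^+ 2).

Lemma energy_ge0 s a b : 0 <= energy s a b.
Proof. by apply: sumr_ge0 => n _; rewrite addr_ge0// sqr_ge0. Qed.

Lemma trigp_measurable s a b (D : set plane) : measurable_fun D (trigp s a b : plane -> R).
Proof.
apply: measurable_sum => n; apply: measurable_funD; apply: measurable_funM => //.
  exact: cos_dotp_measurable.
exact: sin_dotp_measurable.
Qed.

Lemma normr_trigp_term (a b t : R) : `|a * cos t + b * sin t| <= `|a| + `|b|.
Proof.
apply: le_trans (ler_normD _ _) _; rewrite !normrM.
by apply: lerD; rewrite ler_piMr// ler_norml ?cos_geN1 ?cos_le1 ?sin_geN1 ?sin_le1.
Qed.

Lemma trigp_bounded s a b x : `|trigp s a b x| <= \sum_(n <- s) (`|a n| + `|b n|).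
Proof.
apply: le_trans (ler_norm_sum _ _ _) _; apply: ler_sum => n _.
exact: normr_trigp_term.
Qed.

Lemma cos_dotp_sqint n : sqint (area R) (@square R) (fun x => cos (dotp n x)).
Proof.
apply: (sqint_bounded mD muD (M := 1)); first exact: cos_dotp_measurable.
by move=> x _; rewrite ler_norml cos_geN1 cos_le1.
Qed.

Lemma sin_dotp_sqint n : sqint (area R) (@square R) (fun x => sin (dotp n x)).
Proof.
apply: (sqint_bounded mD muD (M := 1)); first exact: sin_dotp_measurable.
by move=> x _; rewrite ler_norml sin_geN1 sin_le1.
Qed.

Lemma trigp_sqint s a b : sqint (area R) (@square R) (trigp s a b).
Proof.
apply: (sqint_bounded mD muD); first exact: trigp_measurable.
by move=> x _; exact: trigp_bounded.
Qed.

Lemma I_trigp_sum (J : Type) (p : seq J) (k : J -> int * int) (a b : J -> R) :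
  I (fun x => \sum_(j <- p) (a j * cos (dotp (k j) x) + b j * sin (dotp (k j) x)))
  = A * \sum_(j <- p) (k j == 0)%:R * a j.
Proof.
have h1 j : igb (fun x => cos (dotp (k j) x)) by apply: (sqint_igb mD muD); exact: cos_dotp_sqint.
have h2 j : igb (fun x => sin (dotp (k j) x)) by apply: (sqint_igb mD muD); exact: sin_dotp_sqint.
rewrite (I_sum mD muD); last first.
  by move=> j; apply: igbD => //; exact: igbZ.
rewrite mulr_sumr; apply: eq_bigr => j _.
rewrite (I_D mD (igbZ mD (a j) (h1 j)) (igbZ mD (b j) (h2 j))) !(I_Z mD)//.
by rewrite Rintegral_cos Rintegral_sin mulr0 addr0; ring.
Qed.

Let pairs (s : seq (int * int)) := [seq (n, m) | n <- s, m <- s].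

(* |F|^2 for F = sum_n (a_n - i b_n) e^(i n.x), whose real part is [trigp s a b]. *)
Lemma trigp_sqr_add s a b x : trigp s a b x ^+ 2 + trigp s (fun n => - b n) a x ^+ 2 =
  \sum_(q <- pairs s) ((a q.1 * a q.2 + b q.1 * b q.2) * cos (dotp (q.1 - q.2) x)
    + (b q.1 * a q.2 - a q.1 * b q.2) * sin (dotp (q.1 - q.2) x)).
Proof.
rewrite big_allpairs_dep /= !expr2 /trigp !mulr_suml -big_split /=.
apply: eq_bigr => n _; rewrite !mulr_sumr -big_split /=; apply: eq_bigr => m _.
have -> : dotp (n - m) x = dotp n x - dotp m x by rewrite /dotp /= !rmorphB /=; ring.
by rewrite cosB sinB; ring.
Qed.

Lemma I_trigp_sqr_add s a b : uniq s ->
  I (fun x => trigp s a b x ^+ 2 + trigp s (fun n => - b n) a x ^+ 2) = A * energy s a b.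
Proof.
move=> us; rewrite (@eq_I _ _ _ (area R) (@square R) _ _ (fun x _ => trigp_sqr_add s a b x)) I_trigp_sum; congr (_ * _).
rewrite big_allpairs_dep /= big_seq [RHS]big_seq; apply: eq_bigr => n ns.
rewrite (bigD1_seq n)//= big1 ?addr0 ?subrr ?eqxx ?mul1r -?expr2//.
by move=> m mn; rewrite subr_eq0 eq_sym (negPf mn) mul0r.
Qed.

(** There is no equality in general: if n and -n both lie in s, their cosines are not orthogonal.
    Adding the square of the conjugate polynomial gives |F|^2, where the exponentials are
    orthogonal. *)
Lemma I_trigp_sqr s a b : uniq s -> I (fun x => trigp s a b x ^+ 2) <= A * energy s a b.
Proof.
move=> us; rewrite -I_trigp_sqr_add//; apply: (I_le mD).
- exact: (trigp_sqint s a b).2.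
- by apply: (igbD mD); exact: (trigp_sqint _ _ _).2.
by move=> x _; rewrite lerDl sqr_ge0.
Qed.

(* The fourth moment is the second moment of |F|^2, whose k-th coefficient is a
   sum over the n with n and n - k in s. *)
Lemma I_trigp_pow4 (s : seq (int * int)) a b (c : nat) : uniq s ->
  (forall k : int * int, k != 0 -> (size [seq n <- s | (n - k)%R \in s] <= c)%N) ->
  I (fun x => trigp s a b x ^+ 4) <= A * (c.+1%:R * energy s a b ^+ 2).
Proof.
move=> us sc; set E := energy s a b.
pose r : seq (int * int) := undup [seq q.1 - q.2 | q <- pairs s].
have ur : uniq r by exact: undup_uniq.
pose al (k : int * int) := \sum_(q <- pairs s | q.1 - q.2 == k) (a q.1 * a q.2 + b q.1 * b q.2).
pose be (k : int * int) := \sum_(q <- pairs s | q.1 - q.2 == k) (b q.1 * a q.2 - a q.1 * b q.2).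
have GE x : trigp s a b x ^+ 2 + trigp s (fun n => - b n) a x ^+ 2 = trigp r al be x.
  rewrite trigp_sqr_add (@sum_fibers _ _ _ _ r (fun q => q.1 - q.2))//; last first.
    by move=> q qp; rewrite mem_undup; exact: map_f.
  apply: eq_bigr => k _; rewrite /al /be !mulr_suml -big_split /=.
  by apply: eq_bigr => q /eqP ->.
apply: (@le_trans _ _ (I (fun x => trigp r al be x ^+ 2))).
  apply: (I_le mD).
  - apply: (igb_bounded mD muD (M := (\sum_(n <- s) (`|a n| + `|b n|)) ^+ 4)).
      by apply: measurable_funX; exact: trigp_measurable.
    move=> y _; rewrite normrX lerXn2r// ?nnegrE ?normr_ge0 ?trigp_bounded//.
    by apply: sumr_ge0 => n _; rewrite addr_ge0.
  - exact: (trigp_sqint r al be).2.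
  move=> x _; rewrite -GE (exprM _ 2 2) lerXn2r ?nnegrE ?addr_ge0 ?sqr_ge0//.
  by rewrite lerDl sqr_ge0.
apply: le_trans (I_trigp_sqr _ _ ur) _; rewrite ler_pM2l ?exprn_gt0 ?mulr_gt0 ?pi_gt0//.
pose e2 (q : (int * int) * (int * int)) := (a q.1 ^+ 2 + b q.1 ^+ 2) * (a q.2 ^+ 2 + b q.2 ^+ 2).
have e20 q : 0 <= e2 q by rewrite mulr_ge0 ?addr_ge0 ?sqr_ge0.
have EE : E ^+ 2 = \sum_(q <- pairs s) e2 q.
  by rewrite big_allpairs_dep /= expr2 /E /energy mulr_suml; apply: eq_bigr => n _; rewrite mulr_sumr.
have uP : uniq (pairs s) by rewrite allpairs_uniq// => -[? ?] [? ?].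
(* For k nonzero at most c pairs have difference k, and (a a' + b b')^2 + (b a' - a b')^2 is exactly
   the product of the two energies. *)
have termle (k : int * int) : k != 0 -> al k ^+ 2 + be k ^+ 2 <= c%:R * \sum_(q <- pairs s | q.1 - q.2 == k) e2 q.
  move=> k0; rewrite /al /be -[X in X ^+ 2 + _]big_filter -[X in _ + X ^+ 2]big_filter -[X in _ * X]big_filter.
  set p := [seq _ <- _ | _].
  have szp : (size p <= c)%N.
    apply: leq_trans (sc k k0); rewrite -(size_map fst); apply: uniq_leq_size.
      rewrite map_inj_in_uniq ?filter_uniq// => -[n m] [n' m'].
      rewrite !mem_filter /= => /andP[/eqP <- _] /andP[/eqP h _] nn; subst n'.
      by move/addrI/oppr_inj: h => ->.
    move=> _ /mapP[[n m] + ->]; rewrite mem_filter => /andP[/= /eqP <- /allpairsP[[n' m'] [/= ? ? [-> ->]]]].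
    by rewrite mem_filter subKr; apply/andP.
  apply: le_trans (lerD (sum_sqr_le_size _ _) (sum_sqr_le_size _ _)) _.
  rewrite -mulrDr -big_split /=; apply: ler_pM.
  - by [].
  - by apply: sumr_ge0 => q _; rewrite addr_ge0 ?sqr_ge0.
  - by rewrite ler_nat.
  - by apply: ler_sum => q _; rewrite le_eqVlt; apply/orP; left; apply/eqP; rewrite /e2; ring.
(* Frequency 0 collects the diagonal pairs and contributes E^2 by itself, whence c + 1. *)
have [r0|r0] := boolP (0 \in r).
  rewrite /energy (bigD1_seq 0)//= -natr1 addrC mulrDl mul1r lerD//.
    rewrite EE (@sum_fibers _ _ _ _ r (fun q => q.1 - q.2))//; last first.
      by move=> q qp; rewrite mem_undup; exact: map_f.
    rewrite mulr_sumr [leRHS](bigD1_seq 0)//= -[leLHS]add0r lerD ?ler_sum//.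
    by rewrite mulr_ge0// sumr_ge0.
  have diag (F : (int * int) * (int * int) -> R) :
      \sum_(q <- pairs s | q.1 - q.2 == 0) F q = \sum_(n <- s) F (n, n).
    rewrite big_mkcond big_allpairs_dep /= big_seq [RHS]big_seq; apply: eq_bigr => n ns.
    rewrite (bigD1_seq n)//= subrr eqxx big1 ?addr0// => m mn.
    by rewrite subr_eq0 eq_sym (negPf mn).
  rewrite /al /be !diag /= [X in _ + X ^+ 2]big1 ?expr0n ?addr0//; last by move=> n _; ring.
apply: (@le_trans _ _ (c%:R * E ^+ 2)); last by rewrite ler_wpM2r ?sqr_ge0// ler_nat.
rewrite EE (@sum_fibers _ _ _ _ r (fun q => q.1 - q.2))//; last first.
  by move=> q qp; rewrite mem_undup; exact: map_f.
rewrite mulr_sumr /energy big_seq [leRHS]big_seq; apply: ler_sum => k kr.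
by apply: termle; apply: contraNneq r0 => <-.
Qed.
End TrigPoly.

Section SmoothTrig.
Variable R : realType.

Fact dotp_is_linear (k : int * int) : linear (@dotp R k : R * R -> R^o).
Proof. by move=> a x y; rewrite /dotp /= /GRing.scale /=; ring. Qed.

HB.instance Definition _ (k : int * int) :=
  GRing.isLinear.Build R (R * R)%type R^o *:%R (@dotp R k) (dotp_is_linear k).

Lemma dotp_continuous (k : int * int) : continuous (@dotp R k : R * R -> R).
Proof.
move=> x; apply: cvgD; apply: cvgM; try exact: cvg_cst.
  exact: cvg_fst.
exact: cvg_snd.
Qed.

Lemma is_diff_dotp (k : int * int) (x : R * R) : is_diff x (@dotp R k : R * R -> R^o) (@dotp R k : R * R -> R^o).
Proof.
have h := @diff_lin R (R * R)%type R^o (@dotp R k) x (@dotp_continuous k).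
by apply: DiffDef => //; exact: linear_differentiable (@dotp_continuous k).
Qed.

Lemma trig1_derive (k : int * int) (a b : R) (v x : R * R) :
  differentiable (fun y : R * R => a * cos (dotp k y) + b * sin (dotp k y)) x /\
  'D_v (fun y : R * R => a * cos (dotp k y) + b * sin (dotp k y)) x =
    (b * dotp k v) * cos (dotp k x) + (- a * dotp k v) * sin (dotp k x).
Proof.
have h := is_diff_dotp k x.
pose F (t : R) : R^o := a * cos t + b * sin t.
have dF : is_derive (dotp k x) 1 F (b * cos (dotp k x) - a * sin (dotp k x)).
  by apply: is_derive_eq; rewrite /GRing.scale /=; ring.
have dF' : is_diff (dotp k x) F (fun t => t *: (b * cos (dotp k x) - a * sin (dotp k x))).
  have dFx : differentiable F (dotp k x) by apply/derivable1_diffP; exact: ex_derive.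
  apply: DiffDef => //; rewrite diff1E// derive1E.
  by apply/funext => t; rewrite derive_val.
have := @is_diff_comp _ _ _ _ (@dotp R k) (@dotp R k) F _ x h dF'.
rewrite /comp => hF; split; first exact: ex_diff.
rewrite deriveE; last exact: ex_diff.
by rewrite diff_val /GRing.scale /=; ring.
Qed.

(** The span of cosine and sine at one frequency is stable under directional derivatives, so all
    iterated derivatives are differentiable at once. *)
Lemma trig1_foldr_derive (k : int * int) (a b : R) (s : seq (R * R)) : exists c d : R,
  foldr (fun v (f : R * R -> R) => 'D_v f) (fun y => a * cos (dotp k y) + b * sin (dotp k y)) s
  = (fun y => c * cos (dotp k y) + d * sin (dotp k y)).
Proof.
elim: s => [|v s [c [d IH]]]; first by exists a, b.
exists (d * dotp k v), (- c * dotp k v); rewrite /= IH; apply/funext => x.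
exact: (trig1_derive k c d v x).2.
Qed.

Lemma trig1_smooth (k : int * int) (a b : R) :
  smooth (fun y : R * R => a * cos (dotp k y) + b * sin (dotp k y)).
Proof.
move=> s x; have [c [d ->]] := trig1_foldr_derive k a b s.
exact: (trig1_derive k c d 0 x).1.
Qed.

Lemma trig1_laplacian (k : int * int) (a b : R) (x : R * R) :
  laplacian (fun y : R * R => a * cos (dotp k y) + b * sin (dotp k y)) x =
  - (nsq k)%:R * (a * cos (dotp k x) + b * sin (dotp k x)).
Proof.
have DE a' b' v : 'D_v (fun y : R * R => a' * cos (dotp k y) + b' * sin (dotp k y)) =
    (fun x => (b' * dotp k v) * cos (dotp k x) + (- a' * dotp k v) * sin (dotp k x)).
  by apply/funext => y; exact: (trig1_derive k a' b' v y).2.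
rewrite /laplacian !DE !(trig1_derive _ _ _ _ _).2 -[(nsq k)%:R]/((nsq k)%:Z%:~R) nsqE rmorphD !rmorphXn /dotp /=.

ring.
Qed.

Lemma dotp_add_period (k : int * int) (x v : R * R) : period_lattice v ->
  exists j : int, dotp k (x + v) = dotp k x + 2 * pi * j%:~R.
Proof.
move=> [m [n ->]]; exists (k.1 * m + k.2 * n).
by rewrite /dotp /= rmorphD !rmorphM /=; ring.
Qed.

Lemma trig1_periodic (k : int * int) (a b : R) :
  torus_periodic (fun y : R * R => a * cos (dotp k y) + b * sin (dotp k y)).
Proof. by move=> x v /(dotp_add_period k x)[j ->]; rewrite cos_period sin_period. Qed.
End SmoothTrig.

Section FourierCoef.
Variable R : realType.
Local Notation I f := (\int[area R]_(x in @square R) f x).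
Local Notation igb f := ((area R).-integrable (@square R) (EFin \o f)).
Local Notation plane := (measurableTypeR R * measurableTypeR R)%type.
Local Notation A := ((2 * pi) ^+ 2 : R).
Local Notation sqint2 f := (sqint (area R) (@square R) f).
Implicit Types (s : seq (int * int)) (a b : int * int -> R).
Let mD : measurable (@square R : set plane) := @measurable_square R.
Let muD := @area_square_fin R.

(** With [fsin], the coefficient u^(n) is fcos - i fsin. Hence [trigp s (fcos u) (fsin u)] is the
    real part of the sum of u^(n) e^(i n.x) over s, without a factor 2 when s contains both n and
    -n. *)
Definition fcos (u : R * R -> R) (n : int * int) : R := A^-1 * I (fun x => u x * cos (dotp n x)).
Definition fsin (u : R * R -> R) (n : int * int) : R := A^-1 * I (fun x => u x * sin (dotp n x)).

Lemma area_gt0 : 0 < A.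
Proof. by rewrite exprn_gt0// mulr_gt0// pi_gt0. Qed.

Lemma fcosE u n : A * fcos u n = I (fun x => u x * cos (dotp n x)).
Proof. by rewrite /fcos mulVKf// gt_eqF// area_gt0. Qed.

Lemma fsinE u n : A * fsin u n = I (fun x => u x * sin (dotp n x)).
Proof. by rewrite /fsin mulVKf// gt_eqF// area_gt0. Qed.

Lemma igb_mul_bounded (u f : R * R -> R) M : igb u -> measurable_fun (@square R) (f : plane -> R) ->
  (forall x, @square R x -> `|f x| <= M) -> igb (fun x => u x * f x).
Proof.
move=> iu mf fM; have mu := igb_measurable iu.
apply: (igb_le mD (g := fun x => M * `|u x|)); first exact: measurable_funM.
  by move=> x Dx; rewrite normrM mulrC ler_wpM2r// fM.
apply: igbZ => //; have := integrable_abse iu; apply: eq_integrable => //.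
Qed.

Lemma igb_mul_cos u n : igb u -> igb (fun x => u x * cos (dotp n x)).
Proof.
move=> iu; apply: (igb_mul_bounded (M := 1)) => //; first exact: cos_dotp_measurable.
by move=> x _; rewrite ler_norml cos_geN1 cos_le1.
Qed.

Lemma igb_mul_sin u n : igb u -> igb (fun x => u x * sin (dotp n x)).
Proof.
move=> iu; apply: (igb_mul_bounded (M := 1)) => //; first exact: sin_dotp_measurable.
by move=> x _; rewrite ler_norml sin_geN1 sin_le1.
Qed.

Lemma I_mul_trigp (w : R * R -> R) s a b : igb w ->
  I (fun x => w x * trigp s a b x) = A * \sum_(n <- s) (a n * fcos w n + b n * fsin w n).
Proof.
move=> iw; have ic n := igb_mul_cos n iw; have is_ n := igb_mul_sin n iw.
rewrite (@eq_I _ _ _ (area R) (@square R) _ (fun x => \sum_(n <- s)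
    (a n * (w x * cos (dotp n x)) + b n * (w x * sin (dotp n x))))); last first.
  by move=> x _; rewrite mulr_sumr; apply: eq_bigr => n _; ring.
rewrite (I_sum mD muD); last by move=> n; apply: igbD => //; exact: igbZ.
rewrite mulr_sumr; apply: eq_bigr => n _.
rewrite (I_D mD (igbZ mD (a n) (ic n)) (igbZ mD (b n) (is_ n))) !(I_Z mD)//.
by rewrite -fcosE -fsinE; ring.
Qed.

(** Expand the integral of (u - T)^2: that of u T is A times the energy, that of T^2 at most as
    much. *)
Lemma bessel (u : R * R -> R) s : uniq s -> sqint2 u ->
  A * energy s (fcos u) (fsin u) <= I (fun x => u x ^+ 2).
Proof.
move=> us su; set T := trigp s (fcos u) (fsin u).
have sT : sqint2 T by exact: trigp_sqint.
have uT := sqint_mul mD su sT.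
have : 0 <= I (fun x => (u x - T x) ^+ 2) by apply: I_ge0 => x _; exact: sqr_ge0.
rewrite (@eq_I _ _ _ (area R) (@square R) _ (fun x => u x ^+ 2 + (- 2) * (u x * T x) + T x ^+ 2)); last first.
  by move=> x _; ring.
rewrite (I_D mD (igbD mD su.2 (igbZ mD _ uT)) sT.2) (I_D mD su.2 (igbZ mD _ uT)) (I_Z mD)//.
rewrite I_mul_trigp; last exact: sqint_igb su.
have := @I_trigp_sqr R s (fcos u) (fsin u) us; rewrite -/T /energy.
under [X in _ * (_ * X)]eq_bigr do rewrite -!expr2.
lra.
Qed.

(* Duality with the fourth moment bound for trigonometric polynomials. *)
Lemma product_energy (W u : R * R -> R) (M : R) s (c : nat) : uniq s ->
  (forall k : int * int, k != 0 -> (size [seq n <- s | (n - k)%R \in s] <= c)%N) ->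
  sqint2 W -> measurable_fun (@square R) (u : plane -> R) ->
  (forall x, @square R x -> `|u x| <= M) ->
  A ^+ 3 * energy s (fcos (fun x => W x * u x)) (fsin (fun x => W x * u x)) ^+ 2 <=
  c.+1%:R * I (fun x => W x ^+ 2) ^+ 2 * I (fun x => u x ^+ 4).
Proof.
move=> us sc sW mu uM; set a := fcos _; set b := fsin _; set E := energy s a b.
set T := trigp s a b.
have A0 := area_gt0.
have sT : sqint2 T by exact: trigp_sqint.
have su : sqint2 u by apply: (sqint_bounded mD muD (M := M)).
have [N TN] : exists N, forall x, `|T x| <= N by eexists => x; exact: trigp_bounded.
have mT : measurable_fun (@square R) (T : plane -> R) by exact: trigp_measurable.
have suT : sqint2 (fun x => u x * T x).
  apply: (sqint_bounded mD muD (M := M * N)); first exact: measurable_funM.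
  by move=> x Dx; rewrite normrM ler_pM// uM.
have su2 : sqint2 (fun x => u x ^+ 2).
  apply: (sqint_bounded mD muD (M := M ^+ 2)); first exact: measurable_funX.
  by move=> x Dx; rewrite normrX lerXn2r ?nnegrE// ?uM// (le_trans _ (uM _ Dx)).
have sT2 : sqint2 (fun x => T x ^+ 2).
  apply: (sqint_bounded mD muD (M := N ^+ 2)); first exact: measurable_funX.
  by move=> x Dx; rewrite normrX lerXn2r ?nnegrE// (le_trans _ (TN x)).
(* W u is tested against the polynomial T with the coefficients of W u. Two Cauchy-Schwarz
   inequalities and the fourth moment of T give (A E)^4 <= W2^2 U A (c + 1) E^2, and A E^2 is
   cancelled at the end. *)
have AE : A * E = I (fun x => W x * (u x * T x)).
  under eq_Rintegral do rewrite mulrA.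
  rewrite I_mul_trigp; first by congr (_ * _); apply: eq_bigr => n _; rewrite -!expr2.
  exact: (sqint_mul mD sW su).
have h1 := I_cauchy mD sW suT; rewrite -AE in h1.
have h2 := I_cauchy mD su2 sT2.
rewrite (@eq_I _ _ _ (area R) (@square R) _ (fun x => (u x * T x) ^+ 2)) in h2; last first.
  by move=> x _; rewrite exprMn.
have e4 (f : R * R -> R) : I (fun x => (f x ^+ 2) ^+ 2) = I (fun x => f x ^+ 4).
  by apply: eq_I => x _; rewrite -exprM.
rewrite !e4 in h2.
have h3 := @I_trigp_pow4 R s a b c us sc; rewrite -/T -/E in h3.
have E0 : 0 <= E by exact: energy_ge0.
have U0 : 0 <= I (fun x => u x ^+ 4) by rewrite -e4; apply: I_ge0 => x _; exact: sqr_ge0.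
have [->|En0] := eqVneq E 0.
  by rewrite expr0n mulr0; apply: mulr_ge0 => //; apply: mulr_ge0; rewrite ?sqr_ge0.
have Ep : 0 < E by rewrite lt_def En0.
have J0 : 0 <= I (fun x => (u x * T x) ^+ 2) by apply: I_ge0 => x _; rewrite sqr_ge0.
have W0 : 0 <= I (fun x => W x ^+ 2) by apply: I_ge0 => x _; rewrite sqr_ge0.
move: h1 h2 h3 U0 J0 W0.
set J := I (fun x => (u x * T x) ^+ 2); set U := I (fun x => u x ^+ 4).
set W2 := I (fun x => W x ^+ 2); set T4 := I (fun x => T x ^+ 4) => h1 h2 h3 U0 J0 W0.
have h4 : J ^+ 2 <= U * (A * (c.+1%:R * E ^+ 2)).
  by apply: le_trans h2 _; rewrite ler_wpM2l.
have h5 : (A * E) ^+ 4 <= W2 ^+ 2 * J ^+ 2.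
  have -> : (A * E) ^+ 4 = ((A * E) ^+ 2) ^+ 2 by rewrite -exprM.
  by rewrite -exprMn lerXn2r ?nnegrE ?sqr_ge0 ?mulr_ge0.
have h6 : (A * E) ^+ 4 <= W2 ^+ 2 * (U * (A * (c.+1%:R * E ^+ 2))).
  by apply: le_trans h5 _; rewrite ler_wpM2l ?sqr_ge0.
rewrite -(ler_pM2r (x := A * E ^+ 2)); last by apply: mulr_gt0 => //; exact: exprn_gt0.
rewrite (_ : _ * (A * E ^+ 2) = (A * E) ^+ 4); last by ring.
by rewrite [leRHS](_ : _ = W2 ^+ 2 * (U * (A * (c.+1%:R * E ^+ 2))))//; ring.
Qed.
End FourierCoef.

(** * Fourier coefficients of eigenfunctions *)

Section RealEigen.
Variable R : realType.
Local Notation I f := (\int[area R]_(x in @square R) f x).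
Local Notation igb f := ((area R).-integrable (@square R) (EFin \o f)).
Local Notation plane := (measurableTypeR R * measurableTypeR R)%type.
Local Notation sqint2 f := (sqint (area R) (@square R) f).
Let mD : measurable (@square R : set plane) := @measurable_square R.
Let muD := @area_square_fin R.

(** V is real, so the equation splits into real and imaginary parts. One of them may vanish
    identically, hence no condition that u be nonzero. *)
Definition real_eigen (V : R * R -> R) (lam : R) (u : R * R -> R) : Prop :=
  [/\ continuous u, L2_torus u & exists g : R * R -> R,
     [/\ L2_torus g, distr_laplacian u g &
         {ae area R, forall x, lam ^+ 2 * u x = - g x + V x * u x}]].

Lemma ae_area_imp (P Q : R * R -> Prop) : (forall x, P x -> Q x) ->
  {ae area R, forall x, P x} -> {ae area R, forall x, Q x}.
Proof. by move=> PQ; apply: negligibleS => x /= nQ /PQ. Qed.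

Lemma eigenfunction_real (V : R * R -> R) (lam : R) (e : R * R -> R[i]) :
  eigenfunction V (lam ^+ 2) e ->
  real_eigen V lam (fun x => complex.Re (e x)) /\ real_eigen V lam (fun x => complex.Im (e x)).
Proof.
move=> [cr ci _ [[ur ui] _ [g [[gr gi] [dr di] h]]]]; split; split => //.
  exists (fun x => complex.Re (g x)); split => //.
  apply: ae_area_imp h => x /(congr1 (@complex.Re _)).
  case: (e x) => a b; case: (g x) => c d; rewrite /= => h.
  by move: h; rewrite !mul0r !subr0.
exists (fun x => complex.Im (g x)); split => //.
apply: ae_area_imp h => x /(congr1 (@complex.Im _)).
case: (e x) => a b; case: (g x) => c d; rewrite /= => h.
by move: h; rewrite !mul0r !addr0.
Qed.

Lemma L2_torus_sqint (u : R * R -> R) : L2_torus u -> sqint2 u.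
Proof.
move=> [_ mu iu]; have mu' : measurable_fun (@square R) (u : plane -> R).
  exact: measurable_funS mu.
split => //; apply/integrableP; split.
  by apply/measurable_EFinP; exact: measurable_funX.
apply: le_lt_trans iu; rewrite le_eqVlt; apply/orP; left; apply/eqP.
by apply: eq_integral => x _ /=; rewrite ger0_norm ?sqr_ge0.
Qed.

Lemma continuous_square_bounded (u : R * R -> R) : continuous u ->
  exists M, forall x, @square R x -> `|u x| <= M.
Proof.
move=> cu.
have cD : compact (@square R) by apply: compact_setX; exact: segment_compact.
have /compact_bounded [M [_ MP]] : compact (u @` @square R).
  by apply: continuous_compact => //; exact: continuous_subspaceT.
exists (M + 1) => x Dx; apply: (MP (M + 1)); first by rewrite ltrDl.
by exists x.
Qed.

(** Cosine and sine at n are test functions whose Laplacian is -|n|^2 times themselves; the weak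
    Laplacian g is replaced almost everywhere by V u - lam^2 u. *)
Lemma coef_equation (V : R * R -> R) lam (u : R * R -> R) (n : int * int) :
  L2_torus V -> real_eigen V lam u ->
  ((nsq n)%:R - lam ^+ 2) * fcos u n = - fcos (fun x => V x * u x) n /\
  ((nsq n)%:R - lam ^+ 2) * fsin u n = - fsin (fun x => V x * u x) n.
Proof.
move=> hV [cu hu [g [hg dg ae]]].
have sV := L2_torus_sqint hV; have su := L2_torus_sqint hu; have sg := L2_torus_sqint hg.
have A0 := area_gt0 R.
have iVu := sqint_mul mD sV su.
have iu := sqint_igb mD muD su; have ig := sqint_igb mD muD sg.
have key (f : R * R -> R) : smooth f -> torus_periodic f ->
    measurable_fun (@square R) (f : plane -> R) -> (forall x, `|f x| <= 1) ->
    (forall x, laplacian f x = - (nsq n)%:R * f x) ->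
    ((nsq n)%:R - lam ^+ 2) * I (fun x => u x * f x) = - I (fun x => V x * u x * f x).
  move=> sf pf mf f1 lf.
  have b1 (w : R * R -> R) : igb w -> igb (fun x => w x * f x).
    by move=> iw; apply: (igb_mul_bounded (M := 1)).
  have := dg f sf pf.
  rewrite (@eq_I _ _ _ (area R) (@square R) _ (fun x => - (nsq n)%:R * (u x * f x))); last first.
    by move=> x _; rewrite lf; ring.
  rewrite (I_Z mD)//; last exact: b1.
  have -> : I (fun x => g x * f x) = I (fun x => V x * u x * f x - lam ^+ 2 * (u x * f x)).
    rewrite /Rintegral; congr fine; apply: ae_eq_integral => //.
    - exact: measurable_int (b1 _ ig).
    - exact: measurable_int (igbB mD (b1 _ iVu) (igbZ mD (lam ^+ 2) (b1 _ iu))).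
    apply: ae_area_imp ae => x h _; congr EFin.
    rewrite mulrA h; ring.
  rewrite (I_B mD (b1 _ iVu) (igbZ mD (lam ^+ 2) (b1 _ iu))) (I_Z mD _ (b1 _ iu)) => h.
  by rewrite mulrBl; lra.
have cE (x : R * R) : 1 * cos (dotp n x) + 0 * sin (dotp n x) = cos (dotp n x) by ring.
have sE (x : R * R) : 0 * cos (dotp n x) + 1 * sin (dotp n x) = sin (dotp n x) by ring.
have cF : (fun x : R * R => 1 * cos (dotp n x) + 0 * sin (dotp n x)) = (fun x => cos (dotp n x)).
  exact/funext.
have sF : (fun x : R * R => 0 * cos (dotp n x) + 1 * sin (dotp n x)) = (fun x => sin (dotp n x)).
  exact/funext.
have hc := key (fun x => cos (dotp n x)).
have hs := key (fun x => sin (dotp n x)).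
split; apply: (mulfI (lt0r_neq0 A0)).
  rewrite mulrCA mulrN !fcosE; apply: hc.
  - by rewrite -cF; exact: trig1_smooth.
  - by rewrite -cF; exact: trig1_periodic.
  - exact: cos_dotp_measurable.
  - by move=> x; rewrite ler_norml cos_geN1 cos_le1.
  - by move=> x; rewrite -cF trig1_laplacian cE.
rewrite mulrCA mulrN !fsinE; apply: hs.
- by rewrite -sF; exact: trig1_smooth.
- by rewrite -sF; exact: trig1_periodic.
- exact: sin_dotp_measurable.
- by move=> x; rewrite ler_norml sin_geN1 sin_le1.
- by move=> x; rewrite -sF trig1_laplacian sE.
Qed.
End RealEigen.

(** * Uniform convergence of Fourier series with summable coefficients *)

Section PeakKernel.
Variable R : realType.
Local Notation I f := (\int[area R]_(x in @square R) f x).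
Local Notation igb f := ((area R).-integrable (@square R) (EFin \o f)).
Local Notation plane := (measurableTypeR R * measurableTypeR R)%type.
Local Notation A := ((2 * pi) ^+ 2 : R).
Let mD : measurable (@square R : set plane) := @measurable_square R.
Let muD := @area_square_fin R.

Definition cospoly (p : seq ((int * int) * R)) (x0 y : R * R) : R :=
  \sum_(i <- p) i.2 * cos (dotp i.1 (y - x0)).

Let nonneg (p : seq ((int * int) * R)) := forall i, i \in p -> 0 <= i.2.

(** The product formula for cosines has coefficients 1/2, so signs are preserved. *)
Lemma cospoly_mul_cos p m x0 : nonneg p -> exists2 p', nonneg p' &
  forall y, cospoly p' x0 y = cospoly p x0 y * cos (dotp m (y - x0)).
Proof.
move=> p0; exists ([seq (i.1 + m, i.2 / 2) | i <- p] ++ [seq (i.1 - m, i.2 / 2) | i <- p]).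
  move=> i; rewrite mem_cat => /orP[] /mapP[j /p0 jp ->] /=; exact: divr_ge0.
move=> y; rewrite /cospoly big_cat !big_map /= -big_split mulr_suml; apply: eq_bigr => i _ /=.
have -> : dotp (i.1 + m) (y - x0) = dotp i.1 (y - x0) + dotp m (y - x0).
  by rewrite /dotp /= !rmorphD /=; ring.
have -> : dotp (i.1 - m) (y - x0) = dotp i.1 (y - x0) - dotp m (y - x0).
  by rewrite /dotp /= !rmorphB /=; ring.
by rewrite cosD cosB; field.
Qed.

(** Between 0 and 4, with value 4 only at x0 modulo the period lattice. *)
Definition peak (x0 y : R * R) : R := 2 + cos (y.1 - x0.1) + cos (y.2 - x0.2).

Lemma peakX_cospoly x0 j : exists2 p, nonneg p & forall y, cospoly p x0 y = peak x0 y ^+ j.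
Proof.
elim: j => [|j [p p0 pE]].
  exists [:: (0, 1)]; first by move=> i; rewrite inE => /eqP ->.
  by move=> y; rewrite /cospoly big_seq1 /dotp /= !mul0r addr0 cos0 mulr1.
have [p1 p10 p1E] := cospoly_mul_cos (1, 0) x0 p0.
have [p2 p20 p2E] := cospoly_mul_cos (0, 1) x0 p0.
exists ([seq (i.1, 2 * i.2) | i <- p] ++ p1 ++ p2).
  move=> i; rewrite !mem_cat => /orP[/mapP[k /p0 kp ->]|/orP[/p10|/p20]//].
  exact: mulr_ge0.
move=> y; rewrite /cospoly !big_cat big_map /= -!/(cospoly _ _ _) p1E p2E.
under eq_bigr do rewrite -mulrA.
rewrite -mulr_sumr -/(cospoly p x0 y) pE /dotp /= !mul1r !mul0r add0r addr0 exprS /peak; ring.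
Qed.

Lemma cospoly_measurable p x0 (D : set plane) : measurable_fun D (cospoly p x0 : plane -> R).
Proof.
have -> : cospoly p x0 = (fun y => \sum_(i <- p)
    ((i.2 * cos (dotp i.1 x0)) * cos (dotp i.1 y) + (i.2 * sin (dotp i.1 x0)) * sin (dotp i.1 y))).
  apply/funext => y; apply: eq_bigr => i _.
  have -> : dotp i.1 (y - x0) = dotp i.1 y - dotp i.1 x0 by rewrite /dotp /=; ring.
  by rewrite cosB; ring.
apply: measurable_sum => i; apply: measurable_funD; apply: measurable_funM => //.
  exact: cos_dotp_measurable.
exact: sin_dotp_measurable.
Qed.

Lemma cospoly_bounded p x0 y : `|cospoly p x0 y| <= \sum_(i <- p) `|i.2|.
Proof.
apply: le_trans (ler_norm_sum _ _ _) _; apply: ler_sum => i _.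
by rewrite normrM ler_piMr// ler_norml cos_geN1 cos_le1.
Qed.

Lemma I_mul_cospoly (w : R * R -> R) p x0 : igb w -> I (fun y => w y * cospoly p x0 y) =
  A * \sum_(i <- p) i.2 * (cos (dotp i.1 x0) * fcos w i.1 + sin (dotp i.1 x0) * fsin w i.1).
Proof.
move=> iw; have ic n := igb_mul_cos n iw; have is_ n := igb_mul_sin n iw.
rewrite (@eq_I _ _ _ (area R) (@square R) _ (fun y => \sum_(i <- p)
   (i.2 * cos (dotp i.1 x0) * (w y * cos (dotp i.1 y)) +
    i.2 * sin (dotp i.1 x0) * (w y * sin (dotp i.1 y))))); last first.
  move=> y _; rewrite mulr_sumr; apply: eq_bigr => i _.
  have -> : dotp i.1 (y - x0) = dotp i.1 y - dotp i.1 x0 by rewrite /dotp /=; ring.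
  by rewrite cosB; ring.
rewrite (I_sum mD muD); last by move=> n; apply: igbD => //; exact: igbZ.
rewrite mulr_sumr; apply: eq_bigr => i _.
rewrite (I_D mD (igbZ mD _ (ic i.1)) (igbZ mD _ (is_ i.1))) !(I_Z mD)//.
by rewrite -fcosE -fsinE; ring.
Qed.

Lemma I_cospoly p x0 : I (cospoly p x0) = A * \sum_(i <- p) (i.1 == 0)%:R * i.2.
Proof.
rewrite (@eq_I _ _ _ (area R) (@square R) _ (fun y => \sum_(i <- p)
    ((i.2 * cos (dotp i.1 x0)) * cos (dotp i.1 y) + (i.2 * sin (dotp i.1 x0)) * sin (dotp i.1 y)))).
  rewrite I_trigp_sum; congr (_ * _); apply: eq_bigr => i _.
  case: eqP => [->|]; last by rewrite !mul0r.
  by rewrite /dotp /= !mul0r addr0 cos0 mulr1.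
move=> y _; apply: eq_bigr => i _.
have -> : dotp i.1 (y - x0) = dotp i.1 y - dotp i.1 x0 by rewrite /dotp /=; ring.
by rewrite cosB; ring.
Qed.

Lemma cospoly_igb p x0 : igb (cospoly p x0).
Proof.
apply: (igb_bounded mD muD); first exact: cospoly_measurable.
by move=> y _; exact: cospoly_bounded.
Qed.

(** For a nonnegative kernel K the integral of K cos(n.(y - x0)) is at most that of K, which bounds
    every coefficient by twice the mean of K: the product with the cosine returns half of the
    coefficient at n to frequency 0. The coefficients being nonnegative, none is lost to
    cancellation. *)
Lemma I_mul_cospoly_le (d : R * R -> R) (T : R) p x0 : nonneg p -> igb d ->
  (forall y, 0 <= cospoly p x0 y) ->
  (forall s, uniq s -> \sum_(n <- s) (`|fcos d n| + `|fsin d n|) <= T) ->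
  I (fun y => d y * cospoly p x0 y) <= 2 * T * I (cospoly p x0).
Proof.
move=> p0 id K0 dT; have A0 := area_gt0 R.
pose be n := `|fcos d n| + `|fsin d n|.
pose r := undup [seq i.1 | i <- p].
pose ka n := \sum_(i <- p | i.1 == n) i.2.
have kale n : A * ka n <= 2 * I (cospoly p x0).
  have [p' p'0 p'E] := cospoly_mul_cos n x0 p0.
  have : I (cospoly p' x0) <= I (cospoly p x0).
    apply: (I_le mD); [exact: cospoly_igb|exact: cospoly_igb|].
    by move=> y _; rewrite p'E ler_piMr// cos_le1.
  have -> : I (cospoly p' x0) =
      A * \sum_(i <- p) (((i.1 + n == 0)%:R + (i.1 - n == 0)%:R) * (i.2 / 2)).
    rewrite (@eq_I _ _ _ (area R) (@square R) _ (cospoly ([seq (i.1 + n, i.2 / 2) | i <- p] ++ [seq (i.1 - n, i.2 / 2) | i <- p]) x0)).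
      rewrite I_cospoly big_cat !big_map /= -big_split /=; congr (_ * _).
      by apply: eq_bigr => i _; ring.
    move=> y _; rewrite p'E /cospoly big_cat !big_map /= -big_split mulr_suml; apply: eq_bigr => i _ /=.
    have -> : dotp (i.1 + n) (y - x0) = dotp i.1 (y - x0) + dotp n (y - x0).
      by rewrite /dotp /= !rmorphD /=; ring.
    have -> : dotp (i.1 - n) (y - x0) = dotp i.1 (y - x0) - dotp n (y - x0).
      by rewrite /dotp /= !rmorphB /=; ring.
    by rewrite cosD cosB; field.
  move=> h; rewrite -(ler_pM2l (x := 2^-1))// mulKf//; apply: le_trans h.
  rewrite mulrCA ler_pM2l// /ka big_mkcond mulr_sumr big_seq [leRHS]big_seq; apply: ler_sum => i ip.
  rewrite subr_eq0; have := p0 _ ip; case: ifP => _ i0.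
    by rewrite mulrDl mul1r mulrC lerDr mulr_ge0// divr_ge0.
  by rewrite mulr0 mulr_ge0 ?addr_ge0// divr_ge0.
rewrite I_mul_cospoly//.
apply: (@le_trans _ _ (A * \sum_(i <- p) i.2 * be i.1)).
  rewrite ler_pM2l// big_seq [leRHS]big_seq; apply: ler_sum => i ip.
  apply: ler_wpM2l; first exact: p0.
  apply: le_trans (ler_norm _) _; apply: le_trans (ler_normD _ _) _.
  by rewrite /be; apply: lerD; rewrite normrM ler_piMl// ler_norml ?cos_geN1 ?cos_le1 ?sin_geN1 ?sin_le1.
rewrite (@sum_fibers _ _ _ _ r fst) ?undup_uniq//; last first.
  by move=> i ip; rewrite mem_undup map_f.
apply: (@le_trans _ _ (\sum_(n <- r) 2 * I (cospoly p x0) * be n)).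
  rewrite mulr_sumr; apply: ler_sum => n _.
  under eq_bigr => i /eqP -> do [].
  by rewrite -mulr_suml mulrA; apply: ler_wpM2r; [exact: addr_ge0|exact: kale].
rewrite -mulr_sumr -mulrA [2 * T * _]mulrAC -mulrA ler_pM2l//.
by apply: ler_wpM2l; [exact: I_ge0|apply: dT; exact: undup_uniq].
Qed.
End PeakKernel.

Lemma geometric_unbounded (R : archiRealFieldType) (r B : R) : 1 < r ->
  exists j : nat, B < r ^+ j.
Proof.
move=> r1; have x0 : 0 < r - 1 by rewrite subr_gt0.
have bern j : 1 + j%:R * (r - 1) <= r ^+ j.
  elim: j => [|j IH]; first by rewrite mul0r addr0.
  rewrite exprS -natr1; have j0 : 0 <= j%:R * (r - 1) by rewrite mulr_ge0// ltW.
  by move: (j%:R) j0 (r ^+ j) IH => z z0 w zw; nra.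
exists (Num.bound (B / (r - 1))); apply: lt_le_trans (bern _).
have [B0|B0] := ltP B 0.
  by rewrite (lt_le_trans B0)// addr_ge0// mulr_ge0// ltW.
have /archi_boundP : 0 <= B / (r - 1) by rewrite divr_ge0// ltW.
by rewrite ltr_pdivrMr//; lra.
Qed.

Section PointwiseBound.
Variable R : realType.
Local Notation I f := (\int[area R]_(x in @square R) f x).
Local Notation igb f := ((area R).-integrable (@square R) (EFin \o f)).
Local Notation plane := (measurableTypeR R * measurableTypeR R)%type.
Local Notation A := ((2 * pi) ^+ 2 : R).
Let mD : measurable (@square R : set plane) := @measurable_square R.
Let muD := @area_square_fin R.

Lemma peak_ge0 (x0 y : R * R) : 0 <= peak x0 y.
Proof. by rewrite /peak; have := cos_geN1 (y.1 - x0.1); have := cos_geN1 (y.2 - x0.2); lra. Qed.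

Lemma cos_le_away (del t : R) : 0 <= del <= pi -> del <= `|t| <= 2 * pi - del -> cos t <= cos del.
Proof.
move=> /andP[d0 dpi]; rewrite -cos_norm; move: `|t| => {}t /andP[dt tpi].
have mono (x : R) : del <= x <= pi -> cos x <= cos del.
  move=> /andP[dx xpi]; move: dx; rewrite le_eqVlt => /predU1P[->//|dx].
  by apply: ltW; rewrite ltr_cos ?in_itv/= ?d0 ?dpi ?xpi ?(le_trans d0 (ltW dx)).
have [tp|tp] := leP t pi; first by apply: mono; rewrite dt.
have -> : cos t = cos (2 * pi - t).
  rewrite -[LHS](cos_period (-1)) -[LHS]cosN; congr cos.
  by rewrite rmorphN1; ring.
by apply: mono; lra.
Qed.

Lemma peak_le_away (x0 y : R * R) (del : R) : 0 <= del <= pi ->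
  del <= x0.1 <= 2 * pi - del -> del <= x0.2 <= 2 * pi - del -> @square R y ->
  del <= `|y.1 - x0.1| \/ del <= `|y.2 - x0.2| -> peak x0 y <= 3 + cos del.
Proof.
move=> dd /andP[a1 a2] /andP[b1 b2] [] /=; rewrite !in_itv/= => /andP[y1 y2] /andP[z1 z2].
rewrite /peak; have := cos_le1 (y.1 - x0.1); have := cos_le1 (y.2 - x0.2) => c1 c2.
case=> h; have := @cos_le_away del _ dd => h'.
  have : cos (y.1 - x0.1) <= cos del by apply: h'; rewrite h ler_norml; lra.
  lra.
have : cos (y.2 - x0.2) <= cos del by apply: h'; rewrite h ler_norml; lra.
lra.
Qed.

Lemma I_box (x0 : R * R) (r : R) : 0 < r ->
  (forall y, `|y.1 - x0.1| <= r -> `|y.2 - x0.2| <= r -> @square R y) ->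
  let B : set plane := `[x0.1 - r, x0.1 + r] `*` `[x0.2 - r, x0.2 + r] in
  measurable B /\ I (\1_B) = (2 * r) ^+ 2.
Proof.
move=> r0 Bs B.
have mI (a b : R) : measurable (`[a, b] : set (measurableTypeR R)) by exact: measurable_itv.
have mB : measurable B by exact: measurableX.
split => //; rewrite /Rintegral integral_indic//.
have -> : B `&` @square R = B.
  apply/setIidl => y [] /=; rewrite !in_itv/= => /andP[a1 a2] /andP[b1 b2].
  by apply: Bs; rewrite ler_norml; lra.
have LI (a : R) : lebesgue_measure (`[a - r, a + r] : set R) = (2 * r)%:E.
  rewrite lebesgue_measure_itv/= lte_fin ifT; last by lra.
  by rewrite -EFinB; congr EFin; ring.
have -> : area R B = ((2 * r)%:E * (2 * r)%:E)%E.
  apply: etrans (product_measure1E (@lebesgue_measure R) (@lebesgue_measure R) (mI _ _) (mI _ _)) _.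
  by congr (_ * _)%E; exact: LI.
by rewrite -EFinM /= expr2.
Qed.

(* Test d against high powers of the kernel [peak x0]: they concentrate at x0, are
   nonnegative, and have nonnegative Fourier coefficients. *)
Lemma interior_bound (d : R * R -> R) (T : R) (x0 : R * R) : continuous d -> igb d ->
  (forall s, uniq s -> \sum_(n <- s) (`|fcos d n| + `|fsin d n|) <= T) ->
  0 < x0.1 < 2 * pi -> 0 < x0.2 < 2 * pi -> d x0 <= 2 * T.
Proof.
move=> cd id dT x01 x02; have A0 := area_gt0 R; have pi0 := pi_gt0 R.
have T0 : 0 <= T by have := dT [::] isT; rewrite big_nil.
rewrite leNgt; apply/negP => dx.
pose c := (d x0 - 2 * T) / 2; have c0 : 0 < c by rewrite divr_gt0// subr_gt0.
have ball_of (f : R * R -> R) (b : R) : {for x0, continuous f} -> b < f x0 ->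
    exists2 r, 0 < r & forall y, `|y.1 - x0.1| < r -> `|y.2 - x0.2| < r -> b < f y.
  move=> cf bf; have : \forall y \near x0, b < f y.
    by have := cf _ (lt_nbhsr bf).
  move=> /nbhs_ballP[r /= r0 h]; exists r => // y h1 h2; apply: h.
  by split; rewrite /ball /= distrC.
have cpeak : continuous (peak x0).
  move=> y; apply: cvgD; first apply: cvgD; first exact: cvg_cst.
    apply: continuous_cvg; first exact: continuous_cos.
    by apply: cvgB; [exact: cvg_fst|exact: cvg_cst].
  apply: continuous_cvg; first exact: continuous_cos.
  by apply: cvgB; [exact: cvg_snd|exact: cvg_cst].
have [r1 r10 h1] : exists2 r, 0 < r & forall y, `|y.1 - x0.1| < r -> `|y.2 - x0.2| < r -> 2 * T + c < d y.
  by apply: ball_of (cd x0) _; rewrite /c; lra.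
(* On the box of half side [del] around x0 one has d > 2 T + c, and the box stays inside the square,
   so no other point of the lattice orbit of x0 comes near. *)
pose del := Num.min (Num.min r1 pi) (Num.min (Num.min x0.1 (2 * pi - x0.1)) (Num.min x0.2 (2 * pi - x0.2))).
have [del0 del1 del2 del3 del4] : [/\ 0 < del, del <= r1, del <= pi, del <= x0.1 <= 2 * pi - del & del <= x0.2 <= 2 * pi - del].
  have e : del <= del by [].
  move: e; rewrite {2}/del !le_min => /andP[/andP[e1 e2] /andP[/andP[e3 e4] /andP[e5 e6]]].
  have dp : 0 < del.
    by rewrite /del !lt_min r10 pi0 !subr_gt0; move: x01 x02 => /andP[-> ->] /andP[-> ->].
  by split => //; apply/andP; (split; [done|lra]).
(* Outside the box of half side [del] the kernel is at most 4 - th; in the smaller box of half side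
   [r] it exceeds 4 - th / 2. The ratio of the two is what high powers exploit. *)
pose th := 1 - cos del.
have th0 : 0 < th.
  by rewrite subr_gt0 -(cos0 R) ltr_cos ?in_itv/= ?lexx ?pi_ge0// del2 andbT ltW.
have th2 : th <= 2 by rewrite /th; have := cos_geN1 del; lra.
have pk : 4 - th / 2 < peak x0 x0 by rewrite /peak !subrr cos0; lra.
have [r2 r20 h2] := ball_of _ _ (cpeak x0) pk.
pose r := Num.min del r2 / 2.
have r0 : 0 < r by rewrite divr_gt0// lt_min del0.
have [rdel rr2] : r < del /\ r < r2.
  have e : Num.min del r2 <= Num.min del r2 by [].
  by move: e; rewrite le_min => /andP[e1 e2]; rewrite /r; split; lra.
have Bs (y : R * R) : `|y.1 - x0.1| <= r -> `|y.2 - x0.2| <= r -> @square R y.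
  by rewrite !ler_norml => g1 g2; rewrite /square /= !in_itv/=; lra.
have [mB IB] := I_box r0 Bs; set B := _ `*` _ in mB IB.
have [M0 M0P] := continuous_square_bounded cd.
pose M := `|M0| + 2 * T.
have M_ge0 : 0 <= M by rewrite addr_ge0// mulr_ge0.
have [j jP] : exists j : nat, M * A / (c * (2 * r) ^+ 2) < ((4 - th / 2) / (4 - th)) ^+ j.
  by apply: geometric_unbounded; rewrite ltr_pdivlMr; lra.
have [p p0 pE] := @peakX_cospoly R x0 j.
have pE' : cospoly p x0 = (fun y => peak x0 y ^+ j) by exact/funext.
have : I (fun y => d y * peak x0 y ^+ j) <= 2 * T * I (fun y => peak x0 y ^+ j).
  have := @I_mul_cospoly_le R d T p x0 p0 id _ dT; rewrite pE'; apply.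
  by move=> y; rewrite exprn_ge0// peak_ge0.
have ip : igb (fun y => peak x0 y ^+ j) by rewrite -pE'; exact: cospoly_igb.
have idp : igb (fun y => d y * peak x0 y ^+ j).
  apply: (igb_mul_bounded (f := fun y => peak x0 y ^+ j) (M := \sum_(i <- p) `|i.2|) id).
    by rewrite -pE'; exact: cospoly_measurable.
  by move=> y _; rewrite -pE; exact: cospoly_bounded.
have iB : igb (\1_B).
  apply: (igb_bounded mD muD (M := 1)); first exact: measurable_indic.
  by move=> y _; rewrite indicE; case: (_ \in _); rewrite ?normr1 ?normr0.
rewrite leNgt => /negP; apply; rewrite -subr_gt0 -(I_Z mD)// -(I_B mD)//; last exact: igbZ.
set G := (4 - th / 2) ^+ j; set H := (4 - th) ^+ j.
have H0 : 0 < H by rewrite exprn_gt0//; lra.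
(* Pointwise, (d - 2 T) peak^j is at least c G in the small box, at least 0 in the rest of the large
   box and at least - M H elsewhere; j was chosen to make the first gain win. *)
apply: (@lt_le_trans _ _ (I (fun y => c * G * \1_B y - M * H))).
  rewrite (I_B mD (igbZ mD _ iB) (igb_cst mD muD (M * H))) (I_Z mD)// IB.
  rewrite Rintegral_cst// area_square /= subr_gt0.
  move: jP; rewrite expr_div_n -/G -/H ltr_pdivrMr; last by rewrite mulr_gt0// exprn_gt0// mulr_gt0.
  rewrite mulrAC ltr_pdivlMr//; lra.
apply: (I_le mD (igbB mD (igbZ mD _ iB) (igb_cst mD muD (M * H))) (igbB mD idp (igbZ mD _ ip))) => y Dy.
rewrite -mulrBl.
have dM : - M <= d y - 2 * T.
  by have := M0P _ Dy; have := ler_norm M0; rewrite /M ler_norml; lra.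
have P0 : 0 <= peak x0 y ^+ j by rewrite exprn_ge0// peak_ge0.
have MH : 0 <= M * H by rewrite mulr_ge0// ltW.
rewrite indicE; have [yB|yB] := boolP (y \in B).
  have [y1 y2] : `|y.1 - x0.1| <= r /\ `|y.2 - x0.2| <= r.
    by move: yB => /set_mem[] /=; rewrite !in_itv/= !ler_norml; lra.
  rewrite mulr1 (@le_trans _ _ (c * G))//; first by rewrite lerBlDr lerDl.
  apply: ler_pM; rewrite ?(ltW c0)//.
  - by rewrite exprn_ge0//; lra.
  - by have := h1 y (lt_le_trans (le_lt_trans y1 rdel) del1) (lt_le_trans (le_lt_trans y2 rdel) del1); lra.
  - by rewrite lerXn2r ?nnegrE ?peak_ge0//; [lra|rewrite ltW// h2// (le_lt_trans _ rr2)].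
rewrite mulr0 sub0r.
have [/andP[y1 y2]|] := boolP ((`|y.1 - x0.1| < del) && (`|y.2 - x0.2| < del)).
  apply: (@le_trans _ _ 0); first by rewrite oppr_le0.
  apply: mulr_ge0 => //.
  by have := h1 y (lt_le_trans y1 del1) (lt_le_trans y2 del1); lra.
rewrite negb_and -!leNgt => /orP far.
have pkle : peak x0 y ^+ j <= H.
  rewrite lerXn2r ?nnegrE ?peak_ge0//; first lra.
  have := @peak_le_away x0 y del; rewrite /th (ltW del0) del2 del3 del4 => /(_ isT isT isT Dy far); lra.
apply: (@le_trans _ _ (- M * peak x0 y ^+ j)).
  by rewrite mulNr lerN2 ler_wpM2l.
exact: ler_wpM2r.
Qed.
End PointwiseBound.

Section Approximation.
Variable R : realType.
Local Notation I f := (\int[area R]_(x in @square R) f x).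
Local Notation igb f := ((area R).-integrable (@square R) (EFin \o f)).
Local Notation plane := (measurableTypeR R * measurableTypeR R)%type.
Let mD : measurable (@square R : set plane) := @measurable_square R.
Let muD := @area_square_fin R.
Implicit Types (s : seq (int * int)) (u : R * R -> R) (n m : int * int).

Lemma trigp_continuous s (a b : int * int -> R) : continuous (trigp s a b).
Proof.
elim: s => [|n s IH] x.
  rewrite (_ : trigp [::] a b = cst 0); first exact: cvg_cst.
  by apply/funext => y; rewrite /trigp big_nil.
rewrite (_ : trigp (n :: s) a b =
   (fun y => a n * cos (dotp n y) + b n * sin (dotp n y) + trigp s a b y)); last first.
  by apply/funext => y; rewrite /trigp big_cons.
apply: cvgD; last exact: IH.
apply: cvgD; apply: cvgM; try exact: cvg_cst.
  by apply: continuous_cvg; [exact: continuous_cos|exact: dotp_continuous].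
by apply: continuous_cvg; [exact: continuous_sin|exact: dotp_continuous].
Qed.

Lemma trigp_periodic s (a b : int * int -> R) : torus_periodic (trigp s a b).
Proof. by move=> x v pv; apply: eq_bigr => n _; exact: trig1_periodic. Qed.

Lemma fcos_cos n m : fcos (fun x : R * R => cos (dotp n x)) m = ((m == n)%:R + (m == - n)%:R) / 2.
Proof.
apply: (mulfI (lt0r_neq0 (area_gt0 R))); rewrite fcosE.
pose p := [:: n - m; n + m].
rewrite (@eq_I _ _ _ (area R) (@square R) _ (fun x => \sum_(k <- p) (2^-1 * cos (dotp k x) + 0 * sin (dotp k x)))).
  rewrite (I_trigp_sum p id (fun=> 2^-1) (fun=> 0)) /p big_cons big_seq1.
  by rewrite subr_eq0 eq_sym addr_eq0 [n == - m]eq_sym eqr_oppLR; field.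
move=> x _; rewrite big_cons big_seq1.
have -> : dotp (n - m) x = dotp n x - dotp m x by rewrite /dotp /= !rmorphB /=; ring.
have -> : dotp (n + m) x = dotp n x + dotp m x by rewrite /dotp /= !rmorphD /=; ring.
by rewrite cosB cosD; field.
Qed.

Lemma fsin_sin n m : fsin (fun x : R * R => sin (dotp n x)) m = ((m == n)%:R - (m == - n)%:R) / 2.
Proof.
apply: (mulfI (lt0r_neq0 (area_gt0 R))); rewrite fsinE.
rewrite (@eq_I _ _ _ (area R) (@square R) _ (fun x =>
    (2^-1 * cos (dotp (n - m) x) + 0 * sin (dotp (n - m) x)) +
    (- 2^-1 * cos (dotp (n + m) x) + 0 * sin (dotp (n + m) x)))).
  pose p := [:: (n - m, 2^-1); (n + m, - 2^-1 : R)].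
  have := I_trigp_sum p fst snd (fun=> 0); rewrite /p big_cons big_seq1 /=.
  under eq_Rintegral do rewrite big_cons big_seq1 /=.
  by move=> ->; rewrite subr_eq0 eq_sym addr_eq0 [n == - m]eq_sym eqr_oppLR; field.
move=> x _.
have -> : dotp (n - m) x = dotp n x - dotp m x by rewrite /dotp /= !rmorphB /=; ring.
have -> : dotp (n + m) x = dotp n x + dotp m x by rewrite /dotp /= !rmorphD /=; ring.
by rewrite cosB cosD; field.
Qed.

Lemma fsin_cos n m : fsin (fun x : R * R => cos (dotp n x)) m = 0.
Proof.
apply: (mulfI (lt0r_neq0 (area_gt0 R))); rewrite fsinE mulr0.
rewrite (@eq_I _ _ _ (area R) (@square R) _ (fun x =>
    (0 * cos (dotp (n + m) x) + 2^-1 * sin (dotp (n + m) x)) +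
    (0 * cos (dotp (n - m) x) + - 2^-1 * sin (dotp (n - m) x)))).
  pose p := [:: (n + m, 2^-1); (n - m, - 2^-1 : R)].
  have := I_trigp_sum p fst (fun=> 0) snd; rewrite /p big_cons big_seq1 /=.
  under eq_Rintegral do rewrite big_cons big_seq1 /=.
  by move=> ->; rewrite !mulr0 addr0 mulr0.
move=> x _.
have -> : dotp (n - m) x = dotp n x - dotp m x by rewrite /dotp /= !rmorphB /=; ring.
have -> : dotp (n + m) x = dotp n x + dotp m x by rewrite /dotp /= !rmorphD /=; ring.
by rewrite sinB sinD; field.
Qed.

Lemma fcos_sin n m : fcos (fun x : R * R => sin (dotp n x)) m = 0.
Proof.
have := fsin_cos m n; rewrite /fsin /fcos => h; rewrite -[RHS]h; congr (_ * _).
by apply: eq_I => x _; rewrite mulrC.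
Qed.

Lemma fcosN u n : fcos u (- n) = fcos u n.
Proof.
rewrite /fcos; congr (_ * _); apply: eq_I => x _; congr (_ * _).
by rewrite -cosN; congr cos; rewrite /dotp /= !rmorphN /=; ring.
Qed.

Lemma fsinN u n : igb u -> fsin u (- n) = - fsin u n.
Proof.
move=> iu; apply: (mulfI (lt0r_neq0 (area_gt0 R))); rewrite mulrN !fsinE.
have -> : I (fun x => u x * sin (dotp (- n) x)) = I (fun x => - (u x * sin (dotp n x))).
  apply: eq_I => x _; rewrite -mulrN -sinN; congr (_ * sin _).
  by rewrite /dotp /= !rmorphN /=; ring.
rewrite -mulN1r -(I_Z mD); last exact: igb_mul_sin.
by apply: eq_I => x _; rewrite mulN1r.
Qed.

(** The cosines at n and -n coincide, and each of the two frequencies supplies half of the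
    coefficient; hence the symmetry required of s. *)
Lemma fcos_trigp (u : R * R -> R) s n : uniq s -> (forall m, m \in s -> - m \in s) ->
  fcos (trigp s (fcos u) (fsin u)) n = (n \in s)%:R * fcos u n.
Proof.
move=> us sN; apply: (mulfI (lt0r_neq0 (area_gt0 R))); rewrite fcosE.
rewrite (@eq_I _ _ _ (area R) (@square R) _ (fun x => cos (dotp n x) * trigp s (fcos u) (fsin u) x)); last first.
  by move=> x _; rewrite mulrC.
rewrite I_mul_trigp; last by apply: (sqint_igb mD muD); exact: cos_dotp_sqint.
congr (_ * _).
have sNE m : (- m \in s) = (m \in s) by apply/idP/idP => /sN; rewrite ?opprK.
transitivity (\sum_(m <- s) (2^-1 * ((m == n)%:R * fcos u m) + 2^-1 * ((m == - n)%:R * fcos u m))).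
  by apply: eq_bigr => m _; rewrite fcos_cos fsin_cos; field.
rewrite big_split /= -!mulr_sumr.
have pick k : \sum_(m <- s) ((m == k)%:R * fcos u m) = (k \in s)%:R * fcos u k.
  have [ks|ks] := boolP (k \in s).
    by rewrite (bigD1_seq k)//= eqxx big1 ?addr0// => m /negPf ->; rewrite mul0r.
  rewrite big_seq big1 ?mul0r// => m ms; case: eqP => [mk|_]; last by rewrite mul0r.
  by rewrite -mk ms in ks.
by rewrite !pick sNE fcosN; field.
Qed.

Lemma fsin_trigp (u : R * R -> R) s n : igb u -> uniq s -> (forall m, m \in s -> - m \in s) ->
  fsin (trigp s (fcos u) (fsin u)) n = (n \in s)%:R * fsin u n.
Proof.
move=> iu us sN; apply: (mulfI (lt0r_neq0 (area_gt0 R))); rewrite fsinE.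
rewrite (@eq_I _ _ _ (area R) (@square R) _ (fun x => sin (dotp n x) * trigp s (fcos u) (fsin u) x)); last first.
  by move=> x _; rewrite mulrC.
rewrite I_mul_trigp; last by apply: (sqint_igb mD muD); exact: sin_dotp_sqint.
congr (_ * _).
have sNE m : (- m \in s) = (m \in s) by apply/idP/idP => /sN; rewrite ?opprK.
transitivity (\sum_(m <- s) (2^-1 * ((m == n)%:R * fsin u m) + (- 2^-1) * ((m == - n)%:R * fsin u m))).
  by apply: eq_bigr => m _; rewrite fsin_sin fcos_sin; field.
rewrite big_split /= -!mulr_sumr.
have pick k : \sum_(m <- s) ((m == k)%:R * fsin u m) = (k \in s)%:R * fsin u k.
  have [ks|ks] := boolP (k \in s).
    by rewrite (bigD1_seq k)//= eqxx big1 ?addr0// => m /negPf ->; rewrite mul0r.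
  rewrite big_seq big1 ?mul0r// => m ms; case: eqP => [mk|_]; last by rewrite mul0r.
  by rewrite -mk ms in ks.
by rewrite !pick sNE fsinN//; field.
Qed.

(** The difference u - S keeps exactly the coefficients outside s, so [interior_bound] applies to it
    and to its opposite. Periodicity and continuity carry the bound from the open square to the
    plane. *)
Lemma trigp_approx (u : R * R -> R) s (T : R) : continuous u -> L2_torus u ->
  uniq s -> (forall m, m \in s -> - m \in s) ->
  (forall s', uniq s' -> (forall n, n \in s' -> n \notin s) ->
     \sum_(n <- s') (`|fcos u n| + `|fsin u n|) <= T) ->
  forall x, `|u x - trigp s (fcos u) (fsin u) x| <= 2 * T.
Proof.
move=> cu hu us sN sT; set S := trigp s _ _.
have su := L2_torus_sqint hu; have iu := sqint_igb mD muD su.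
have iS : igb S by apply: (sqint_igb mD muD); exact: trigp_sqint.
pose d x := u x - S x.
have cd : continuous d by move=> x; apply: cvgB; [exact: cu|exact: trigp_continuous].
have id : igb d by exact: igbB.
have fcd n : fcos d n = (n \notin s)%:R * fcos u n.
  apply: (mulfI (lt0r_neq0 (area_gt0 R))); rewrite fcosE.
  rewrite (@eq_I _ _ _ (area R) (@square R) _ (fun x => u x * cos (dotp n x) - S x * cos (dotp n x))); last first.
    by move=> x _; rewrite -mulrBl.
  rewrite (I_B mD (igb_mul_cos n iu) (igb_mul_cos n iS)) -!fcosE fcos_trigp//.
  by case: (n \in s) => /=; ring.
have fsd n : fsin d n = (n \notin s)%:R * fsin u n.
  apply: (mulfI (lt0r_neq0 (area_gt0 R))); rewrite fsinE.
  rewrite (@eq_I _ _ _ (area R) (@square R) _ (fun x => u x * sin (dotp n x) - S x * sin (dotp n x))); last first.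
    by move=> x _; rewrite -mulrBl.
  rewrite (I_B mD (igb_mul_sin n iu) (igb_mul_sin n iS)) -!fsinE fsin_trigp//.
  by case: (n \in s) => /=; ring.
have dT s' : uniq s' -> \sum_(n <- s') (`|fcos d n| + `|fsin d n|) <= T.
  move=> us'; rewrite (bigID (fun n => n \in s))/= big1 ?add0r; last first.
    by move=> n ns; rewrite fcd fsd ns !mul0r normr0 addr0.
  rewrite -big_filter; set s'' := [seq _ <- _ | _].
  apply: le_trans (sT s'' (filter_uniq _ us') _); last first.
    by move=> n; rewrite mem_filter => /andP[].
  rewrite big_seq [leRHS]big_seq; apply: ler_sum => n; rewrite mem_filter => /andP[ns _].
  by rewrite fcd fsd ns !mul1r.
have inter x : 0 < x.1 < 2 * pi -> 0 < x.2 < 2 * pi -> `|d x| <= 2 * T.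
  move=> x1 x2; rewrite ler_norml; apply/andP; split; last exact: (interior_bound cd id dT).
  rewrite lerNl; apply: (@interior_bound _ (fun x => - d x)) => //.
  - by move=> y; apply: cvgN; exact: cd.
  - exact: igbN.
  move=> s' us'; apply: le_trans (dT s' us'); apply: ler_sum => n _.
  have nE : fcos (fun x => - d x) n = - fcos d n.
    apply: (mulfI (lt0r_neq0 (area_gt0 R))); rewrite mulrN !fcosE -mulN1r -(I_Z mD); last exact: igb_mul_cos.
    by apply: eq_I => y _; ring.
  have sE : fsin (fun x => - d x) n = - fsin d n.
    apply: (mulfI (lt0r_neq0 (area_gt0 R))); rewrite mulrN !fsinE -mulN1r -(I_Z mD); last exact: igb_mul_sin.
    by apply: eq_I => y _; ring.
  by rewrite nE sE !normrN.
have pd : torus_periodic d.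
  by move=> x v pv; rewrite /d /S (@trigp_periodic s _ _ x v pv); have [-> ] := hu.
move=> x; rewrite -/(d x) leNgt; apply/negP => dx.
have cn : continuous (fun y => `|d y|) by move=> y; apply: cvg_norm; exact: cd.
have /nbhs_ballP[r /= r0 h] : \forall y \near x, 2 * T < `|d y|.
  by have := cn x _ (lt_nbhsr dx).
have pi0 : 0 < 2 * pi :> R by rewrite mulr_gt0// pi_gt0.
(* A point on the boundary lines has no translate in the open square; a small shift to the right in
   both coordinates gives it one. *)
have fl (t : R) : exists k : int, exists2 e, 0 < e & forall z, 0 < z < e -> 0 < t + z + 2 * pi * k%:~R < 2 * pi.
  exists (- Num.floor (t / (2 * pi))); rewrite rmorphN /= mulrN.
  have := floor_itv (t / (2 * pi)); set f := (Num.floor _)%:~R.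
  rewrite rmorphD /= -/f ler_pdivlMr// ltr_pdivrMr// => /andP[f1 f2].
  exists (2 * pi - (t - 2 * pi * f)) => [|z /andP[z0 z1]]; first by nra.
  by apply/andP; split; nra.
have [k1 [e1 e10 h1]] := fl x.1; have [k2 [e2 e20 h2]] := fl x.2.
pose z := Num.min r (Num.min e1 e2) / 2.
have m0 : 0 < Num.min r (Num.min e1 e2) by rewrite !lt_min r0 e10 e20.
have z0 : 0 < z by rewrite divr_gt0.
have [zr z1 z2] : [/\ z < r, z < e1 & z < e2].
  have zm : z < Num.min r (Num.min e1 e2) by rewrite /z ltr_pdivrMr// ltr_pMr// ltr1n.
  by move: zm; rewrite !lt_min => /and3P[].
have : 2 * T < `|d (x.1 + z, x.2 + z)|.
  by apply: h; split; rewrite /ball /= opprD addNKr normrN gtr0_norm.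
rewrite -(pd _ (2 * pi * k1%:~R, 2 * pi * k2%:~R)); last by exists k1, k2.
by apply/negP; rewrite -leNgt; apply: inter; rewrite /= ?h1 ?h2 ?z0.
Qed.
End Approximation.

Lemma ler_sum_subset (R : numDomainType) (J : eqType) (s t : seq J) (F : J -> R) :
  (forall j, 0 <= F j) -> uniq s -> {subset s <= t} ->
  \sum_(j <- s) F j <= \sum_(j <- t) F j.
Proof.
move=> F0; elim: s t => [|x s IH] t; first by rewrite big_nil sumr_ge0.
rewrite /= => /andP[xs us] st.
have xt : x \in t by apply: st; rewrite mem_head.
rewrite big_cons (big_rem x xt) /= lerD2l; apply: IH => // y ys.
have yt : y \in t by apply: st; rewrite inE ys orbT.
move: yt; rewrite (perm_mem (perm_to_rem xt)) inE => /orP[/eqP yx|//].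
by rewrite yx (negPf xs) in ys.
Qed.

Fixpoint disc (M : nat) : seq (int * int) :=
  if M is M'.+1 then circle M' ++ disc M' else [::].

Lemma mem_disc M z : (z \in disc M) = (nsq z < M)%N.
Proof.
by elim: M => //= M IH; rewrite mem_cat mem_circle IH ltnS [RHS]leq_eqVlt.
Qed.

Lemma uniq_disc M : uniq (disc M).
Proof.
elim: M => //= M IH; rewrite cat_uniq uniq_circle IH andbT /=.
by apply/hasPn => z; rewrite mem_disc /= mem_circle => zM; rewrite neq_ltn zM.
Qed.

Lemma big_disc (V : nmodType) (F : int * int -> V) M :
  \sum_(z <- disc M) F z = \sum_(N < M) \sum_(z <- circle N) F z.
Proof.
elim: M => [|M IH]; first by rewrite big_nil big_ord0.
by rewrite /= big_cat /= IH big_ord_recr /= addrC.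
Qed.

(** * Geometrically growing windows around lam^2 *)

Definition ndist (m n : nat) : nat := (m - n) + (n - m).

(** The j >= 1 with 2^(16 (j - 1)) <= |N - L| + 1 < 2^(16 j). The ratio 2^16 makes the exponents
    below integral and leaves a whole factor 2^j for weights. *)
Definition window (L N : nat) : nat := ((trunc_log 2 (ndist N L).+1) %/ 16).+1.

Lemma window_bounds L N :
  (2 ^ (16 * (window L N).-1) <= (ndist N L).+1 < 2 ^ (16 * window L N))%N.
Proof.
rewrite /window /=; set t := trunc_log _ _; apply/andP; split.
  apply: leq_trans (@trunc_logP 2 (ndist N L).+1 isT isT).
  by rewrite leq_pexp2l// mulnC leq_divM.
apply: leq_trans (@trunc_log_ltn 2 (ndist N L).+1 isT) _.
by rewrite leq_pexp2l// mulnC ltn_ceil.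
Qed.

Section WindowSum.
Variable R : realType.

(** Cauchy-Schwarz over 2^(16 j) terms gives 2^(14 j) B for an interval. Two intervals, the weight
    2^j and the divisor 2^(16 (j - 1)) make 2^(17 - j) B for window j, and the geometric series sums
    to at most 2^18 B. *)
Lemma window_sum (be wt : nat -> R) (L M : nat) (B : R) :
  (forall N, 0 <= be N) -> 0 <= B -> (forall N, 0 <= wt N <= 2 ^+ window L N) ->
  (forall j a : nat, \sum_(a <= N < a + 2 ^ (16 * j)) be N ^+ 2 <= 2 ^+ (12 * j) * B ^+ 2) ->
  \sum_(N < M) wt N * (be N / (ndist N L).+1%:R) <= 2 ^+ 18 * B.
Proof.
move=> be0 B0 wtle win.
have two0 k : 0 < 2 ^+ k :> R by rewrite exprn_gt0.
have winS j a : \sum_(a <= N < a + 2 ^ (16 * j)) be N <= 2 ^+ (14 * j) * B.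
  rewrite -(@ler_pXn2r _ 2) ?nnegrE ?sumr_ge0 ?mulr_ge0 ?(ltW (two0 _))//.
  apply: le_trans (sum_sqr_le_size _ _) _.
  rewrite size_iota addKn natrX exprMn -exprM.
  apply: le_trans (ler_wpM2l (ltW (two0 _)) (win j a)) _.
  by rewrite mulrA -exprD le_eqVlt; apply/orP; left; apply/eqP; congr (2 ^+ _ * _); lia.
have fib j : \sum_(0 <= N < M | window L N == j) wt N * (be N / (ndist N L).+1%:R)
    <= 2 ^+ 17 * B / 2 ^+ j.
  have [->|j0] := posnP j.
    by rewrite big_pred0 ?divr_ge0 ?mulr_ge0 ?(ltW (two0 _)).
  (* One interval on each side of L. If L is smaller than the length, truncated subtraction starts
     the left one at 0 and it still reaches L. *)
  have sub : \sum_(0 <= N < M | window L N == j) be N <= 2 * (2 ^+ (14 * j) * B).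
    rewrite -big_filter.
    apply: (@le_trans _ _ (\sum_(N <- index_iota (L - 2 ^ (16 * j)) (L - 2 ^ (16 * j) + 2 ^ (16 * j))
       ++ index_iota L (L + 2 ^ (16 * j))) be N)).
      apply: ler_sum_subset => //; first by rewrite filter_uniq// iota_uniq.
      move=> N; rewrite mem_filter mem_cat !mem_index_iota => /andP[/eqP Nj _].
      have := window_bounds L N; rewrite Nj /ndist => /andP[_].
      move: (2 ^ (16 * j))%N => K; lia.
    rewrite big_cat /= mulr2n mulrDl mul1r.
    by apply: lerD; exact: winS.
  apply: (@le_trans _ _ (\sum_(0 <= N < M | window L N == j) 2 ^+ j / 2 ^+ (16 * j.-1) * be N)).
    apply: ler_sum => N /eqP Nj; rewrite mulrAC -mulrA.
    have /andP[w0 w1] := wtle N; rewrite Nj in w1.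
    apply: ler_pM => //; first by rewrite divr_ge0.
    apply: ler_wpM2l => //; rewrite lef_pV2 ?posrE ?ltr0n// -natrX ler_nat.
    by have := window_bounds L N; rewrite Nj => /andP[].
  rewrite -mulr_sumr; apply: le_trans (ler_wpM2l _ sub) _.
    by rewrite divr_ge0 ?(ltW (two0 _)).
  rewrite le_eqVlt; apply/orP; left; apply/eqP.
  case: j j0 {sub} => // j _ /=.
  rewrite (_ : 14 * j.+1 = 14 + 14 * j)%N; last by lia.
  rewrite (_ : 16 * j = 14 * j + j + j)%N; last by lia.
  by rewrite !exprD !exprS expr0; field; rewrite !expf_neq0.
rewrite -(big_mkord xpredT (fun N => wt N * (be N / (ndist N L).+1%:R))).
rewrite (@sum_fibers _ _ _ _ (iota 0 (\max_(N < M) window L N).+1) (window L)) ?iota_uniq//; last first.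
  move=> N; rewrite mem_iota mem_index_iota => /andP[_ NM]; rewrite /= ltnS.
  exact: (@leq_bigmax_cond _ xpredT (fun N : 'I_M => window L N) (Ordinal NM)).
apply: (@le_trans _ _ (\sum_(j <- iota 0 (\max_(N < M) window L N).+1) 2 ^+ 17 * B / 2 ^+ j)).
  by apply: ler_sum => j _; exact: fib.
have geo k : \sum_(j <- iota 0 k) 2 ^+ 17 * B / 2 ^+ j = 2 ^+ 18 * B - 2 ^+ 18 * B / 2 ^+ k.
  elim: k => [|k IH]; first by rewrite big_nil expr0 divr1 subrr.
  rewrite -addn1 iotaD big_cat /= big_seq1 add0n IH addn1 !exprS.
  by field; rewrite expf_neq0.
by rewrite geo gerBl divr_ge0// ?mulr_ge0// ltW.
Qed.
End WindowSum.

(** * Fourth moments *)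

Section FourthMoment.
Variable R : realType.
Local Notation I f := (\int[area R]_(x in @square R) f x).
Local Notation igb f := ((area R).-integrable (@square R) (EFin \o f)).
Local Notation plane := (measurableTypeR R * measurableTypeR R)%type.
Local Notation A := ((2 * pi) ^+ 2 : R).
Local Notation sqint2 f := (sqint (area R) (@square R) f).
Let mD : measurable (@square R : set plane) := @measurable_square R.
Let muD := @area_square_fin R.
Implicit Types (s : seq (int * int)) (u : R * R -> R) (n m : int * int) (a b : int * int -> R).

Definition cnorm a b (N : nat) : R := Num.sqrt (energy (circle N) a b).

Lemma cnorm_ge0 a b N : 0 <= cnorm a b N.
Proof. exact: sqrtr_ge0. Qed.

Lemma cnorm_sqr a b N : cnorm a b N ^+ 2 = energy (circle N) a b.
Proof. by rewrite sqr_sqrtr// energy_ge0. Qed.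

Lemma trigp_disc M a b x : trigp (disc M) a b x = \sum_(N < M) trigp (circle N) a b x.
Proof. exact: big_disc. Qed.

Lemma trigp_circle_eq0 a b N x : cnorm a b N = 0 -> trigp (circle N) a b x = 0.
Proof.
move=> p0; have : energy (circle N) a b = 0 by rewrite -cnorm_sqr p0 expr0n.
move=> /eqP; rewrite psumr_eq0; last by move=> n _; rewrite addr_ge0 ?sqr_ge0.
move=> /allP h; rewrite /trigp big_seq big1// => n /h.
by rewrite /= paddr_eq0 ?sqr_ge0// !sqrf_eq0 => /andP[/eqP-> /eqP->]; rewrite !mul0r addr0.
Qed.

(** The case K = 1 of [window_count]: at most 2 points of a circle have n - k on it as well, hence
    the constant 3. *)
Lemma I_trigp_circle_pow4 a b N : I (fun x => trigp (circle N) a b x ^+ 4) <= A * (3 * cnorm a b N ^+ 4).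
Proof.
have -> : cnorm a b N ^+ 4 = energy (circle N) a b ^+ 2 by rewrite -cnorm_sqr -exprM.
apply: (@I_trigp_pow4 R _ a b 2 (uniq_circle N)) => k k0.
rewrite -[2%N]/(2 * 1 * 1)%N; apply: (window_count (A := N) k0) => //.
  by rewrite filter_uniq// uniq_circle.
move=> n; rewrite mem_filter !mem_circle => /andP[/eqP -> /eqP ->].
by rewrite leqnn addn1 ltnSn.
Qed.

(** The triangle inequality in L^4 over the circles. With y_N = T_N / p_N, convexity used twice
    gives (sum p_N y_N)^4 <= P^3 sum p_N y_N^4. If p_N = 0 then T_N = 0, and the value 0 of the
    inverse of 0 is harmless. *)
Lemma I_trigp_disc_pow4 a b M :
  I (fun x => trigp (disc M) a b x ^+ 4) <= 3 * A * (\sum_(N < M) cnorm a b N) ^+ 4.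
Proof.
set P := \sum_(N < M) _; pose g (N : nat) x := trigp (circle N) a b x.
have P0 : 0 <= P by apply: sumr_ge0 => N _; exact: cnorm_ge0.
pose q (N : nat) := (cnorm a b N ^+ 3)^-1.
have q0 N : 0 <= q N by rewrite invr_ge0 exprn_ge0// cnorm_ge0.
have qE N : cnorm a b N * (cnorm a b N)^-1 ^+ 4 = q N.
  rewrite /q; have [->|h] := eqVneq (cnorm a b N) 0; first by rewrite mul0r expr0n invr0.
  by field.
have pw x : trigp (disc M) a b x ^+ 4 <= P ^+ 3 * \sum_(N < M) q N * g N x ^+ 4.
  pose y (N : nat) := g N x / cnorm a b N.
  have -> : trigp (disc M) a b x = \sum_(N < M) cnorm a b N * y N.
    rewrite trigp_disc; apply: eq_bigr => N _; rewrite /y /g.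
    have [h|h] := eqVneq (cnorm a b N) 0; first by rewrite trigp_circle_eq0// h mul0r.
    by rewrite mulrC divfK.
  have h1 := @weighted_sum_sqr R 'I_M (index_enum _) (fun N => cnorm a b N) y (fun N => cnorm_ge0 a b N).
  have h2 := @weighted_sum_sqr R 'I_M (index_enum _) (fun N => cnorm a b N) (fun N => y N ^+ 2) (fun N => cnorm_ge0 a b N).
  rewrite -/P in h1 h2.
  have -> : \sum_(N < M) q N * g N x ^+ 4 = \sum_(N < M) cnorm a b N * (y N ^+ 2) ^+ 2.
    by apply: eq_bigr => N _; rewrite -exprM /y -qE exprMn; ring.
  set X := \sum_(N < M) _ * y N in h1 *; set Y := \sum_(N < M) _ * y N ^+ 2 in h1 h2.
  have Y0 : 0 <= Y by apply: sumr_ge0 => N _; rewrite mulr_ge0 ?cnorm_ge0 ?sqr_ge0.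
  have -> : X ^+ 4 = (X ^+ 2) ^+ 2 by rewrite -exprM.
  apply: (@le_trans _ _ ((P * Y) ^+ 2)).
    by rewrite lerXn2r ?nnegrE ?sqr_ge0 ?mulr_ge0.
  by rewrite exprMn [P ^+ 3]exprSr -mulrA; apply: ler_wpM2l; rewrite ?sqr_ge0.
have mg (N : nat) : igb (fun x => g N x ^+ 4).
  apply: (igb_bounded mD muD (M := (\sum_(n <- circle N) (`|a n| + `|b n|)) ^+ 4)).
    by apply: measurable_funX; exact: trigp_measurable.
  move=> y _; rewrite normrX lerXn2r// ?nnegrE ?normr_ge0 ?trigp_bounded//.
  by apply: sumr_ge0 => n _; rewrite addr_ge0.
apply: (@le_trans _ _ (I (fun x => P ^+ 3 * \sum_(N < M) q N * g N x ^+ 4))).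
  apply: (I_le mD) => //.
  - apply: (igb_bounded mD muD (M := (\sum_(n <- disc M) (`|a n| + `|b n|)) ^+ 4)).
      by apply: measurable_funX; exact: trigp_measurable.
    move=> y _; rewrite normrX lerXn2r// ?nnegrE ?normr_ge0 ?trigp_bounded//.
    by apply: sumr_ge0 => n _; rewrite addr_ge0.
  - by apply: (igbZ mD); apply: (igb_sum mD muD) => N; exact: (igbZ mD).
rewrite (I_Z mD); last by apply: (igb_sum mD muD) => N; exact: (igbZ mD).
rewrite (I_sum mD muD); last by move=> N; exact: (igbZ mD).
have -> : 3 * A * P ^+ 4 = P ^+ 3 * \sum_(N < M) (3 * A) * cnorm a b N.
  by rewrite -mulr_sumr -/P [in LHS]exprS; ring.
apply: ler_wpM2l; first exact: exprn_ge0.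
apply: ler_sum => N _; rewrite (I_Z mD)//.
apply: le_trans (ler_wpM2l (q0 N) (I_trigp_circle_pow4 a b N)) _.
rewrite -qE; have [->|h] := eqVneq (cnorm a b N) 0; first by rewrite !mul0r !mulr0.
by rewrite le_eqVlt; apply/orP; left; apply/eqP; field.
Qed.

(** The constant 24 is 8 times 3, from (v + w)^4 <= 8 v^4 + 8 w^4. The approximation error is taken
    at most 1, so that its fourth power is bounded by itself. *)
Lemma I_pow4_limit u (a b : int * int -> R) (C : R) : sqint2 u -> (exists M, forall x, @square R x -> `|u x| <= M) ->
  (forall eps, 0 < eps -> exists M, forall x, `|u x - trigp (disc M) a b x| <= eps) ->
  (forall M, \sum_(N < M) cnorm a b N <= C) ->
  I (fun x => u x ^+ 4) <= 24 * A * C ^+ 4.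
Proof.
move=> su [U uU] ap sC; have A0 := area_gt0 R.
have C0 : 0 <= C by have := sC 0%N; rewrite big_ord0.
have iu4 : igb (fun x => u x ^+ 4).
  apply: (igb_bounded mD muD (M := U ^+ 4)); first by apply: measurable_funX; exact: su.1.
  move=> x Dx; rewrite normrX lerXn2r ?nnegrE ?uU//; exact: le_trans (normr_ge0 _) (uU _ Dx).
apply/ler_addgt0Pr => eps eps0.
pose e := Num.min 1 (eps / (8 * A)).
have e0 : 0 < e by rewrite lt_min ltr01 divr_gt0// mulr_gt0.
have [M uM] := ap e e0.
set S := trigp (disc M) a b in uM.
have iS4 : igb (fun x => S x ^+ 4).
  apply: (igb_bounded mD muD (M := (\sum_(n <- disc M) (`|a n| + `|b n|)) ^+ 4)).
    by apply: measurable_funX; exact: trigp_measurable.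
  move=> y _; rewrite normrX lerXn2r// ?nnegrE ?normr_ge0 ?trigp_bounded//.
  by apply: sumr_ge0 => n _; rewrite addr_ge0.
apply: (@le_trans _ _ (I (fun x => 8 * S x ^+ 4 + 8 * e))).
  apply: (I_le mD) => //.
    by apply: (igbD mD); [exact: (igbZ mD)|exact: (igb_cst mD muD)].
  move=> x _; have := uM x; rewrite ler_norml; have e1 : e <= 1 by rewrite /e ge_min lexx.
  move: (u x) (S x) => v w /andP[h1 h2].
  have h3 : (v - w) ^+ 2 <= e ^+ 2 by clear -h1 h2; nra.
  have h4 : (v - w) ^+ 4 <= e.
    rewrite (exprM _ 2 2); apply: (@le_trans _ _ ((e ^+ 2) ^+ 2)).
      by rewrite lerXn2r ?nnegrE ?sqr_ge0.
    rewrite -exprM -[leRHS]expr1; apply: ler_wiXn2l => //; exact: ltW.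
  have h5 : v ^+ 4 <= 8 * w ^+ 4 + 8 * (v - w) ^+ 4.
    have h6 (p q : R) : (p + q) ^+ 2 <= 2 * p ^+ 2 + 2 * q ^+ 2.
      by rewrite -subr_ge0 (_ : _ - _ = (p - q) ^+ 2) ?sqr_ge0//; ring.
    have h7 := h6 w (v - w); rewrite addrC subrK in h7.
    rewrite !(exprM _ 2 2).
    apply: (@le_trans _ _ ((2 * w ^+ 2 + 2 * (v - w) ^+ 2) ^+ 2)).
      apply: lerXn2r; rewrite ?nnegrE ?sqr_ge0//.
      by apply: addr_ge0; apply: mulr_ge0; rewrite ?sqr_ge0.
    apply: le_trans (h6 _ _) _; rewrite le_eqVlt; apply/orP; left; apply/eqP; ring.
  apply: le_trans h5 _; lra.
rewrite (I_D mD (igbZ mD 8 iS4) (igb_cst mD muD (8 * e))) (I_Z mD)//.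
rewrite Rintegral_cst// area_square /=.
apply: lerD.
  rewrite (_ : 24 * A * C ^+ 4 = 8 * (3 * A * C ^+ 4)); last by ring.
  apply: ler_wpM2l => //; apply: le_trans (I_trigp_disc_pow4 a b M) _.
  apply: ler_wpM2l; first by rewrite mulr_ge0// ltW.
  by rewrite lerXn2r ?nnegrE ?sC// sumr_ge0// => N _; exact: cnorm_ge0.
have : e <= eps / (8 * A) by rewrite /e ge_min lexx orbT.
rewrite ler_pdivlMr; last by rewrite mulr_gt0.
by rewrite mulrA [e * 8]mulrC.
Qed.
End FourthMoment.

Section Summability.
Variable R : realType.
Local Notation I f := (\int[area R]_(x in @square R) f x).
Local Notation plane := (measurableTypeR R * measurableTypeR R)%type.
Local Notation A := ((2 * pi) ^+ 2 : R).
Local Notation sqint2 f := (sqint (area R) (@square R) f).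
Let mD : measurable (@square R : set plane) := @measurable_square R.
Implicit Types (s : seq (int * int)) (u : R * R -> R) (n m : int * int) (a b : int * int -> R).

(** Telescoping: 1 / (1 + l^2) <= 4 / ((l + 1) (l + 2)). *)
Lemma sum_inv_sqr (L : nat) : \sum_(k < L) (1 + k%:R ^+ 2)^-1 <= 5 - 4 / L.+1%:R :> R.
Proof.
elim: L => [|L IH]; first by rewrite big_ord0 divr1; lra.
rewrite big_ord_recr /=; apply: le_trans (lerD IH (lexx _)) _.
have -> : L.+2%:R = L%:R + 2 :> R by rewrite -natrD addn2.
rewrite -[L.+1%:R]natr1; have : 0 <= L%:R :> R by [].
move: (L%:R) => l l0.
have d1 : 0 < 1 + l ^+ 2 by rewrite ltr_wpDr// sqr_ge0.
have d2 : 0 < l + 1 by lra.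
have d3 : 0 < l + 2 by lra.
rewrite -subr_ge0.
rewrite (_ : _ - _ = (4 * (1 + l ^+ 2) - (l + 1) * (l + 2)) / ((l + 1) * (l + 2) * (1 + l ^+ 2))).
  by rewrite divr_ge0 ?mulr_ge0 ?(ltW d1) ?(ltW d2) ?(ltW d3)//; nra.
by field; rewrite !gt_eqF.
Qed.

(** Since (1 + |n|^2)^2 >= (1 + n_1^2) (1 + n_2^2), the sum is dominated by the square of a
    one-dimensional sum, at most 10. *)
Lemma sum_inv_nsq s : uniq s -> \sum_(n <- s) ((1 + (nsq n)%:R)^-1) ^+ 2 <= 100 :> R.
Proof.
move=> us; pose f (k : int) : R := (1 + k%:~R ^+ 2)^-1.
have f0 k : 0 <= f k by rewrite invr_ge0 addr_ge0// sqr_ge0.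
pose L := (\max_(n <- s) maxn `|n.1| `|n.2|).+1.
pose r := [seq k%:Z | k <- iota 0 L] ++ [seq - k%:Z | k <- iota 0 L].
have fr : \sum_(k <- r) f k <= 10.
  rewrite big_cat !big_map /=.
  have fN k : f (- k) = f k by rewrite /f rmorphN /= sqrrN.
  under [X in _ + X]eq_bigr do rewrite fN.
  have h : \sum_(j <- iota 0 L) f j <= 5.
    have := sum_inv_sqr L; rewrite -(big_mkord xpredT (fun k => (1 + k%:R ^+ 2)^-1)) /index_iota subn0.
    move=> /le_trans; apply; rewrite gerBl divr_ge0//.
  lra.
have inr (n : int * int) (k : int) : n \in s -> (`|k| <= maxn `|n.1| `|n.2|)%N -> k \in r.
  move=> ns kn; have kL : (`|k| < L)%N.
    rewrite /L ltnS (leq_trans kn)//.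
    exact: (@leq_bigmax_seq _ _ xpredT (fun n : int * int => maxn `|n.1| `|n.2|)).
  rewrite mem_cat; apply/orP; have [k0|k0] := leP 0 k; [left|right]; apply/mapP; exists `|k|%N;
    rewrite ?mem_iota//; lia.
apply: (@le_trans _ _ (\sum_(n <- [seq (x, y) | x <- r, y <- r]) f n.1 * f n.2)).
  apply: (@le_trans _ _ (\sum_(n <- s) f n.1 * f n.2)).
    apply: ler_sum => n _; rewrite /f -invfM exprVn lef_pV2 ?posrE; last 2 first.
    - by rewrite exprn_gt0// ltr_wpDr.
    - by rewrite mulr_gt0// ltr_wpDr// sqr_ge0.
    rewrite -[(nsq n)%:R]/((nsq n)%:Z%:~R) nsqE rmorphD !rmorphXn /=.
    have := sqr_ge0 (n.1%:~R : R); have := sqr_ge0 (n.2%:~R : R).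
    move: (_ ^+ 2) (_ ^+ 2) => x y x0 y0; nra.
  apply: ler_sum_subset => // [n|[x y] ns]; first exact: mulr_ge0.
  apply: allpairs_f; apply: (inr _ _ ns) => /=; lia.
rewrite big_allpairs_dep /=.
under eq_bigr do rewrite -mulr_sumr.
rewrite -mulr_suml -expr2 (_ : 100 = 10 ^+ 2); last by ring.
by rewrite lerXn2r ?nnegrE// sumr_ge0.
Qed.

Lemma product_sqint (V u : R * R -> R) : L2_torus V -> L2_torus u -> continuous u ->
  sqint2 (fun x => V x * u x).
Proof.
move=> hV hu cu; have sV := L2_torus_sqint hV; have su := L2_torus_sqint hu.
have [M uM] := continuous_square_bounded cu.
split; first by apply: measurable_funM; [exact: sV.1|exact: su.1].
apply: (igb_le mD (g := fun x => M ^+ 2 * V x ^+ 2)).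
- by apply: measurable_funX; apply: measurable_funM; [exact: sV.1|exact: su.1].
- move=> x Dx; rewrite ger0_norm ?sqr_ge0// exprMn mulrC ler_wpM2r ?sqr_ge0//.
  rewrite -(real_normK (num_real (u x))).
  by rewrite lerXn2r ?nnegrE// ?uM// (le_trans _ (uM _ Dx)).
by apply: (igbZ mD); exact: sV.2.
Qed.

Lemma energy_catl s a b : \sum_(n <- s) a n ^+ 2 <= energy s a b.
Proof. by apply: ler_sum => n _; rewrite lerDl sqr_ge0. Qed.

Lemma energy_catr s a b : \sum_(n <- s) b n ^+ 2 <= energy s a b.
Proof. by apply: ler_sum => n _; rewrite lerDr sqr_ge0. Qed.

(** With v = 1 / (1 + |n|^2), the equation gives c = v (- d + (1 + lam^2) c), where d are
    coefficients of V u; v, c and d are square summable. The bound depends on lam and u, which is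
    enough for uniform convergence. *)
Lemma coef_summable (V u : R * R -> R) lam : L2_torus V -> real_eigen V lam u ->
  exists K, forall s, uniq s -> \sum_(n <- s) (`|fcos u n| + `|fsin u n|) <= K.
Proof.
move=> hV hu; have [cu lu _] := hu.
have A0 := area_gt0 R.
have sw := product_sqint hV lu cu; have su := L2_torus_sqint lu.
set w := fun x => V x * u x in sw.
pose Y := I (fun x => w x ^+ 2) / A; pose U := I (fun x => u x ^+ 2) / A.
have bw s : uniq s -> energy s (fcos w) (fsin w) <= Y.
  by move=> us; rewrite ler_pdivlMr// mulrC; exact: bessel.
have bu s : uniq s -> energy s (fcos u) (fsin u) <= U.
  by move=> us; rewrite ler_pdivlMr// mulrC; exact: bessel.
have key (c d : int * int -> R) s : uniq s ->
    (forall n, ((nsq n)%:R - lam ^+ 2) * c n = - d n) ->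
    \sum_(n <- s) c n ^+ 2 <= U -> \sum_(n <- s) d n ^+ 2 <= Y ->
    \sum_(n <- s) `|c n| <= Y + (1 + lam ^+ 2) ^+ 2 * U + 50.
  move=> us eqn cU dY.
  apply: (@le_trans _ _ (\sum_(n <- s) (d n ^+ 2 + (1 + lam ^+ 2) ^+ 2 * c n ^+ 2
      + 2^-1 * ((1 + (nsq n)%:R)^-1) ^+ 2))).
    apply: ler_sum => n _; have := eqn n.
    have : 0 <= (nsq n)%:R :> R by [].
    move: (nsq n)%:R => q q0 qE; set v := (1 + q)^-1.
    have v0 : 0 < v by rewrite invr_gt0 ltr_wpDr.
    have cE : c n = v * (- d n + (1 + lam ^+ 2) * c n).
      by rewrite -qE -mulrDl mulrA /v (_ : q - _ + _ = 1 + q) ?mulVf ?mul1r// ?gt_eqF ?ltr_wpDr//; ring.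
    have h1 : `|c n| <= v * (`|d n| + (1 + lam ^+ 2) * `|c n|).
      rewrite {1}cE normrM (gtr0_norm v0) ler_wpM2l ?(ltW v0)//.
      apply: le_trans (ler_normD _ _) _; rewrite normrN normrM (@ger0_norm _ (1 + _))//.
      by rewrite addr_ge0// sqr_ge0.
    apply: le_trans h1 _; rewrite -(real_normK (num_real (d n))) -(real_normK (num_real (c n))).
    rewrite -exprMn; move: `|d n| (_ * `|c n|) => x y; clear.
    have := sqr_ge0 (x - y); have := sqr_ge0 (v - x - y); nra.
  rewrite !big_split /= -!mulr_sumr; have := sum_inv_nsq us => h.
  apply: lerD; last by lra.
  by apply: lerD => //; apply: ler_wpM2l; rewrite ?sqr_ge0.
exists ((Y + (1 + lam ^+ 2) ^+ 2 * U + 50) + (Y + (1 + lam ^+ 2) ^+ 2 * U + 50)) => s us.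
rewrite big_split /=; apply: lerD.
  apply: (key _ (fcos w)) => //.
  - by move=> n; exact: (coef_equation n hV hu).1.
  - exact: le_trans (energy_catl _ _ _) (bu s us).
  - exact: le_trans (energy_catl _ _ _) (bw s us).
apply: (key _ (fsin w)) => //.
- by move=> n; exact: (coef_equation n hV hu).2.
- exact: le_trans (energy_catr _ _ _) (bu s us).
- exact: le_trans (energy_catr _ _ _) (bw s us).
Qed.

(** Otherwise blocks of mass more than eps could be appended forever, exceeding K. *)
Lemma summable_tail (f : int * int -> R) (K eps : R) : (forall n, 0 <= f n) ->
  (forall s, uniq s -> \sum_(n <- s) f n <= K) -> 0 < eps ->
  exists2 s0, uniq s0 & forall s, uniq s -> (forall n, n \in s -> n \notin s0) ->
    \sum_(n <- s) f n <= eps.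
Proof.
move=> f0 fK eps0; apply: contrapT => nt.
have grow k : exists2 s, uniq s & k%:R * eps <= \sum_(n <- s) f n.
  elim: k => [|k [s us sk]]; first by exists [::]; rewrite // mul0r big_nil.
  apply: contrapT => ns; apply: nt; exists s => // s' us' ss'.
  rewrite leNgt; apply/negP => h; apply: ns; exists (s' ++ s).
    by rewrite cat_uniq us us' andbT/=; apply/hasPn => n ns; apply/negP => /ss'; rewrite ns.
  by rewrite big_cat -natr1 mulrDl mul1r addrC /= lerD// ltW.
have /archi_boundP : 0 <= K / eps.
  by rewrite divr_ge0 ?(ltW eps0)//; have := fK [::] isT; rewrite big_nil.
set k := Num.bound _; have [s us sk] := grow k.
by rewrite ltr_pdivrMr// ltNge (le_trans sk)// fK.
Qed.

Lemma disc_approx (V u : R * R -> R) lam (eps : R) : L2_torus V -> real_eigen V lam u -> 0 < eps ->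
  exists M, forall x, `|u x - trigp (disc M) (fcos u) (fsin u) x| <= eps.
Proof.
move=> hV hu eps0; have [cu lu _] := hu.
have [K KP] := coef_summable hV hu.
have f0 n : 0 <= `|fcos u n| + `|fsin u n| by exact: addr_ge0.
have e2 : 0 < eps / 2 by rewrite divr_gt0.
have [s0 us0 s0P] := summable_tail f0 KP e2.
exists (\max_(n <- s0) nsq n).+1 => x.
rewrite [leRHS](_ : eps = 2 * (eps / 2)); last by field.
apply: trigp_approx => //; first exact: uniq_disc.
  by move=> m; rewrite !mem_disc nsqN.
move=> s' us' ss'; apply: s0P => // n /ss'; apply: contra => ns; rewrite mem_disc ltnS.
exact: (@leq_bigmax_seq _ _ xpredT nsq).
Qed.
End Summability.

(** * Absorption of the L^4 norm *)

Section Absorption.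
Variable R : realType.
Local Notation I f := (\int[area R]_(x in @square R) f x).
Local Notation igb f := ((area R).-integrable (@square R) (EFin \o f)).
Local Notation plane := (measurableTypeR R * measurableTypeR R)%type.
Local Notation A := ((2 * pi) ^+ 2 : R).
Local Notation sqint2 f := (sqint (area R) (@square R) f).
Let mD : measurable (@square R : set plane) := @measurable_square R.
Let muD := @area_square_fin R.
Implicit Types (s : seq (int * int)) (u : R * R -> R) (n m : int * int) (a b : int * int -> R).

(** V is clamped to [-k, k]. At each point the error vanishes for large k, and its square is
    dominated by V^2. *)
Lemma L2_truncation (V : R * R -> R) (del : R) : L2_torus V -> 0 < del ->
  exists M V1, [/\ measurable_fun (@square R) (V1 : plane -> R), forall x, `|V1 x| <= M,
    sqint2 (fun x => V x - V1 x) & I (fun x => (V x - V1 x) ^+ 2) <= del].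
Proof.
move=> hV del0; have sV := L2_torus_sqint hV.
pose V1 (k : nat) x := Num.max (- k%:R) (Num.min (V x) k%:R).
have mV1 k : measurable_fun (@square R) (V1 k : plane -> R).
  apply: measurable_maxr => //; apply: measurable_minr => //; exact: sV.1.
have bV1 k x : `|V1 k x| <= k%:R.
  rewrite /V1 ler_norml le_max lexx /= ge_max ge_min lexx orbT andbT.
  by rewrite (@le_trans _ _ 0)// oppr_le0.
have Wle k x : (V x - V1 k x) ^+ 2 <= V x ^+ 2.
  rewrite -(real_normK (num_real (V x - _))) -(real_normK (num_real (V x))).
  rewrite lerXn2r ?nnegrE//; have k0 : 0 <= k%:R :> R by [].
  rewrite /V1; case: (leP (V x) k%:R) => h1.
    case: (leP (- k%:R) (V x)) => h2; first by rewrite subrr normr0.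
    by rewrite !ler0_norm; lra.
  case: (leP (- k%:R) k%:R) => h2; last by lra.
  by rewrite !ger0_norm; lra.
have mW k : measurable_fun (@square R) (fun x : plane => V x - V1 k x).
  by apply: measurable_funB => //; exact: sV.1.
have sW k : sqint2 (fun x => V x - V1 k x).
  split; first exact: mW.
  apply: (igb_le mD _ _ sV.2); first by apply: measurable_funX; exact: mW.
  by move=> x _; rewrite ger0_norm ?sqr_ge0//; exact: Wle.
have dc : [sequence (\int[area R]_(x in @square R) ((V x - V1 k x) ^+ 2)%:E)%E]_k @ \oo
    --> (\int[area R]_(x in @square R) (cst 0%E x : \bar R))%E.
  have [] // := @dominated_convergence _ _ R (area R) (@square R) mD
    (fun k => EFin \o (fun x => (V x - V1 k x) ^+ 2)) (cst 0%E) (EFin \o (fun x => V x ^+ 2)).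
  - by move=> k; apply/measurable_EFinP; apply: measurable_funX; exact: mW.
  - apply: aeW => x Dx /=; apply: cvg_near_cst; exists (Num.bound `|V x|) => // k /= kV.
    have /archi_boundP Vb : 0 <= `|V x| by [].
    have Vk : `|V x| <= k%:R by apply: ltW; rewrite (lt_le_trans Vb)// ler_nat.
    have : V1 k x = V x.
      move: Vk; rewrite ler_norml => /andP[v1 v2].
      by rewrite /V1 (min_idPl v2) (max_idPr v1).
    by move=> ->; rewrite subrr expr0n.
  - exact: sV.2.
  by apply: aeW => x k Dx; rewrite /= lee_fin ger0_norm ?sqr_ge0//; exact: Wle.
rewrite integral0 in dc.
have [k _ /(_ k (leqnn k)) /= Wk] := cvgr_lt 0 (fine_cvg dc) del del0.
by exists k%:R, (V1 k); split => //; apply: ltW.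
Qed.

Definition annulus (c K : nat) : seq (int * int) := [seq z <- disc (c + K) | (c <= nsq z)%N].

Lemma sum_annulus c K a b :
  \sum_(c <= N < c + K) cnorm a b N ^+ 2 = energy (annulus c K) a b.
Proof.
rewrite /energy /annulus big_filter [RHS]big_mkcond.
rewrite big_disc /= -(big_mkord xpredT (fun N =>
  \sum_(z <- circle N) (if (c <= nsq z)%N then a z ^+ 2 + b z ^+ 2 else 0))).
rewrite (@big_cat_nat _ _ _ c 0 (c + K)) ?leq_addr//= [X in _ = X + _]big1_seq; last first.
  move=> N; rewrite mem_index_iota => /andP[_ /andP[_ Nc]]; rewrite big_seq big1// => z.
  by rewrite mem_circle => /eqP ->; rewrite leqNgt Nc.
rewrite add0r; apply: eq_big_nat => N /andP[cN _]; rewrite cnorm_sqr /energy.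
by apply: eq_big_seq => z; rewrite mem_circle => /eqP ->; rewrite cN.
Qed.

Lemma uniq_annulus c K : uniq (annulus c K).
Proof. by rewrite filter_uniq// uniq_disc. Qed.

Lemma annulus_count (c K h : nat) (k : int * int) : k != 0 -> (K <= h ^ 2)%N ->
  (size [seq n <- annulus c K | (n - k)%R \in annulus c K] <= 2 * K * h)%N.
Proof.
move=> k0 Km; apply: (window_count (A := c) k0) => //; first by rewrite filter_uniq// uniq_annulus.
by move=> n; rewrite !mem_filter !mem_disc => /andP[/andP[-> ->] /andP[-> ->]].
Qed.

Lemma energyD_le s a b a' b' :
  energy s (fun n => a n + a' n) (fun n => b n + b' n) <= 2 * energy s a b + 2 * energy s a' b'.
Proof.
rewrite /energy !mulr_sumr -big_split /=; apply: ler_sum => n _.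
have h (p q : R) : (p + q) ^+ 2 <= 2 * p ^+ 2 + 2 * q ^+ 2.
  by rewrite -subr_ge0 (_ : _ - _ = (p - q) ^+ 2) ?sqr_ge0//; ring.
by have := h (a n) (a' n); have := h (b n) (b' n); lra.
Qed.

Lemma eq_energy s a b a' b' : a =1 a' -> b =1 b' -> energy s a b = energy s a' b'.
Proof. by move=> ea eb; apply: eq_bigr => n _; rewrite ea eb. Qed.

Lemma fcosD (v w : R * R -> R) n : igb v -> igb w -> fcos (fun x => v x + w x) n = fcos v n + fcos w n.
Proof.
move=> iv iw; rewrite /fcos -mulrDr -(I_D mD (igb_mul_cos n iv) (igb_mul_cos n iw)).
by congr (_ * _); apply: eq_I => x _; rewrite mulrDl.
Qed.

Lemma fsinD (v w : R * R -> R) n : igb v -> igb w -> fsin (fun x => v x + w x) n = fsin v n + fsin w n.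
Proof.
move=> iv iw; rewrite /fsin -mulrDr -(I_D mD (igb_mul_sin n iv) (igb_mul_sin n iw)).
by congr (_ * _); apply: eq_I => x _; rewrite mulrDl.
Qed.

(** One unit pays for rounding lam^2 down, the other for the successor that keeps the divisor
    positive, also when N is at or near lam^2. *)
Lemma dist_truncn (l : R) (N : nat) : 0 <= l ->
  (ndist N (Num.truncn l)).+1%:R <= `|N%:R - l| + 2.
Proof.
move=> l0; have /andP[t1 t2] := truncn_itv l0; set L := Num.truncn l in t1 t2 *.
rewrite -natr1 in t2; rewrite -natr1 /ndist.
have [NL|NL] := leqP N L.
  have -> : (N - L + (L - N) = L - N)%N by lia.
  by rewrite natrB// distrC; have := ler_norm (l - N%:R); lra.
have -> : (N - L + (L - N) = N - L)%N by lia.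
by rewrite natrB 1?ltnW//; have := ler_norm (N%:R - l); lra.
Qed.

Fact window_count_bound (j : nat) : (2 * 2 ^ (16 * j) * 2 ^ (8 * j) < 4 * 2 ^ (24 * j))%N.
Proof.
by rewrite -mulnA -expnD -mulnDl ltn_pmul2r ?expn_gt0.
Qed.

(* V is bounded up to a part that is small in L^2; the contribution of the latter
   involves the L^4 norm of u, which is bounded by the sum itself. *)
Lemma cnorm_sum_bound (V : R * R -> R) : L2_torus V -> exists2 C : R, 0 <= C &
  forall (lam : R) u (wt : nat -> R), real_eigen V lam u ->
    (forall N, 0 <= wt N <= 2 ^+ window (Num.truncn (lam ^+ 2)) N) ->
    forall M, \sum_(N < M) wt N * cnorm (fcos u) (fsin u) N <= C * Num.sqrt (I (fun x => u x ^+ 2)).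
Proof.
move=> hV; have A0 := area_gt0 R; have sV := L2_torus_sqint hV.
pose G : R := 2 ^+ 18; have G0 : 0 < G by rewrite exprn_gt0.
(* Chosen so that 8 (W2 / A) q <= B2 / 2 once q <= 5 G^2 B2 is known. *)
have del0 : 0 < A / (80 * G ^+ 2) by rewrite divr_gt0// mulr_gt0// exprn_gt0.
have [M0 [V1 [mV1 bV1 sW Wdel]]] := L2_truncation hV del0.
set W2 := I (fun x => (V x - V1 x) ^+ 2) in Wdel.
have W20 : 0 <= W2 by apply: I_ge0 => x _; exact: sqr_ge0.
pose C0 := 2 * ((4 * M0 ^+ 2 + 8) / A).
have C00 : 0 <= C0 by rewrite mulr_ge0// divr_ge0 ?(ltW A0)// addr_ge0// mulr_ge0// sqr_ge0.
exists (G * Num.sqrt C0) => [|lam u wt hu wtle M]; first by rewrite mulr_ge0 ?sqrtr_ge0 ?ltW.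
have [cu lu _] := hu; have su := L2_torus_sqint lu.
have [bu buP] := continuous_square_bounded cu.
set U := I (fun x => u x ^+ 2).
have U0 : 0 <= U by apply: I_ge0 => x _; exact: sqr_ge0.
set L := Num.truncn _ in wtle.
pose U4 := I (fun x => u x ^+ 4).
have U40 : 0 <= U4 by apply: I_ge0 => x _; rewrite (exprM _ 2 2) sqr_ge0.
pose q := Num.sqrt (U4 / A).
have q0 : 0 <= q by exact: sqrtr_ge0.
have q2 : A * q ^+ 2 = U4 by rewrite sqr_sqrtr ?divr_ge0 ?(ltW A0)// mulrC divfK// gt_eqF.
pose w x := V x * u x; pose w1 x := V1 x * u x; pose w2 x := (V x - V1 x) * u x.
have sV1 : sqint2 V1 by apply: (sqint_bounded mD muD (M := M0)).
have iw1 : igb w1 := sqint_mul mD sV1 su.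
have iw2 : igb w2 := sqint_mul mD sW su.
have sw1 : sqint2 w1.
  split; first by apply: measurable_funM; [exact: mV1|exact: su.1].
  apply: (igb_le mD (g := fun x => M0 ^+ 2 * u x ^+ 2)).
  - by apply: measurable_funX; apply: measurable_funM; [exact: mV1|exact: su.1].
  - move=> x _; rewrite ger0_norm ?sqr_ge0// exprMn ler_wpM2r ?sqr_ge0//.
    rewrite -(real_normK (num_real (V1 x))).
    by rewrite lerXn2r ?nnegrE// (le_trans _ (bV1 x)).
  by apply: (igbZ mD); exact: su.2.
have w1U : I (fun x => w1 x ^+ 2) <= M0 ^+ 2 * U.
  rewrite -(I_Z mD) ?su.2//; apply: (I_le mD); [exact: sw1.2|by apply: (igbZ mD); exact: su.2|].
  move=> x _; rewrite exprMn ler_wpM2r ?sqr_ge0//.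
  rewrite -(real_normK (num_real (V1 x))).
  by rewrite lerXn2r ?nnegrE// (le_trans _ (bV1 x)).
have fw n : fcos w n = fcos w1 n + fcos w2 n /\ fsin w n = fsin w1 n + fsin w2 n.
  rewrite -fcosD// -fsinD//; split; congr (_ * _); apply: eq_I => x _; rewrite /w /w1 /w2; ring.
pose om N := cnorm (fcos w) (fsin w) N; pose p N := cnorm (fcos u) (fsin u) N.
(* The factor |n|^2 - lam^2 is constant on a circle, so the coefficient equation passes to the
   circle norms. *)
have omE N : `|N%:R - lam ^+ 2| * p N = om N.
  rewrite -[LHS](ger0_norm (mulr_ge0 (normr_ge0 _) (cnorm_ge0 _ _ _))) -sqrtr_sqr /om /cnorm.
  congr Num.sqrt; rewrite exprMn cnorm_sqr real_normK ?num_real// /energy mulr_sumr.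
  apply: eq_big_seq => z; rewrite mem_circle => /eqP zN.
  have [h1 h2] := coef_equation z hV hu; rewrite zN in h1 h2.
  by rewrite mulrDr -!exprMn h1 h2 !sqrrN.
(* The term 2 p N matches the loss of 2 in [dist_truncn]; no case distinction near the resonance N =
   lam^2 is needed. *)
pose be N := om N + 2 * p N.
have be0 N : 0 <= be N by rewrite addr_ge0 ?mulr_ge0 ?cnorm_ge0.
have pbe N : p N <= be N / (ndist N L).+1%:R.
  rewrite ler_pdivlMr ?ltr0n// /be -omE -mulrDl mulrC ler_wpM2r ?cnorm_ge0//.
  by apply: dist_truncn; rewrite sqr_ge0.
(* From be^2 <= 2 om^2 + 8 p^2: the bounded part of V gives 4 M0^2, the term 8 p^2 gives 8, both by
   Bessel, and the small part of V gives the term in q, the square root of the fourth moment of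
   u. *)
pose B2 := (4 * M0 ^+ 2 + 8) / A * U + 8 * (W2 / A) * q.
have X0 : 0 <= (4 * M0 ^+ 2 + 8) / A * U.
  by rewrite mulr_ge0// divr_ge0 ?(ltW A0)// addr_ge0// mulr_ge0// sqr_ge0.
have WA0 : 0 <= W2 / A by rewrite divr_ge0// ltW.
have B20 : 0 <= B2 by rewrite addr_ge0// mulr_ge0// mulr_ge0.
have win j c : \sum_(c <= N < c + 2 ^ (16 * j)) be N ^+ 2 <= 2 ^+ (12 * j) * Num.sqrt B2 ^+ 2.
  rewrite sqr_sqrtr//.
  pose K := (2 ^ (16 * j))%N; pose t : R := 2 ^+ (12 * j); rewrite -/t.
  have t1 : 1 <= t by rewrite exprn_ege1// ler1n.
  apply: (@le_trans _ _ (\sum_(c <= N < c + K) (2 * om N ^+ 2 + 8 * p N ^+ 2))).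
    apply: ler_sum => N _; rewrite -subr_ge0 (_ : _ - _ = (om N - 2 * p N) ^+ 2) ?sqr_ge0//.
    by rewrite /be; ring.
  rewrite big_split /= -!mulr_sumr !sum_annulus; set S := annulus c K.
  have uS : uniq S by exact: uniq_annulus.
  have E1 : energy S (fcos w1) (fsin w1) <= M0 ^+ 2 * U / A.
    by rewrite ler_pdivlMr// mulrC; apply: le_trans w1U; exact: bessel.
  have Eu : energy S (fcos u) (fsin u) <= U / A.
    by rewrite ler_pdivlMr// mulrC; exact: bessel.
  have E2 : energy S (fcos w2) (fsin w2) <= 2 * t * (W2 / A * q).
    set E := energy _ _ _.
    rewrite -(@ler_pXn2r _ 2) ?nnegrE ?energy_ge0//; last first.
      by apply: mulr_ge0; apply: mulr_ge0 => //; exact: le_trans ler01 t1.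
    have Kh : (K <= (2 ^ (8 * j)) ^ 2)%N by rewrite -expnM mulnAC.
    have := product_energy uS (fun k k0 => @annulus_count c K _ k k0 Kh) sW su.1 buP.
    rewrite -/E -/W2 -/U4 -q2 => h.
    have c4 : (2 * K * 2 ^ (8 * j)).+1%:R <= 4 * t ^+ 2 :> R.
      have -> : (4 * t ^+ 2 : R) = (4 * 2 ^ (24 * j))%:R.
        by rewrite natrM natrX /t -exprM mulnAC.
      rewrite ler_nat; exact: window_count_bound.
    rewrite -(ler_pM2l (x := A ^+ 3)); last exact: exprn_gt0.
    apply: le_trans h _.
    rewrite [leRHS](_ : _ = 4 * t ^+ 2 * W2 ^+ 2 * (A * q ^+ 2)); last first.
      have gen (x y z v : R) : x != 0 -> x ^+ 3 * (2 * y * (z / x * v)) ^+ 2 = 4 * y ^+ 2 * z ^+ 2 * (x * v ^+ 2).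
        by move=> x0; field.
      by apply: gen; rewrite gt_eqF.
    apply: ler_wpM2r; first by rewrite mulr_ge0 ?sqr_ge0// ltW.
    by apply: ler_wpM2r => //; exact: sqr_ge0.
  have Ew : energy S (fcos w) (fsin w) <= 2 * (M0 ^+ 2 * U / A) + 2 * (2 * t * (W2 / A * q)).
    rewrite (eq_energy _ (fun n => (fw n).1) (fun n => (fw n).2)).
    apply: le_trans (energyD_le _ _ _ _ _) _.
    by apply: lerD; apply: ler_wpM2l.
  have UA0 : 0 <= U / A by rewrite divr_ge0// ltW.
  apply: (@le_trans _ _ (2 * (2 * (M0 ^+ 2 * U / A) + 2 * (2 * t * (W2 / A * q))) + 8 * (U / A))).
    by apply: lerD; apply: ler_wpM2l.
  have -> : t * B2 = t * ((4 * M0 ^+ 2 + 8) / A * U) + 8 * t * (W2 / A * q) by rewrite /B2; ring.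
  have : (4 * M0 ^+ 2 + 8) / A * U <= t * ((4 * M0 ^+ 2 + 8) / A * U) by rewrite ler_peMl.
  have -> : (4 * M0 ^+ 2 + 8) / A * U = 4 * (M0 ^+ 2 * U / A) + 8 * (U / A) by ring.
  clear; lra.
have sqB0 : 0 <= Num.sqrt B2 by exact: sqrtr_ge0.
have main (wt' : nat -> R) M' : (forall N, 0 <= wt' N <= 2 ^+ window L N) ->
    \sum_(N < M') wt' N * p N <= G * Num.sqrt B2.
  move=> wt'le; apply: le_trans (window_sum M' be0 sqB0 wt'le win).
  by apply: ler_sum => N _; apply: ler_wpM2l => //; have /andP[] := wt'le N.
have sp M' : \sum_(N < M') p N <= G * Num.sqrt B2.
  have := main (fun=> 1) M'; under eq_bigr do rewrite mul1r.
  by apply=> N; rewrite ler01 exprn_ege1// ler1n.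
have U4le : U4 <= 24 * A * (G * Num.sqrt B2) ^+ 4.
  apply: (@I_pow4_limit _ u (fcos u) (fsin u)) => //; first by exists bu.
  by move=> eps eps0; exact: (disc_approx hV hu).
(* The constant 24 of the fourth moment is rounded up to 25 to have an exact root. *)
have qB : q <= 5 * G ^+ 2 * B2.
  rewrite -(@ler_pXn2r _ 2) ?nnegrE ?mulr_ge0 ?sqr_ge0//.
  rewrite -(ler_pM2l A0) q2; apply: le_trans U4le _.
  rewrite [(G * _) ^+ 4]exprMn (_ : Num.sqrt B2 ^+ 4 = B2 ^+ 2); last by rewrite -[in RHS](sqr_sqrtr B20) -exprM.
  rewrite (_ : A * _ = 25 * A * (G ^+ 4 * B2 ^+ 2)); last by ring.
  rewrite ler_wpM2r ?mulr_ge0 ?sqr_ge0 ?exprn_ge0 ?(ltW G0)//.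
  by rewrite ler_wpM2r ?(ltW A0)// ler_nat.
have WG : W2 / A * (80 * G ^+ 2) <= 1.
  rewrite mulrAC ler_pdivrMr// mul1r.
  by move: Wdel; rewrite ler_pdivlMr// mulr_gt0// exprn_gt0.
(* The absorption: the term of [B2] that contains q is at most B2 / 2, so [B2] is at most twice the
   other term. *)
have B2le : B2 <= C0 * U.
  have : 8 * (W2 / A) * q <= B2 / 2.
    have h1 : (W2 / A) * q <= (W2 / A) * (5 * G ^+ 2 * B2) by exact: ler_wpM2l.
    have h2 : W2 / A * (80 * G ^+ 2) * B2 <= 1 * B2 by exact: ler_wpM2r.
    clear -h1 h2; clearbody B2; move: (W2 / A) (G ^+ 2) h1 h2 => t g; lra.
  have : B2 = (4 * M0 ^+ 2 + 8) / A * U + 8 * (W2 / A) * q by [].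
  rewrite /C0 -[2 * _ * U]mulrA; move: (_ / A * U) (8 * _ * q); clear; move: B2 => b X y; lra.
apply: le_trans (main wt M wtle) _; rewrite -mulrA ler_pM2l// -sqrtrM//.
exact: ler_wsqrtr.
Qed.
End Absorption.

(** * Restriction of trigonometric polynomials to curves *)

Section Minkowski.
Context d (T : measurableType d) (R : realType) (mu : {measure set T -> \bar R}).
Variables (D : set T) (mD : measurable D) (muD : (mu D < +oo)%E).
Local Notation I f := (\int[mu]_(x in D) f x).

Lemma I_sum_sqr (J : Type) (s : seq J) (g : J -> T -> R) (q : J -> R) :
  (forall j, sqint mu D (g j)) -> (forall j, 0 <= q j) ->
  (forall j, I (fun x => g j x ^+ 2) <= q j ^+ 2) ->
  I (fun x => (\sum_(j <- s) g j x) ^+ 2) <= (\sum_(j <- s) q j) ^+ 2.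
Proof.
move=> sg q0 gq.
rewrite (@eq_I _ _ _ mu D _ (fun x => \sum_(i <- s) \sum_(j <- s) g i x * g j x)); last first.
  by move=> x _; rewrite expr2 mulr_suml; apply: eq_bigr => i _; rewrite mulr_sumr.
have ig i j := sqint_mul mD (sg i) (sg j).
rewrite (I_sum mD muD); last by move=> i; exact: (igb_sum mD muD).
rewrite expr2 mulr_suml; apply: ler_sum => i _.
rewrite (I_sum mD muD)// mulr_sumr; apply: ler_sum => j _.
apply: le_trans (ler_norm _) _.
rewrite -(@ler_pXn2r _ 2) ?nnegrE ?mulr_ge0// real_normK ?num_real//.
apply: le_trans (I_cauchy mD (sg i) (sg j)) _; rewrite exprMn.
by apply: ler_pM => //; apply: I_ge0 => x _; exact: sqr_ge0.
Qed.
End Minkowski.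

Section CurveIntegral.
Variable R : realType.
Implicit Types (a b : R) (f g w : R -> R) (gam : R -> R * R).
Local Notation mu := (@lebesgue_measure R).
Local Notation J a b f := (\int[@lebesgue_measure R]_(t in `[a, b]) f t).
Local Notation cts a b f := (forall t : R, a <= t <= b -> {for t, continuous f}).

Lemma itv_measurable a b : measurable (`[a, b] : set (measurableTypeR R)).
Proof. exact: measurable_itv. Qed.

Lemma eq_J a b f g : (forall t, a <= t <= b -> f t = g t) -> J a b f = J a b g.
Proof. by move=> fg; apply: eq_I => t /=; rewrite in_itv/=; exact: fg. Qed.

Lemma itv_fin a b : (@lebesgue_measure R (`[a, b] : set (measurableTypeR R)) < +oo)%E.
Proof.
suff : (lebesgue_measure (`[a, b] : set R) < +oo)%E by [].
by rewrite lebesgue_measure_itv/=; case: ifP => _; rewrite -?EFinD ltry.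
Qed.

Lemma cts_within a b f : cts a b f -> {within `[a, b], continuous f}.
Proof. by move=> cf; apply: continuous_in_subspaceT => x /[!inE]/=; rewrite in_itv/=; exact: cf. Qed.

Lemma cts_bounded a b f : cts a b f -> exists M, forall t, a <= t <= b -> `|f t| <= M.
Proof.
move=> cf; have /compact_bounded [M [_ MP]] : compact (f @` `[a, b]).
  by apply: continuous_compact; [exact: cts_within|exact: segment_compact].
exists (M + 1) => t tab; apply: (MP (M + 1)); first by rewrite ltrDl.
by exists t => //=; rewrite in_itv.
Qed.

Lemma cts_measurable a b f : cts a b f -> measurable_fun (`[a, b] : set (measurableTypeR R)) f.
Proof.
move=> cf; apply: subspace_continuous_measurable_fun; first exact: measurable_itv.
exact: cts_within.
Qed.

Lemma cts_sqint a b f : cts a b f -> @sqint _ (measurableTypeR R) R mu `[a, b] f.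
Proof.
move=> cf; have [M fM] := cts_bounded cf.
apply: (sqint_bounded (itv_measurable a b) (itv_fin a b) (M := M)); first exact: cts_measurable.
by move=> t /=; rewrite in_itv/=; exact: fM.
Qed.

Lemma cts_igb a b f : cts a b f -> mu.-integrable `[a, b] (EFin \o f).
Proof. by move=> /cts_sqint; exact: (sqint_igb (itv_measurable a b) (itv_fin a b)). Qed.

Definition gam_cts gam a b := cts a b (fst \o gam) /\ cts a b (snd \o gam).

Lemma dotp_gam_cts gam a b (k : int * int) : gam_cts gam a b -> cts a b (fun t => dotp k (gam t)).
Proof.
move=> [c1 c2] t tab; apply: cvgD; apply: cvgM; try exact: cvg_cst.
  exact: c1.
exact: c2.
Qed.

Lemma cos_gam_cts gam a b (k : int * int) : gam_cts gam a b -> cts a b (fun t => cos (dotp k (gam t))).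
Proof.
move=> cg t tab; apply: (@continuous_comp R R R (fun t => dotp k (gam t)) (@cos R)).

  exact: (dotp_gam_cts cg tab).
exact: continuous_cos.
Qed.

Lemma sin_gam_cts gam a b (k : int * int) : gam_cts gam a b -> cts a b (fun t => sin (dotp k (gam t))).
Proof.
move=> cg t tab; apply: (@continuous_comp R R R (fun t => dotp k (gam t)) (@sin R)).

  exact: (dotp_gam_cts cg tab).
exact: continuous_sin.
Qed.

Lemma trigp_gam_cts gam a b s (c c' : int * int -> R) : gam_cts gam a b ->
  cts a b (fun t => trigp s c c' (gam t)).
Proof.
move=> cg t tab; elim: s => [|n s IH].
  rewrite (_ : (fun t => _) = cst 0); first exact: cvg_cst.
  by apply/funext => y; rewrite /trigp big_nil.
rewrite (_ : (fun t => _) = (fun t => c n * cos (dotp n (gam t)) + c' n * sin (dotp n (gam t))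
    + trigp s c c' (gam t))); last first.
  by apply/funext => y; rewrite /trigp big_cons.
apply: cvgD; last exact: IH.
apply: cvgD; apply: cvgM; try exact: cvg_cst.
  exact: (cos_gam_cts cg tab).
exact: (sin_gam_cts cg tab).
Qed.

(* Schur test for the Gram matrix of the exponentials n . gam on [a, b]. *)
Lemma gram_bound gam a b w s (ka : int * int -> R) (S : R) (c c' : int * int -> R) :
  gam_cts gam a b -> cts a b w -> (forall t, a <= t <= b -> 0 <= w t) ->
  (forall k, 0 <= ka k) ->
  (forall k, `|J a b (fun t => w t * cos (dotp k (gam t)))| <= ka k) ->
  (forall k, `|J a b (fun t => w t * sin (dotp k (gam t)))| <= ka k) ->
  (forall n, n \in s -> \sum_(m <- s) ka (n - m) <= S) ->
  (forall n, n \in s -> \sum_(m <- s) ka (m - n) <= S) ->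
  J a b (fun t => w t * trigp s c c' (gam t) ^+ 2) <= 2 * S * energy s c c'.
Proof.
move=> cg cw w0 ka0 kc ks S1 S2.
have mD := itv_measurable a b; have muD := itv_fin a b.
pose P := [seq (n, m) | n <- s, m <- s].
pose al (q : (int * int) * (int * int)) := c q.1 * c q.2 + c' q.1 * c' q.2.
pose be (q : (int * int) * (int * int)) := c' q.1 * c q.2 - c q.1 * c' q.2.
pose E n := c n ^+ 2 + c' n ^+ 2.
have cM (f g : R -> R) : cts a b f -> cts a b g -> cts a b (fun t => f t * g t).
  by move=> cf cg' t tab; apply: cvgM; [exact: cf|exact: cg'].
have icos k : mu.-integrable `[a, b] (EFin \o (fun t => w t * cos (dotp k (gam t)))).
  by apply: cts_igb; apply: cM => // t tab; exact: (cos_gam_cts cg tab).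
have isin k : mu.-integrable `[a, b] (EFin \o (fun t => w t * sin (dotp k (gam t)))).
  by apply: cts_igb; apply: cM => // t tab; exact: (sin_gam_cts cg tab).
pose G t := \sum_(q <- P) (al q * (w t * cos (dotp (q.1 - q.2) (gam t))) +
  be q * (w t * sin (dotp (q.1 - q.2) (gam t)))).
have GE t : G t = w t * (trigp s c c' (gam t) ^+ 2 + trigp s (fun n => - c' n) c (gam t) ^+ 2).
  by rewrite trigp_sqr_add mulr_sumr; apply: eq_bigr => q _; rewrite /al /be; ring.
have iterm (q : (int * int) * (int * int)) : mu.-integrable `[a, b] (EFin \o (fun t =>
    al q * (w t * cos (dotp (q.1 - q.2) (gam t))) + be q * (w t * sin (dotp (q.1 - q.2) (gam t))))).
  by apply: (igbD mD); exact: (igbZ mD).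
(* As w >= 0, the square of the conjugate polynomial may be added; only differences of frequencies
   then occur. *)
apply: (@le_trans _ _ (J a b G)).
  apply: (I_le mD).
  - have cT : cts a b (fun t => trigp s c c' (gam t)).
      by move=> t tab; exact: (trigp_gam_cts cg tab).
    by apply: cts_igb; exact: (cM _ _ cw (cM _ _ cT cT)).
  - exact: (igb_sum mD muD).
  move=> t /=; rewrite in_itv/= => tab; rewrite GE ler_wpM2l ?w0//.
  by rewrite lerDl sqr_ge0.
rewrite /G (I_sum mD muD)//.
have half (x y x' y' : R) : `|x * x' + y * y'| <= ((x ^+ 2 + y ^+ 2) + (x' ^+ 2 + y' ^+ 2)) / 2.
  have := sqr_ge0 (x - x'); have := sqr_ge0 (y - y'); have := sqr_ge0 (x + x'); have := sqr_ge0 (y + y').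
  by rewrite ler_norml; nra.
apply: (@le_trans _ _ (\sum_(q <- P) (E q.1 + E q.2) * ka (q.1 - q.2))).
  apply: ler_sum => q _.
  rewrite (I_D mD (igbZ mD _ (icos _)) (igbZ mD _ (isin _))) (I_Z mD _ (icos _)) (I_Z mD _ (isin _)).
  apply: le_trans (ler_norm _) _; apply: le_trans (ler_normD _ _) _; rewrite !normrM.
  have h1 : `|al q| <= (E q.1 + E q.2) / 2 by exact: half.
  have h2 : `|be q| <= (E q.1 + E q.2) / 2.
    have := half (c' q.1) (- c q.1) (c q.2) (c' q.2); rewrite mulNr sqrrN.
    by rewrite [c' q.1 ^+ 2 + _]addrC.
  have -> : (E q.1 + E q.2) * ka (q.1 - q.2) =
    (E q.1 + E q.2) / 2 * ka (q.1 - q.2) + (E q.1 + E q.2) / 2 * ka (q.1 - q.2) by field.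
  by apply: lerD; apply: ler_pM.
have E0 n : 0 <= E n by rewrite addr_ge0 ?sqr_ge0.
under eq_bigr do rewrite mulrDl.
rewrite big_split /= mulrDl mulrDl ![1 * _]mul1r.
have SE : S * energy s c c' = \sum_(n <- s) E n * S by rewrite mulrC mulr_suml.
apply: lerD; rewrite SE.
  rewrite big_allpairs_dep /= big_seq [leRHS]big_seq; apply: ler_sum => n ns.
  by rewrite -mulr_sumr ler_wpM2l// S1.
rewrite big_allpairs_dep exchange_big /= big_seq [leRHS]big_seq; apply: ler_sum => n ns.
by rewrite -mulr_sumr ler_wpM2l// S2.
Qed.

(** The triangle inequality in L^2 of the curve over the circles, then a uniform limit. The factor 2
    is that of x^2 <= 2 y^2 + 2 (x - y)^2. *)
Lemma curve_limit gam a b (u : R * R -> R) (c c' : int * int -> R) (B : nat -> R) (C : R) :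
  a <= b -> gam_cts gam a b -> cts a b (u \o gam) -> (forall N, 0 <= B N) ->
  (forall N, J a b (fun t => trigp (circle N) c c' (gam t) ^+ 2) <= B N ^+ 2 * energy (circle N) c c') ->
  (forall M, \sum_(N < M) B N * cnorm c c' N <= C) ->
  (forall eps, 0 < eps -> exists M, forall x, `|u x - trigp (disc M) c c' x| <= eps) ->
  J a b (fun t => u (gam t) ^+ 2) <= 2 * C ^+ 2.
Proof.
move=> ab cg cu B0 BJ BC ap.
have mD := itv_measurable a b; have muD := itv_fin a b.
have C0 : 0 <= C by have := BC 0%N; rewrite big_ord0.
have sq (f : R -> R) : cts a b f -> mu.-integrable `[a, b] (EFin \o (fun t => f t ^+ 2)).
  by move=> /cts_sqint[].
have len : fine (mu (`[a, b] : set R)) = b - a.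
  rewrite lebesgue_measure_itv/= lte_fin; case: ltP => //= ba.
  by apply/esym/eqP; rewrite subr_eq0 eq_le ba ab.
apply/ler_addgt0Pr => eps eps0.
pose l := b - a + 1; have l0 : 0 < l by rewrite ltr_wpDl// subr_ge0.
pose e := Num.min 1 (eps / (2 * l)).
have e0 : 0 < e by rewrite lt_min ltr01 divr_gt0// mulr_gt0.
have e1 : e <= 1 by rewrite /e ge_min lexx.
have [M uM] := ap e e0.
pose S t := trigp (disc M) c c' (gam t).
have cS : cts a b S by move=> t tab; exact: (trigp_gam_cts cg tab).
apply: (@le_trans _ _ (J a b (fun t => 2 * S t ^+ 2 + 2 * e ^+ 2))).
  apply: (I_le mD); first exact: sq.
    by apply: (igbD mD); [exact: (igbZ mD 2 (sq _ cS))|exact: (igb_cst mD muD)].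
  move=> t _; have := uM (gam t); rewrite -/(S t) ler_norml.
  move: (u (gam t)) (S t) => x y /andP[h1 h2]; clear -h1 h2 e0.
  have h3 : (x - y) ^+ 2 <= e ^+ 2 by nra.
  have := sqr_ge0 (2 * y - x); nra.
rewrite (I_D mD (igbZ mD 2 (sq _ cS)) (igb_cst mD muD (2 * e ^+ 2))) (I_Z mD 2 (sq _ cS)).
rewrite Rintegral_cst ?len; last exact: measurable_itv.
apply: lerD.
  rewrite ler_wpM2l//; apply: (@le_trans _ _ ((\sum_(N < M) B N * cnorm c c' N) ^+ 2)); last first.
    by rewrite lerXn2r ?nnegrE ?BC// sumr_ge0// => N _; rewrite mulr_ge0 ?cnorm_ge0.
  rewrite (@eq_I _ _ _ mu `[a, b] _ (fun t => (\sum_(N < M) trigp (circle N) c c' (gam t)) ^+ 2)); last first.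
    by move=> t _; rewrite /S trigp_disc.
  apply: (@I_sum_sqr _ _ R mu _ mD muD 'I_M _ (fun N t => trigp (circle N) c c' (gam t))
    (fun N => B N * cnorm c c' N)) => [N|N|N].
  - by apply: cts_sqint => t tab; exact: (trigp_gam_cts cg tab).
  - by rewrite mulr_ge0 ?cnorm_ge0.
  - by rewrite exprMn cnorm_sqr; exact: BJ.
apply: (@le_trans _ _ (2 * e * l)).
  have e2 : e ^+ 2 <= e by rewrite expr2 ler_piMr// ltW.
  have bl : b - a <= l by rewrite /l lerDl.
  by apply: ler_pM; [rewrite mulr_ge0 ?sqr_ge0|rewrite subr_ge0|rewrite ler_wpM2l|].
have : e <= eps / (2 * l) by rewrite /e ge_min lexx orbT.
by rewrite ler_pdivlMr ?mulr_gt0// mulrA [e * 2]mulrC.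
Qed.
End CurveIntegral.

(** * Oscillatory integrals on curved segments *)

Section VanDerCorput.
Variable R : realType.
Local Notation J a b f := (\int[@lebesgue_measure R]_(t in `[a, b]) f t).
Local Notation cts a b f := (forall t : R, a <= t <= b -> {for t, continuous f}).

Lemma is_derive_continuous (f : R -> R) (t df : R) : is_derive t 1 f df -> {for t, continuous f}.
Proof.
by move=> h; apply: differentiable_continuous; apply/derivable1_diffP; exact: ex_derive.
Qed.

(* The derivative of r * atan (p / sg) contains sg * r ^ 2 / (p ^ 2 + L), and
   r ^ 2 >= c * L ^ 2 - p ^ 2. *)
Lemma sublevel_integral (p r s : R -> R) (a b M c L sg : R) : a < b ->
  (forall t, a <= t <= b -> is_derive t 1 p (r t)) ->
  (forall t, a <= t <= b -> is_derive t 1 r (s t)) -> cts a b s ->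
  1 <= sg -> sg ^+ 2 = L -> 0 < c ->
  (forall t, a <= t <= b -> `|r t| <= M * L /\ `|s t| <= M * L) ->
  (forall t, a <= t <= b -> c * L ^+ 2 <= p t ^+ 2 + r t ^+ 2) ->
  J a b (fun t => (p t ^+ 2 + L)^-1) <= (b - a + M * (4 + 2 * (b - a))) / c * sg / L ^+ 2.
Proof.
move=> ab dp dr cs sg1 sgL c0 rsM low.
have sg0 : 0 < sg by exact: lt_le_trans ltr01 sg1.
have L0 : 0 < L by rewrite -sgL exprn_gt0.
have D0 t : 0 < p t ^+ 2 + L by rewrite ltr_wpDl// sqr_ge0.
(* The arctangent is bounded, so the primitive is O(M L) however often p vanishes, and the factor r
   spares a division by r at its zeros. *)
have dF t : a <= t <= b -> is_derive t 1 (fun t => r t * atan (p t / sg))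
   (s t * atan (p t / sg) + r t ^+ 2 * sg / (p t ^+ 2 + L)).
  move=> tab; have h1 := dp t tab; have h2 := dr t tab.
  apply: is_derive_eq; rewrite /GRing.scale /= -sgL.
  have d1 : sg != 0 by rewrite gt_eqF.
  have d2 : p t ^+ 2 + sg ^+ 2 != 0 by rewrite sgL gt_eqF.
  by field; rewrite d1 d2.
have cp := fun t tab => is_derive_continuous (dp t tab).
have cr := fun t tab => is_derive_continuous (dr t tab).
have cat : cts a b (fun t => atan (p t / sg)).
  move=> t tab; apply: (@continuous_comp R R R (fun t => p t / sg) (@atan R)); last exact: continuous_atan.
  by apply: cvgM; [exact: cp|exact: cvg_cst].
have cDV : cts a b (fun t => (p t ^+ 2 + L)^-1).
  move=> t tab; apply: cvgV; first by rewrite gt_eqF.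
  by apply: cvgD; [apply: cvgM; exact: cp|exact: cvg_cst].
have cr2D : cts a b (fun t => r t ^+ 2 * sg / (p t ^+ 2 + L)).
  move=> t tab; apply: cvgM; last exact: cDV.
  by apply: cvgM; [apply: cvgM; exact: cr|exact: cvg_cst].
have csat : cts a b (fun t => s t * atan (p t / sg)).
  by move=> t tab; apply: cvgM; [exact: cs|exact: cat].
have cF : cts a b (fun t => s t * atan (p t / sg) + r t ^+ 2 * sg / (p t ^+ 2 + L)).
  by move=> t tab; apply: cvgD; [exact: csat|exact: cr2D].
have := Rintegral_FTC ab dF cF.
have mD := itv_measurable a b; have muD := itv_fin a b.
rewrite (I_D mD (cts_igb csat) (cts_igb cr2D)).
have len : fine (lebesgue_measure (`[a, b] : set R)) = b - a.
  by rewrite lebesgue_measure_itv/= lte_fin ab.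
have at2 x : `|atan x| <= 2 :> R.
  have := atan_gtNpi2 x; have := atan_ltpi2 x; have := @pihalf_02_cos_pihalf R => -[/andP[_ h] _].
  by rewrite ler_norml; lra.
have ML0 : 0 <= M * L.
  have aab : a <= a <= b by rewrite lexx ltW.
  by have [h _] := rsM a aab; exact: le_trans (normr_ge0 _) h.
have bs : `|J a b (fun t => s t * atan (p t / sg))| <= 2 * (M * L) * (b - a).
  apply: le_trans (le_normr_Rintegral mD (cts_igb csat)) _.
  rewrite -len -(Rintegral_cst _ mD).
  apply: (I_le mD).
  - by apply: cts_igb => t tab; apply: cvg_norm; exact: csat.
  - exact: (igb_cst mD muD).
  move=> t /=; rewrite in_itv/= => tab; rewrite normrM mulrC.
  by apply: ler_pM => //; have [] := rsM t tab.
have bF t : a <= t <= b -> `|r t * atan (p t / sg)| <= 2 * (M * L).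
  by move=> tab; rewrite normrM mulrC; apply: ler_pM => //; have [] := rsM t tab.
have Fb : `|r b * atan (p b / sg)| <= 2 * (M * L) by apply: bF; rewrite lexx ltW.
have Fa : `|r a * atan (p a / sg)| <= 2 * (M * L) by apply: bF; rewrite lexx ltW.
move=> FTC.
have r2 : J a b (fun t => r t ^+ 2 * sg / (p t ^+ 2 + L)) <= M * L * (4 + 2 * (b - a)).
  move: FTC bs Fb Fa; rewrite !ler_norml; clear; lra.
have cp2D : cts a b (fun t => p t ^+ 2 * (p t ^+ 2 + L)^-1).
  by move=> t tab; apply: cvgM; [apply: cvgM; exact: cp|exact: cDV].
have p2 : J a b (fun t => p t ^+ 2 * (p t ^+ 2 + L)^-1) <= b - a.
  rewrite -len -[X in _ <= X]mul1r -(Rintegral_cst _ mD).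
  apply: (I_le mD); [exact: cts_igb|exact: (igb_cst mD muD)|].
  by move=> t _; rewrite ler_pdivrMr// mul1r lerDl ltW.
(* Integrate c L^2 <= p^2 + r^2 against sg / (p^2 + L): the part of p^2 is at most sg (b - a), that
   of r^2 is bounded by the primitive. *)
have : sg * (c * L ^+ 2) * J a b (fun t => (p t ^+ 2 + L)^-1) <=
    sg * J a b (fun t => p t ^+ 2 * (p t ^+ 2 + L)^-1) + J a b (fun t => r t ^+ 2 * sg / (p t ^+ 2 + L)).
  rewrite -(I_Z mD _ (cts_igb cDV)) -(I_Z mD sg (cts_igb cp2D)).
  rewrite -(I_D mD (igbZ mD sg (cts_igb cp2D)) (cts_igb cr2D)).
  apply: (I_le mD (igbZ mD _ (cts_igb cDV)) (igbD mD (igbZ mD sg (cts_igb cp2D)) (cts_igb cr2D))).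
  move=> t /=; rewrite in_itv/= => tab; rewrite [sg * (p t ^+ 2 * _)]mulrA -mulrDl ler_pM2r ?invr_gt0//.
  by rewrite [r t ^+ 2 * sg]mulrC -mulrDr ler_pM2l// low.
move=> h; rewrite ler_pdivlMr ?exprn_gt0// [leRHS]mulrAC ler_pdivlMr//.
rewrite -(ler_pM2l sg0).
move: h p2 r2; set Z := J a b (fun t => (p t ^+ 2 + L)^-1).
set X := J a b (fun t => p t ^+ 2 * (p t ^+ 2 + L)^-1).
set Y := J a b (fun t => r t ^+ 2 * sg / (p t ^+ 2 + L)) => h p2 r2.
have h1 : sg * X <= sg * (b - a) by rewrite ler_pM2l.
apply: (@le_trans _ _ (sg * (b - a) + M * L * (4 + 2 * (b - a)))).
  rewrite [leLHS](_ : _ = sg * (c * L ^+ 2) * Z); last by ring.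
  by apply: le_trans h _; exact: lerD.
rewrite -{1}sgL; have ba : 0 <= b - a by rewrite subr_ge0 ltW.
have : sg * (b - a) <= sg * (b - a) * sg by rewrite ler_peMr// mulr_ge0// ltW.
move: (b - a) => l; clear; lra.
Qed.

(* The derivative of p / (p ^ 2 + L) * sin ph is cos ph up to a multiple of
   1 / (p ^ 2 + L), so that the stationary points need no separate treatment. *)
Lemma van_der_corput (ph p r s : R -> R) (a b M c L sg : R) : a < b ->
  (forall t, a <= t <= b -> is_derive t 1 ph (p t)) ->
  (forall t, a <= t <= b -> is_derive t 1 p (r t)) ->
  (forall t, a <= t <= b -> is_derive t 1 r (s t)) -> cts a b s ->
  1 <= sg -> sg ^+ 2 = L -> 0 < c ->
  (forall t, a <= t <= b -> `|r t| <= M * L /\ `|s t| <= M * L) ->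
  (forall t, a <= t <= b -> c * L ^+ 2 <= p t ^+ 2 + r t ^+ 2) ->
  `|J a b (fun t => cos (ph t))| <= (2 + (M + 1) * ((b - a + M * (4 + 2 * (b - a))) / c)) / sg.
Proof.
move=> ab dph dp dr cs sg1 sgL c0 rsM low.
have JD := sublevel_integral ab dp dr cs sg1 sgL c0 rsM low.
set C1 := (b - a + _) / c in JD *.
have sg0 : 0 < sg by exact: lt_le_trans ltr01 sg1.
have L0 : 0 < L by rewrite -sgL exprn_gt0.
have D0 t : 0 < p t ^+ 2 + L by rewrite ltr_wpDl// sqr_ge0.
have cph := fun t tab => is_derive_continuous (dph t tab).
have cp := fun t tab => is_derive_continuous (dp t tab).
have cr := fun t tab => is_derive_continuous (dr t tab).
pose H t := - (r t * (L - p t ^+ 2) / (p t ^+ 2 + L) ^+ 2 * sin (ph t)) + L / (p t ^+ 2 + L) * cos (ph t).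
have dG t : a <= t <= b -> is_derive t 1 (fun t => p t / (p t ^+ 2 + L) * sin (ph t)) (cos (ph t) - H t).
  move=> tab; have h0 := dph t tab; have h1 := dp t tab; have h2 := dr t tab.
  have nz : p t ^+ 2 + L != 0 by rewrite gt_eqF.
  have dV : is_derive t 1 (fun t => (p t ^+ 2 + L)^-1) (- (2 * p t * r t) / (p t ^+ 2 + L) ^+ 2).
    have h3 : is_derive t 1 (fun t => p t ^+ 2 + L) (2 * p t * r t).
      by apply: is_derive_eq; rewrite /GRing.scale /=; ring.
    have h4 := @is_deriveV _ (fun t => p t ^+ 2 + L) t _ 1 nz h3.
    apply: is_derive_eq.
    by rewrite /GRing.scale /=; field.
  apply: is_derive_eq; rewrite /GRing.scale /= /H.
  by field.
have cDV : cts a b (fun t => (p t ^+ 2 + L)^-1).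
  move=> t tab; apply: cvgV; first by rewrite gt_eqF.
  by apply: cvgD; [apply: cvgM; exact: cp|exact: cvg_cst].
have ccos : cts a b (fun t => cos (ph t)).
  move=> t tab; apply: (@continuous_comp R R R ph (@cos R)); first exact: cph.
  exact: continuous_cos.
have csin : cts a b (fun t => sin (ph t)).
  move=> t tab; apply: (@continuous_comp R R R ph (@sin R)); first exact: cph.
  exact: continuous_sin.
have cH : cts a b H.
  move=> t tab; apply: cvgD; last first.
    by apply: cvgM; [apply: cvgM; [exact: cvg_cst|exact: cDV]|exact: ccos].
  apply: cvgN; apply: cvgM; last exact: csin.
  apply: cvgM.
    apply: cvgM; first exact: cr.
    by apply: cvgB; [exact: cvg_cst|apply: cvgM; exact: cp].
  apply: cvgV; first by rewrite expf_neq0// gt_eqF.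
  by apply: cvgM; (apply: cvgD; [apply: cvgM; exact: cp|exact: cvg_cst]).
have cf : cts a b (fun t => cos (ph t) - H t).
  by move=> t tab; apply: cvgB; [exact: ccos|exact: cH].
have := Rintegral_FTC ab dG cf.
have mD := itv_measurable a b; have muD := itv_fin a b.
rewrite (I_B mD (cts_igb ccos) (cts_igb cH)) => FTC.
have ML0 : 0 <= M * L.
  have aab : a <= a <= b by rewrite lexx ltW.
  by have [h _] := rsM a aab; exact: le_trans (normr_ge0 _) h.
have M0 : 0 <= M by rewrite -(pmulr_lge0 _ L0).
(* Pointwise |H| <= (M + 1) L / (p^2 + L), because |L - p^2| <= L + p^2; [sublevel_integral] does
   the rest. *)
have bH : `|J a b H| <= (M + 1) * L * (C1 * sg / L ^+ 2).
  apply: (@le_trans _ _ (J a b (fun t => (M + 1) * L * (p t ^+ 2 + L)^-1))); last first.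
    rewrite (I_Z mD _ (cts_igb cDV)); apply: ler_wpM2l => //.
    by apply: mulr_ge0; [exact: addr_ge0|exact: ltW].
  apply: le_trans (le_normr_Rintegral mD (cts_igb cH)) _.
  apply: (I_le mD).
  - by apply: cts_igb => t tab; apply: cvg_norm; exact: cH.
  - exact: (igbZ mD _ (cts_igb cDV)).
  move=> t /=; rewrite in_itv/= => tab; rewrite /H.
  apply: le_trans (ler_normD _ _) _; rewrite normrN.
  have -> : (M + 1) * L * (p t ^+ 2 + L)^-1 = M * L / (p t ^+ 2 + L) + L / (p t ^+ 2 + L) by ring.
  have n1 x : `|sin x| <= 1 :> R by rewrite ler_norml sin_geN1 sin_le1.
  have n2 x : `|cos x| <= 1 :> R by rewrite ler_norml cos_geN1 cos_le1.
  have LD : 0 <= L / (p t ^+ 2 + L) by rewrite divr_ge0// ltW.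
  apply: lerD; last by rewrite normrM (ger0_norm LD) ler_piMr.
  have q1 : `|(L - p t ^+ 2) / (p t ^+ 2 + L)| <= 1.
    rewrite ler_norml ler_pdivrMr// ler_pdivlMr//.
    by have := sqr_ge0 (p t); clear -L0; lra.
  rewrite normrM -[leRHS]mulr1; apply: ler_pM => //.
  rewrite (_ : _ / _ ^+ 2 = r t * ((L - p t ^+ 2) / (p t ^+ 2 + L)) / (p t ^+ 2 + L)); last first.
    by field; rewrite gt_eqF.
  rewrite normrM [X in _ * X]ger0_norm ?invr_ge0 ?(ltW (D0 t))//.
  rewrite ler_pM2r ?invr_gt0// normrM -[leRHS]mulr1; apply: ler_pM => //.
  by have [] := rsM t tab.
have bG t : `|p t / (p t ^+ 2 + L) * sin (ph t)| <= sg^-1.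
  rewrite normrM -[leRHS]mulr1; apply: ler_pM => //; last by rewrite ler_norml sin_geN1 sin_le1.
  rewrite normrM [X in _ * X]gtr0_norm ?invr_gt0//.
  rewrite ler_pdivrMr// -(ler_pM2l sg0) mulrA divff ?gt_eqF// mul1r.
  rewrite -(real_normK (num_real (p t))) -sgL; move: `|p t| => x; have := sqr_ge0 (x - sg).
  have := sqr_ge0 x; have := sqr_ge0 sg; clear; nra.
have -> : (2 + (M + 1) * C1) / sg = sg^-1 + sg^-1 + (M + 1) * L * (C1 * sg / L ^+ 2).
  by rewrite -sgL; field; rewrite gt_eqF.
move: FTC bH (bG a) (bG b); rewrite !ler_norml.
move: (sg^-1) ((M + 1) * L * (C1 * sg / L ^+ 2)); clear => e1 e2; lra.
Qed.
End VanDerCorput.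

Section CurvedSegment.
Variable R : realType.
Local Notation J a b f := (\int[@lebesgue_measure R]_(t in `[a, b]) f t).
Local Notation cts a b f := (forall t : R, a <= t <= b -> {for t, continuous f}).

Lemma smooth_near_is_derive (a b : R) (f : R -> R) : smooth_near a b f ->
  forall n t, a <= t <= b -> is_derive t 1 (derive1n n f) (derive1n n.+1 f t).
Proof.
move=> [c [d [ca bd h]]] n t /andP[at_ tb].
have dt : derivable (derive1n n f) t 1.
  by apply: h; rewrite (lt_le_trans ca at_) (le_lt_trans tb bd).
by apply: DeriveDef; [exact: dt|rewrite derive1nS derive1E].
Qed.

Lemma cts_pos_lower (a b : R) (f : R -> R) : a <= b -> cts a b f ->
  (forall t, a <= t <= b -> 0 < f t) -> exists2 c, 0 < c & forall t, a <= t <= b -> c <= f t.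
Proof.
move=> ab cf f0; have [t tab tmin] := EVT_min ab (cts_within cf).
have tab' : a <= t <= b by move: tab; rewrite in_itv.
by exists (f t) => [|u uab]; [exact: f0|apply: tmin; rewrite in_itv].
Qed.

(** Nonzero curvature means that gam' and gam'' are independent, so on a compact interval (k.gam')^2
    + (k.gam'')^2 >= c |k|^2: the phase k.gam is never stationary to second order. This is the lower
    bound required by [van_der_corput]. *)
Lemma curved_kernel (gam : R -> R * R) (a b : R) : curved_segment gam a b ->
  exists2 C, 0 <= C & forall k : int * int, k != 0 ->
    `|J a b (fun t => cos (dotp k (gam t)))| <= C / root4 R k /\
    `|J a b (fun t => sin (dotp k (gam t)))| <= C / root4 R k.
Proof.
move=> [[ab sx sy sp] cu].
set x := fst \o gam in sx *; set y := snd \o gam in sy *.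
have dx := smooth_near_is_derive sx; have dy := smooth_near_is_derive sy.
have cx n : cts a b (derive1n n x) by move=> t tab; exact: is_derive_continuous (dx n t tab).
have cy n : cts a b (derive1n n y) by move=> t tab; exact: is_derive_continuous (dy n t tab).
have cN (f : R -> R) : cts a b f -> cts a b (fun t => `|f t|).
  by move=> cf t tab; apply: cvg_norm; exact: cf.
have cD (f g : R -> R) : cts a b f -> cts a b g -> cts a b (fun t => f t + g t).
  by move=> cf cg t tab; apply: cvgD; [exact: cf|exact: cg].
have cB (f g : R -> R) : cts a b f -> cts a b g -> cts a b (fun t => f t - g t).
  by move=> cf cg t tab; apply: cvgB; [exact: cf|exact: cg].
have cM (f g : R -> R) : cts a b f -> cts a b g -> cts a b (fun t => f t * g t).
  by move=> cf cg t tab; apply: cvgM; [exact: cf|exact: cg].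
pose F t := (`|derive1n 2 x t| + `|derive1n 2 y t|) + (`|derive1n 3 x t| + `|derive1n 3 y t|).
have [M MP] := cts_bounded (cD _ _ (cD _ _ (cN _ (cx 2)) (cN _ (cy 2))) (cD _ _ (cN _ (cx 3)) (cN _ (cy 3)))).
have FM t : a <= t <= b -> F t <= M by move=> tab; exact: le_trans (ler_norm _) (MP t tab).
have F0 t : 0 <= F t by rewrite !addr_ge0.
have aab : a <= a <= b by rewrite lexx ltW.
have M0 : 0 <= M by exact: le_trans (F0 a) (FM a aab).
pose Q t := (derive1n 1 x t * derive1n 1 x t + derive1n 1 y t * derive1n 1 y t) +
  (derive1n 2 x t * derive1n 2 x t + derive1n 2 y t * derive1n 2 y t).
have [Q1 Q1P] := cts_bounded (cD _ _ (cD _ _ (cM _ _ (cx 1) (cx 1)) (cM _ _ (cy 1) (cy 1)))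
  (cD _ _ (cM _ _ (cx 2) (cx 2)) (cM _ _ (cy 2) (cy 2)))).
pose Q0 := `|Q1| + 1; have Q00 : 0 < Q0 by rewrite ltr_wpDl.
have QQ0 t : a <= t <= b -> Q t <= Q0.
  move=> tab; apply: le_trans (ler_norm _) _; apply: le_trans (Q1P t tab) _.
  by apply: le_trans (ler_norm _) _; rewrite lerDl.
pose De t := derive1n 1 x t * derive1n 2 y t - derive1n 1 y t * derive1n 2 x t.
have De0 t : a <= t <= b -> 0 < De t * De t.
  move=> tab; have : De t != 0.
    by apply: contra_neq (cu t tab); rewrite /De /curvature => ->; rewrite mul0r.
  by move=> h; rewrite -expr2 lt_def sqr_ge0 andbT sqrf_eq0.
have cDe : cts a b De := cB _ _ (cM _ _ (cx 1) (cy 2)) (cM _ _ (cy 1) (cx 2)).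
have [de de0 deP] := cts_pos_lower (ltW ab) (cM _ _ cDe cDe) De0.
pose c := de / Q0; have c0 : 0 < c by rewrite divr_gt0.
pose M' := 2 * M.
pose C := 2 + (M' + 1) * ((b - a + M' * (4 + 2 * (b - a))) / c).
have ba0 : 0 <= b - a by rewrite subr_ge0 ltW.
have M'0 : 0 <= M' by rewrite mulr_ge0.
exists C.
  apply: addr_ge0 => //; apply: mulr_ge0; first exact: addr_ge0.
  by apply: divr_ge0; [rewrite addr_ge0// mulr_ge0// addr_ge0// mulr_ge0|exact: ltW].
move=> k k0; pose k1 : R := k.1%:~R; pose k2 : R := k.2%:~R.
pose L : R := Num.sqrt (nsq k)%:R; pose sg := root4 R k.
have sg1 : 1 <= sg by exact: root4_ge1.
have sgL : sg ^+ 2 = L by rewrite sqr_sqrtr ?sqrtr_ge0.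
have L0 : 0 <= L by exact: sqrtr_ge0.
have L2 : L ^+ 2 = k1 ^+ 2 + k2 ^+ 2.
  by rewrite sqr_sqrtr// -[LHS]/((nsq k)%:Z%:~R) nsqE rmorphD !rmorphXn.
have k1L : `|k1| <= L.
  by rewrite -(@ler_pXn2r _ 2) ?nnegrE// real_normK ?num_real// L2 lerDl sqr_ge0.
have k2L : `|k2| <= L.
  by rewrite -(@ler_pXn2r _ 2) ?nnegrE// real_normK ?num_real// L2 lerDr sqr_ge0.
pose P n t := k1 * derive1n n x t + k2 * derive1n n y t.
have dP n t : a <= t <= b -> is_derive t 1 (P n) (P n.+1 t).
  move=> tab; have h1 := dx n t tab; have h2 := dy n t tab.
  by apply: is_derive_eq; rewrite /GRing.scale /= /P !derive1nS.
have cP3 : cts a b (P 3) by move=> t tab; exact: is_derive_continuous (dP 3 t tab).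
have bP n t : a <= t <= b -> `|derive1n n x t| + `|derive1n n y t| <= M -> `|P n t| <= M' * L.
  move=> tab h; apply: le_trans (ler_normD _ _) _; rewrite !normrM.
  have h1 : `|k1| * `|derive1n n x t| <= L * M.
    by apply: ler_pM => //; apply: le_trans h; rewrite lerDl.
  have h2 : `|k2| * `|derive1n n y t| <= L * M.
    by apply: ler_pM => //; apply: le_trans h; rewrite lerDr.
  by rewrite /M'; move: (lerD h1 h2) => /le_trans; apply; rewrite le_eqVlt; apply/orP; left; apply/eqP; ring.
have bnd t : a <= t <= b -> `|P 2 t| <= M' * L /\ `|P 3 t| <= M' * L.
  move=> tab; have h := FM t tab; split; apply: bP => //; apply: le_trans h; rewrite /F.
    by rewrite lerDl addr_ge0.
  by rewrite lerDr addr_ge0.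
have low t : a <= t <= b -> c * L ^+ 2 <= P 1 t ^+ 2 + P 2 t ^+ 2.
  move=> tab; rewrite /c mulrAC ler_pdivrMr// L2.
  apply: (@le_trans _ _ ((P 1 t ^+ 2 + P 2 t ^+ 2) * Q t)); last first.
    by rewrite ler_wpM2l ?QQ0// addr_ge0 ?sqr_ge0.
  apply: (@le_trans _ _ (De t * De t * (k1 ^+ 2 + k2 ^+ 2))).
    by rewrite ler_wpM2r ?deP// addr_ge0 ?sqr_ge0.
  rewrite /P /Q /De; move: (derive1n 1 x t) (derive1n 1 y t) (derive1n 2 x t) (derive1n 2 y t).
  move=> x1 y1 x2 y2; clear; rewrite -subr_ge0.
  set p := k1 * x1 + k2 * y1; set r := k1 * x2 + k2 * y2.
  (* Cayley-Hamilton for S = M^T M, where M has rows gam' and gam'': |S k|^2 = tr(S) |M k|^2 -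
     det(M)^2 |k|^2, and the left side is the sum of squares displayed. *)
  rewrite [X in 0 <= X](_ : _ = (p * x1 + r * x2) ^+ 2 + (p * y1 + r * y2) ^+ 2 +
     0 * 0).
    by rewrite mul0r addr0 addr_ge0// sqr_ge0.
  rewrite /p /r.
  ring.
have phE t : dotp k (gam t) = P 0 t by [].
split.
  by rewrite -/sg; exact: (van_der_corput ab (dP 0) (dP 1) (dP 2) cP3 sg1 sgL c0 bnd low).
(* The sine is a cosine with the phase shifted by pi / 2, which leaves all derivatives unchanged. *)
have dP' t : a <= t <= b -> is_derive t 1 (fun t => P 0 t - pi / 2) (P 1 t).
  by move=> tab; have h := dP 0 t tab; apply: is_derive_eq; rewrite subr0.
rewrite -/sg (@eq_J R a b _ (fun t => cos (P 0 t - pi / 2))); last first.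
  by move=> t _; rewrite phE cosBpihalf.
exact: (van_der_corput ab dP' (dP 1) (dP 2) cP3 sg1 sgL c0 bnd low).
Qed.

Lemma curved_circle_bound (gam : R -> R * R) (a b : R) : curved_segment gam a b ->
  exists2 B, 0 <= B & forall N c c',
    J a b (fun t => trigp (circle N) c c' (gam t) ^+ 2) <= B * energy (circle N) c c'.
Proof.
move=> hg; have [C C0 CP] := curved_kernel hg; have [C1 [C10 C1P]] := circle_root4_sum R.
have [[ab sx sy _] _] := hg.
have ba0 : 0 <= b - a by rewrite subr_ge0 ltW.
pose S := b - a + C * C1.
have S0 : 0 <= S by rewrite addr_ge0// mulr_ge0.
exists (2 * S) => [|N c c']; first exact: mulr_ge0.
pose ka k := if k == 0 then b - a else C / root4 R k.
have ka0 k : 0 <= ka k by rewrite /ka; case: ifP => // _; rewrite divr_ge0// sqrtr_ge0.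
have kaN k : ka (- k) = ka k by rewrite /ka oppr_eq0 /root4 nsqN.
have len : fine (lebesgue_measure (`[a, b] : set R)) = b - a.
  by rewrite lebesgue_measure_itv/= lte_fin ab.
have cg : gam_cts gam a b.
  split=> t tab; first exact: is_derive_continuous (smooth_near_is_derive sx 0 tab).
  exact: is_derive_continuous (smooth_near_is_derive sy 0 tab).
have mD := itv_measurable a b.
have S1 n : n \in circle N -> \sum_(m <- circle N) ka (n - m) <= S.
  move=> nN; rewrite (bigD1_seq n)//= ?uniq_circle// subrr {1}/ka eqxx lerD2l.
  apply: (@le_trans _ _ (C * \sum_(m <- circle N | m != n) (root4 R (n - m))^-1)).
    rewrite mulr_sumr; apply: ler_sum => m mn.
    by rewrite /ka subr_eq0 eq_sym (negPf mn).
  by rewrite ler_wpM2l// C1P//; move: nN; rewrite mem_circle => /eqP.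
rewrite (@eq_J R a b _ (fun t => cst 1 t * trigp (circle N) c c' (gam t) ^+ 2)); last first.
  by move=> t _; rewrite mul1r.
apply: (gram_bound (ka := ka)) => //.
- by move=> t _; exact: cvg_cst.
- move=> k; rewrite (@eq_J R a b _ (fun t => cos (dotp k (gam t)))); last by move=> t _; rewrite mul1r.
  rewrite /ka; case: eqP => [->|/eqP k0]; last by have [] := CP k k0.
  rewrite (@eq_J R a b _ (fun t => 1)); last by move=> t _; rewrite /dotp /= !mul0r addr0 cos0.
  by rewrite Rintegral_cst// len mul1r ger0_norm.
- move=> k; rewrite (@eq_J R a b _ (fun t => sin (dotp k (gam t)))); last by move=> t _; rewrite mul1r.
  rewrite /ka; case: eqP => [->|/eqP k0]; last by have [] := CP k k0.
  rewrite (@eq_J R a b _ (fun t => 0)); last by move=> t _; rewrite /dotp /= !mul0r addr0 sin0.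
  by rewrite Rintegral_cst// mul0r normr0.
move=> n nN; rewrite (eq_bigr (fun m => ka (n - m))); first exact: S1.
by move=> m _; rewrite -kaN opprB.
Qed.
End CurvedSegment.

(** The case K = 1 of [same_line_close]: two points on the same side coincide. *)
Lemma line_circle_count (k : int * int) (N : nat) (e : int) (s : seq (int * int)) :
  k != 0 -> uniq s -> (forall z, z \in s -> nsq z = N /\ z.1 * k.1 + z.2 * k.2 = e) ->
  (size s <= 2)%N.
Proof.
move=> k0 us sN.
apply: (@size_fibers _ (fun z : int * int => nat_of_bool (0 <= z.1 * k.2 - z.2 * k.1)) 2 1) => [z _|i].
  by case: (0 <= _).
set s' := [seq _ <- _ | _].
case E : s' => [//|z [//|z' s'']].
have sP x : x \in s' -> nat_of_bool (0 <= x.1 * k.2 - x.2 * k.1) = i /\ x \in s.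
  by rewrite mem_filter => /andP[/eqP].
have [zi zs] : nat_of_bool (0 <= z.1 * k.2 - z.2 * k.1) = i /\ z \in s by apply: sP; rewrite E mem_head.
have [zi' zs'] : nat_of_bool (0 <= z'.1 * k.2 - z'.2 * k.1) = i /\ z' \in s.
  by apply: sP; rewrite E !inE eqxx orbT.
have [zN ze] := sN _ zs; have [zN' ze'] := sN _ zs'.
have : (nsq (z - z') < 1)%N.
  apply: (same_line_close k0); first by rewrite ze ze'.
    by move: zi zi'; case: (0 <= _); case: (0 <= _) => // <-.
  by rewrite zN zN' subrr.
rewrite ltnS leqn0 nsq_eq0 subr_eq0 => /eqP zz.
have : uniq s' by rewrite filter_uniq.
by rewrite E /= zz mem_head.
Qed.

(** * Closed geodesics *)

Section ClosedGeodesic.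
Variable R : realType.
Local Notation J a b f := (\int[@lebesgue_measure R]_(t in `[a, b]) f t).
Local Notation cts a b f := (forall t : R, a <= t <= b -> {for t, continuous f}).

Lemma affine_of_derive2_0 (f : R -> R) : (forall t, derivable f t 1) ->
  (forall t, derivable (derive1 f) t 1) -> (forall t, derive1n 2 f t = 0) ->
  forall t, derive1 f t = derive1 f 0 /\ f t = f 0 + t * derive1 f 0.
Proof.
move=> df df1 f2.
have d1 (t : R) : is_derive t 1 (derive1 f) 0.
  by apply: DeriveDef; [exact: df1|rewrite -derive1E; exact: f2].
have c1 (t : R) : derive1 f t = derive1 f 0 by apply: is_derive_0_is_cst.
move=> t; split; first exact: c1.
have dg (x : R) : is_derive x 1 (fun y => f y - y * derive1 f 0) 0.
  have h : is_derive x 1 f (derive1 f 0).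
    by apply: DeriveDef; [exact: df|rewrite -derive1E; exact: c1].
  by apply: is_derive_eq; rewrite /GRing.scale /=; ring.
have := @is_derive_0_is_cst _ (fun y => f y - y * derive1 f 0) t 0 dg.
by rewrite mul0r subr0 => /eqP; rewrite subr_eq => /eqP.
Qed.

Lemma geodesic_affine (gam : R -> R * R) : geodesic gam -> exists p v : R * R,
  [/\ forall t, gam t = (p.1 + t * v.1, p.2 + t * v.2), 0 < v.1 ^+ 2 + v.2 ^+ 2 &
      forall t, speed gam t = Num.sqrt (v.1 ^+ 2 + v.2 ^+ 2)].
Proof.
move=> hg; set x := fst \o gam; set y := snd \o gam.
have fx := @affine_of_derive2_0 x (fun t => let: And4 h _ _ _ := hg t in h.1)
  (fun t => let: And4 _ h _ _ := hg t in h.1) (fun t => let: And4 _ _ h _ := hg t in h.1).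
have fy := @affine_of_derive2_0 y (fun t => let: And4 h _ _ _ := hg t in h.2)
  (fun t => let: And4 _ h _ _ := hg t in h.2) (fun t => let: And4 _ _ h _ := hg t in h.2).
have sE t : speed gam t = Num.sqrt (derive1 x 0 ^+ 2 + derive1 y 0 ^+ 2).
  by rewrite /speed -/x -/y (fx t).1 (fy t).1.
exists (x 0, y 0), (derive1 x 0, derive1 y 0); split => //=.
  by move=> t; rewrite -(fx t).2 -(fy t).2 /x /y /=; case: (gam t).
have [_ _ _] := hg 0; rewrite sE => s0.
by rewrite -sqrtr_gt0 lt_def s0 sqrtr_ge0.
Qed.

Lemma J_extend (a b a' b' : R) (f g : R -> R) : a' <= a -> b <= b' ->
  cts a b f -> cts a' b' g -> (forall t, a' <= t <= b' -> 0 <= g t) ->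
  (forall t, a <= t <= b -> 0 <= f t <= g t) -> J a b f <= J a' b' g.
Proof.
move=> aa bb cf cg g0 fg.
have sub : `[a, b] `<=` (`[a', b'] : set R).
  by move=> t /=; rewrite !in_itv/= => /andP[h1 h2]; rewrite (le_trans aa h1) (le_trans h2 bb).
have cg' : cts a b g.
  by move=> t /andP[h1 h2]; apply: cg; rewrite (le_trans aa h1) (le_trans h2 bb).
apply: (@le_trans _ _ (J a b g)).
  apply: (I_le (itv_measurable a b) (cts_igb cf) (cts_igb cg')) => t /=.
  by rewrite in_itv/= => /fg /andP[].
have mI (c d : R) := itv_measurable c d.
apply: fine_le; try by apply: integrable_fin_num; [exact: mI|exact: cts_igb].
apply: ge0_subset_integral => //; try exact: mI.
  by apply/measurable_EFinP; exact: cts_measurable.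
Qed.

Section Affine.
Variables (gam : R -> R * R) (p v : R * R).
Hypothesis gamE : forall t, gam t = (p.1 + t * v.1, p.2 + t * v.2).

Lemma dotp_affine k t : dotp k (gam t) = dotp k p + t * dotp k v.
Proof. by rewrite gamE /dotp /=; ring. Qed.

Lemma affine_cts a b : gam_cts gam a b.
Proof.
have h (q w : R) : continuous (fun t : R => q + t * w).
  move=> t; apply: cvgD; first exact: cvg_cst.
  by apply: cvgMr_tmp; exact: cvg_id.
split=> t _.
  by rewrite (_ : fst \o gam = (fun t => p.1 + t * v.1)); [exact: h|apply/funext => s /=; rewrite gamE].
by rewrite (_ : snd \o gam = (fun t => p.2 + t * v.2)); [exact: h|apply/funext => s /=; rewrite gamE].
Qed.
End Affine.

(* Over whole periods the integral of cos (k . gam) vanishes unless k is orthogonal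
   to the geodesic, and a line meets a circle at most twice. *)
Lemma closed_circle_bound (gam : R -> R * R) (a b : R) : closed_geodesic_segment gam a b ->
  exists2 B, 0 <= B & forall N c c',
    J a b (fun t => trigp (circle N) c c' (gam t) ^+ 2) <= B * energy (circle N) c c'.
Proof.
move=> [[hg [T T0 per]] ab].
have [p [v [gamE v0 _]]] := geodesic_affine hg.
have [m [n TvE]] := per 0.
have Tv1 : T * v.1 = 2 * pi * m%:~R.
  by move: (congr1 fst TvE); rewrite !gamE /= => <-; ring.
have Tv2 : T * v.2 = 2 * pi * n%:~R.
  by move: (congr1 snd TvE); rewrite !gamE /= => <-; ring.
(* The segment is enlarged to a whole number of periods; the integrand is a square, so this only
   increases the integral. *)
pose q := (Num.bound ((b - a) / T)).+1; pose b' := a + q%:R * T.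
have bb : b <= b'.
  rewrite /b' -lerBlDl -ler_pdivrMr//.
  have /archi_boundP/ltW : 0 <= (b - a) / T by rewrite divr_ge0 ?subr_ge0 ?ltW.
  by move=> h; apply: le_trans h _; rewrite ler_nat.
have ab' : a < b' by exact: lt_le_trans ab bb.
(* The geodesic advances by 2 pi (m, n) in one period, and (m, n) is nonzero since the speed is.
   Thus [kk] detects orthogonality to the geodesic by an integer. *)
pose kk (k : int * int) : int := k.1 * m + k.2 * n.
have kkE k : T * dotp k v = 2 * pi * (kk k)%:~R.
  rewrite /dotp /kk rmorphD !rmorphM /=.
  have -> : T * (k.1%:~R * v.1 + k.2%:~R * v.2) = k.1%:~R * (T * v.1) + k.2%:~R * (T * v.2) by ring.
  by rewrite Tv1 Tv2; ring.
have mn0 : ((m, n) : int * int) != 0.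
  apply/eqP => -[m0 n0]; move: v0 Tv1 Tv2; rewrite m0 n0 !mulr0 => v0 /eqP.
  rewrite mulf_eq0 gt_eqF//= => /eqP v1 /eqP; rewrite mulf_eq0 gt_eqF//= => /eqP v2.
  by move: v0; rewrite v1 v2 !expr0n addr0 ltxx.
have ker0 (k : int * int) (th : R) : kk k != 0 -> J a b' (fun t => cos (th + dotp k v * t)) = 0.
  move=> k0; have xi0 : dotp k v != 0.
    apply: contra_neq k0 => h; have := kkE k; rewrite h mulr0 => /esym/eqP.
    by rewrite !mulf_eq0 pnatr_eq0 (gt_eqF (pi_gt0 R)) /= intr_eq0 => /eqP.
  have dF t : a <= t <= b' -> is_derive t 1 (fun t => sin (th + dotp k v * t) / dotp k v) (cos (th + dotp k v * t)).
    by move=> _; apply: is_derive_eq; rewrite /GRing.scale /=; field.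
  have cF : cts a b' (fun t => cos (th + dotp k v * t)).
    move=> t _; apply: (@continuous_comp R R R (fun t => th + dotp k v * t) (@cos R)); last exact: continuous_cos.
    by apply: cvgD; [exact: cvg_cst|apply: cvgM; [exact: cvg_cst|exact: cvg_id]].
  rewrite (Rintegral_FTC ab' dF cF) /b'.
  rewrite (_ : th + dotp k v * (a + q%:R * T) = th + dotp k v * a + 2 * pi * (q%:Z * kk k)%:~R); last first.
    rewrite rmorphM /= (_ : dotp k v * (a + q%:R * T) = dotp k v * a + q%:R * (T * dotp k v)); last by ring.
    by rewrite kkE; ring.
  by rewrite sin_period subrr.
pose S := 2 * (b' - a).
have ba0 : 0 <= b' - a by rewrite subr_ge0 ltW.
have S0 : 0 <= S by rewrite mulr_ge0.
exists (2 * S) => [|N c c']; first exact: mulr_ge0.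
pose ka k := if kk k == 0 then b' - a else 0.
have ka0 k : 0 <= ka k by rewrite /ka; case: ifP.
have kaN k : ka (- k) = ka k.
  rewrite /ka (_ : kk (- k) = - kk k) ?oppr_eq0//; rewrite /kk /=; ring.
have len : fine (lebesgue_measure (`[a, b'] : set R)) = b' - a.
  by rewrite lebesgue_measure_itv/= lte_fin ab'.
have mD := itv_measurable a b'; have muD := itv_fin a b'.
have cg := affine_cts gamE.
have S1 z : z \in circle N -> \sum_(z' <- circle N) ka (z - z') <= S.
  move=> zN; rewrite (bigID (fun z' => kk (z - z') == 0))/= [X in _ + X]big1 ?addr0; last first.
    by move=> z' /negPf h; rewrite /ka h.
  rewrite -big_filter; set s := [seq _ <- _ | _].
  have ss : (size s <= 2)%N.
    apply: (@line_circle_count _ N (kk z) _ mn0); first by rewrite filter_uniq// uniq_circle.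
    move=> z'; rewrite mem_filter mem_circle => /andP[/eqP h /eqP ->]; split => //.
    by move: h; rewrite /kk /= => h; apply/eqP; rewrite -subr_eq0 -oppr_eq0 -h; apply/eqP; ring.
  apply: (@le_trans _ _ (\sum_(z' <- s) (b' - a))).
    by apply: ler_sum => z' _; rewrite /ka; case: ifP.
  rewrite big_const_seq count_predT iter_addr_0 -[leLHS]mulr_natl /S ler_wpM2r//.
  by rewrite ler_nat.
have bnd (f : R -> R) : cts a b' f -> (forall t, `|f t| <= 1) -> `|J a b' f| <= b' - a.
  move=> cf f1; apply: le_trans (le_normr_Rintegral mD (cts_igb cf)) _.
  rewrite -[leRHS]mul1r -len -(Rintegral_cst _ mD).
  apply: (I_le mD); [|exact: (igb_cst mD muD)|by move=> t _; exact: f1].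
  by apply: cts_igb => t tab; apply: cvg_norm; exact: cf.
have co k := fun t (tab : a <= t <= b') => cos_gam_cts (k := k) (cg a b') tab.
have si k := fun t (tab : a <= t <= b') => sin_gam_cts (k := k) (cg a b') tab.
apply: (@le_trans _ _ (J a b' (fun t => cst 1 t * trigp (circle N) c c' (gam t) ^+ 2))).
  have ctr (x y : R) : cts x y (fun t => trigp (circle N) c c' (gam t)).
    by move=> t txy; exact: (trigp_gam_cts (cg x y) txy).
  apply: J_extend => //.
  - by move=> t tab; apply: cvgM; exact: (ctr _ _ _ tab).
  - by move=> t tab; apply: cvgM; [exact: cvg_cst|apply: cvgM; exact: (ctr _ _ _ tab)].
  - by move=> t _; rewrite mul1r sqr_ge0.
  - by move=> t _; rewrite mul1r sqr_ge0 lexx.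
apply: (gram_bound (ka := ka)) => //.
- by move=> t _; exact: cvg_cst.
- move=> k; rewrite (@eq_J R a b' _ (fun t => cos (dotp k (gam t)))); last by move=> t _; rewrite mul1r.
  rewrite /ka; case: eqP => [_|/eqP k0].
    by apply: bnd; [exact: co|move=> t; rewrite ler_norml cos_geN1 cos_le1].
  rewrite (@eq_J R a b' _ (fun t => cos (dotp k p + dotp k v * t))).
    by rewrite ker0// normr0.
  by move=> t _; rewrite (dotp_affine gamE) mulrC.
- move=> k; rewrite (@eq_J R a b' _ (fun t => sin (dotp k (gam t)))); last by move=> t _; rewrite mul1r.
  rewrite /ka; case: eqP => [_|/eqP k0].
    by apply: bnd; [exact: si|move=> t; rewrite ler_norml sin_geN1 sin_le1].
  rewrite (@eq_J R a b' _ (fun t => cos ((dotp k p - pi / 2) + dotp k v * t))).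
    by rewrite ker0// normr0.
  by move=> t _; rewrite (dotp_affine gamE) -cosBpihalf mulrC; congr cos; ring.
move=> z zN; rewrite (eq_bigr (fun m => ka (z - m))); first exact: S1.
by move=> z' _; rewrite -kaN opprB.
Qed.
End ClosedGeodesic.

(** * General geodesics *)

Section GeodesicSegment.
Variable R : realType.
Local Notation J a b f := (\int[@lebesgue_measure R]_(t in `[a, b]) f t).
Local Notation cts a b f := (forall t : R, a <= t <= b -> {for t, continuous f}).

(** Sort z' by the integer part k of |(z - z').v| / eta, eta = |v| / 16. A slice consists of two
    strips, each counted by [strip_count]; in slice k the summand is at most E / (1 + k^2), and the
    sum over k is at most 5. Hence 40 = 2 * 4 * 5. *)
Lemma strip_sum (v : R * R) : 0 < v.1 ^+ 2 + v.2 ^+ 2 -> exists2 C, 0 <= C &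
  forall N z, \sum_(z' <- circle N) (1 + dotp (z - z') v ^+ 2)^-1 <= C * (trunc_log 2 N).+1%:R.
Proof.
move=> v0; set nu := v.1 ^+ 2 + v.2 ^+ 2 in v0.
pose eta : R := Num.sqrt nu / 16.
have eta0 : 0 < eta by rewrite divr_gt0 ?sqrtr_gt0.
have eta2 : 256 * eta ^+ 2 <= nu.
  have h : Num.sqrt nu ^+ 2 = nu by rewrite sqr_sqrtr ?ltW.
  by rewrite -[leRHS]h /eta; move: (Num.sqrt nu) => q; rewrite le_eqVlt; apply/orP; left; apply/eqP; field.
pose E := 1 + (eta ^+ 2)^-1.
have E0 : 0 <= E by rewrite addr_ge0// invr_ge0 sqr_ge0.
exists (40 * E) => [|N z]; first exact: mulr_ge0.
pose xi (z' : int * int) : R := dotp (z - z') v.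
have xiB (n m : int * int) : (n - m).1%:~R * v.1 + (n - m).2%:~R * v.2 = xi m - xi n.
  by rewrite /xi /dotp /= !rmorphB /=; ring.
pose f z' := Num.truncn (`|xi z'| / eta).
have fP z' : (f z')%:R * eta <= `|xi z'| < (f z').+1%:R * eta.
  rewrite -ler_pdivlMr// -ltr_pdivrMr//; apply: truncn_itv.
  by rewrite divr_ge0// ltW.
have cnt i : (size [seq z' <- circle N | f z' == i] <= 8 * (trunc_log 2 N).+1)%N.
  rewrite (_ : 8 = 2 * 4)%N// -mulnA.
  apply: (@size_fibers _ (fun z' => nat_of_bool (0 <= xi z'))) => [z' _|e]; first by case: (0 <= _).
  set s := [seq _ <- _ | _].
  have us : uniq s by do 2!apply: filter_uniq; exact: uniq_circle.
  have sP x : x \in s -> [/\ nat_of_bool (0 <= xi x) = e, f x = i & nsq x = N].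
    by rewrite 2!mem_filter mem_circle => /and3P[/eqP-> /eqP-> /eqP->].
  have [N0|N0] := posnP N.
    apply: (@leq_trans 1); last by rewrite muln_gt0.
    apply: (@uniq_leq_size _ _ [:: 0]) => // x /sP[_ _]; rewrite N0 => /eqP.
    by rewrite nsq_eq0 inE.
  apply: (strip_count (R := R) (v := v) (eta := eta)) => //; first exact: ltW.
    by move=> x /sP[].
  move=> x y /sP[xe xf _] /sP[ye yf _]; rewrite xiB.
  have := fP x; have := fP y; rewrite xf yf -[i.+1%:R]natr1.
  move: xe ye; case: (ltrP (xi x) 0) => hx; case: (ltrP (xi y) 0) => hy <- // _.
    rewrite (ltr0_norm hx) (ltr0_norm hy); clear -eta0 => /andP[h1 h2] /andP[h3 h4].
    by rewrite ler_norml; apply/andP; split; lra.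
  rewrite (ger0_norm hx) (ger0_norm hy); clear -eta0 => /andP[h1 h2] /andP[h3 h4].
  by rewrite ler_norml; apply/andP; split; lra.
pose L := (\max_(z' <- circle N) f z').+1.
rewrite (@sum_fibers R _ _ _ (iota 0 L) f); first last.
- by move=> z' zN; rewrite mem_iota /= add0n ltnS; exact: leq_bigmax_seq.
- exact: iota_uniq.
apply: (@le_trans _ _ (\sum_(k <- iota 0 L) 8 * (trunc_log 2 N).+1%:R * E * (1 + k%:R ^+ 2)^-1)).
  apply: ler_sum => k _.
  apply: (@le_trans _ _ (\sum_(z' <- circle N | f z' == k) E * (1 + k%:R ^+ 2)^-1)).
    apply: ler_sum => z' /eqP fk; have := fP z'; rewrite fk => /andP[h _].
    have : (k%:R * eta) ^+ 2 <= xi z' ^+ 2.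
      rewrite -[leRHS]real_normK ?num_real// ler_pXn2r ?nnegrE//.
      by rewrite mulr_ge0// ltW.
    rewrite exprMn -/(xi z') => {}h.
    have k1 : 0 < 1 + k%:R ^+ 2 :> R by rewrite ltr_pwDl// sqr_ge0.
    have x1 : 0 < 1 + xi z' ^+ 2 by rewrite ltr_pwDl// sqr_ge0.
    rewrite -[leLHS]mul1r ler_pdivrMr// mulrAC ler_pdivlMr// mul1r.
    apply: (@le_trans _ _ (E * (1 + k%:R ^+ 2 * eta ^+ 2))); last by rewrite ler_wpM2l// lerD2l.
    rewrite /E mulrDl mulrDr mulr1 mul1r mulrDr mulr1.
    rewrite [X in _ + (_ + X)]mulrC mulfK ?gt_eqF ?exprn_gt0//.
    rewrite -subr_ge0; move: (eta ^+ 2) (exprn_gt0 2 eta0) (k%:R ^+ 2 : R) (sqr_ge0 (k%:R : R)) => x x0 y y0.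
    clear -x0 y0; rewrite (_ : _ - _ = y * x + x^-1); last by ring.
    by rewrite addr_ge0 ?mulr_ge0// ?invr_ge0 ltW.
  rewrite -big_filter big_const_seq count_predT iter_addr_0 -[leLHS]mulr_natl -mulrA -natrM.
  apply: ler_wpM2r; last by rewrite ler_nat cnt.
  by rewrite mulr_ge0// invr_ge0 addr_ge0// sqr_ge0.
rewrite -mulr_sumr -[iota 0 L]/(index_iota 0 L) big_mkord.
have h5 : \sum_(k < L) (1 + k%:R ^+ 2)^-1 <= 5 :> R.
  by apply: le_trans (sum_inv_sqr R L) _; rewrite gerBl divr_ge0.
apply: (@le_trans _ _ (8 * (trunc_log 2 N).+1%:R * E * 5)).
  by apply: ler_wpM2l h5; rewrite !mulr_ge0.
by rewrite le_eqVlt; apply/orP; left; apply/eqP; ring.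
Qed.

Lemma J_norm_le (a b M : R) (f : R -> R) : a <= b -> cts a b f ->
  (forall t, a <= t <= b -> `|f t| <= M) -> `|J a b f| <= M * (b - a).
Proof.
move=> ab cf fM; have mD := itv_measurable a b; have muD := itv_fin a b.
have len : fine (lebesgue_measure (`[a, b] : set R)) = b - a.
  rewrite lebesgue_measure_itv/= lte_fin; case: ltgtP ab => // -> _ /=.
  by rewrite subrr.
apply: le_trans (le_normr_Rintegral mD (cts_igb cf)) _.
rewrite -len -(Rintegral_cst _ mD).
apply: (I_le mD); [|exact: (igb_cst mD muD)|by move=> t /=; rewrite in_itv/=; exact: fM].
by apply: cts_igb => t tab; apply: cvg_norm; exact: cf.
Qed.

Section Weight.
Variables (m l : R).
Hypothesis l0 : 0 < l.
Let om := pi / l.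
(* A weight that vanishes to second order at m - l and m + l. *)
Definition hump (t : R) : R := 1 + cos (om * (t - m)).

Lemma hump_ge0 t : 0 <= hump t.
Proof. by rewrite -lerBlDl sub0r cos_geN1. Qed.

Lemma hump_ge1 t : m - l / 2 <= t <= m + l / 2 -> 1 <= hump t.
Proof.
move=> /andP[h1 h2]; rewrite lerDl; apply: cos_ge0_pihalf.
have e : pi / 2 = om * (l / 2) :> R.
  by rewrite /om; move: (pi : R) => p; field; rewrite gt_eqF.
have om0 : 0 < om by rewrite divr_gt0 ?pi_gt0.
rewrite e -mulrN !ler_pM2l//; lra.
Qed.

Lemma hump_cts t : {for t, continuous hump}.
Proof.
apply: cvgD; first exact: cvg_cst.
apply: (@continuous_comp R R R (fun t => om * (t - m)) (@cos R)); last exact: continuous_cos.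
by apply: cvgMl_tmp; apply: cvgB; [exact: cvg_id|exact: cvg_cst].
Qed.

(** Two integrations by parts, written as one primitive. The boundary terms vanish because the
    weight and its derivative do, which gives xi^2 |X| <= 2 l om^2; adding the trivial bound |X| <=
    4 l yields the denominator 1 + xi^2. *)
Lemma hump_kernel th xi : `|J (m - l) (m + l) (fun t => hump t * cos (th + xi * t))|
  <= (4 * l + 2 * l * om ^+ 2) / (1 + xi ^+ 2).
Proof.
have ab : m - l < m + l by move: l0 => h; clear -h; lra.
have len : m + l - (m - l) = 2 * l by ring.
have ccos (t : R) : {for t, continuous (fun t => cos (th + xi * t))}.
  apply: (@continuous_comp R R R (fun t => th + xi * t) (@cos R)); last exact: continuous_cos.
  by apply: cvgD; [exact: cvg_cst|apply: cvgMl_tmp; exact: cvg_id].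
have cos1 (x : R) : `|cos x| <= 1 by rewrite ler_norml cos_geN1 cos_le1.
have cw (t : R) : {for t, continuous (fun t => hump t * cos (th + xi * t))}.
  by apply: cvgM; [exact: hump_cts|exact: ccos].
pose g t := om ^+ 2 * (cos (om * (t - m)) * cos (th + xi * t)).
have cg (t : R) : {for t, continuous g}.
  apply: cvgMl_tmp; apply: cvgM; last exact: ccos.
  apply: (@continuous_comp R R R (fun t => om * (t - m)) (@cos R)); last exact: continuous_cos.
  by apply: cvgMl_tmp; apply: cvgB; [exact: cvg_id|exact: cvg_cst].
set X := \int[_]_(t in _) _.
have X1 : `|X| <= 2 * (2 * l).
  rewrite -len; apply: J_norm_le; [exact: ltW|by []|] => t _.
  rewrite normrM -[2]mulr1 ler_pM// ger0_norm ?hump_ge0// /hump.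
  by rewrite -[2]/(1 + 1) lerD2l cos_le1.
have X2 : xi ^+ 2 * X = J (m - l) (m + l) g.
  have dF t : m - l <= t <= m + l -> is_derive t 1
     (fun t => xi * hump t * sin (th + xi * t) - om * sin (om * (t - m)) * cos (th + xi * t))
     (xi ^+ 2 * (hump t * cos (th + xi * t)) - g t).
    move=> _; rewrite /hump /g; apply: is_derive_eq; rewrite /GRing.scale /=; ring.
  have cF t : m - l <= t <= m + l ->
      {for t, continuous (fun t => xi ^+ 2 * (hump t * cos (th + xi * t)) - g t)}.
    by move=> _; apply: cvgB; [apply: cvgMl_tmp; exact: cw|exact: cg].
  have := Rintegral_FTC ab dF cF.
  have mD := itv_measurable (m - l) (m + l).
  have i1 := cts_igb (a := m - l) (b := m + l) (fun t _ => cw t).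
  have i2 := cts_igb (a := m - l) (b := m + l) (fun t _ => cg t).
  rewrite (I_B mD _ i2); last exact: (igbZ mD).
  rewrite (I_Z mD _ i1) -/X.
  have e1 : om * (m + l - m) = pi by rewrite /om; move: (pi : R) => p; field; rewrite gt_eqF.
  have e2 : om * (m - l - m) = - pi by rewrite /om; move: (pi : R) => p; field; rewrite gt_eqF.
  rewrite /hump e1 e2 sinN cosN sinpi cospi subrr oppr0 !mulr0 !mul0r subrr.
  by move=> /eqP; rewrite subr_eq0 => /eqP.
have X3 : `|X| * xi ^+ 2 <= om ^+ 2 * (2 * l).
  rewrite -[xi ^+ 2]ger0_norm ?sqr_ge0// -normrM mulrC X2 -len.
  apply: J_norm_le; [exact: ltW|by []|] => t _.
  rewrite normrM ger0_norm ?sqr_ge0// -[leRHS]mulr1 ler_wpM2l ?sqr_ge0//.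
  by rewrite normrM mulr_ile1.
rewrite ler_pdivlMr ?ltr_pwDl ?sqr_ge0// mulrDr mulr1.
by move: (lerD X1 X3); rewrite (_ : 2 * (2 * l) = 4 * l) 1?(mulrC (om ^+ 2))//; ring.
Qed.
End Weight.

Lemma geodesic_circle_bound (gam : R -> R * R) (a b : R) : geodesic gam -> a < b ->
  exists2 B, 0 <= B & forall N c c',
    J a b (fun t => trigp (circle N) c c' (gam t) ^+ 2)
      <= B * (trunc_log 2 N).+1%:R * energy (circle N) c c'.
Proof.
move=> hg ab; have [p [v [gamE v0 _]]] := geodesic_affine hg.
have [C C0 CP] := strip_sum v0.
(* With this choice [a, b] is the middle half of the support of the weight, where the weight is at
   least 1. *)
pose m := (a + b) / 2; pose l := b - a.
have l0 : 0 < l by rewrite subr_gt0.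
pose K : R := 4 * l + 2 * l * (pi / l) ^+ 2.
have K0 : 0 <= K by rewrite addr_ge0// mulr_ge0 ?sqr_ge0// ?mulr_ge0// ltW.
exists (2 * (K * C)) => [|N c c']; first by rewrite !mulr_ge0.
have cg := affine_cts gamE.
have D0 k : 0 < 1 + dotp k v ^+ 2 by rewrite ltr_pwDl// sqr_ge0.
have ctr (t : R) : {for t, continuous (fun t => trigp (circle N) c c' (gam t))}.
  by apply: (trigp_gam_cts (cg t t)); rewrite lexx.
have cw (t : R) : {for t, continuous (hump m l)} by exact: hump_cts.
apply: (@le_trans _ _ (J (m - l) (m + l) (fun t => hump m l t * trigp (circle N) c c' (gam t) ^+ 2))).
  apply: J_extend.
  - by rewrite /m /l; move: ab; clear; lra.
  - by rewrite /m /l; move: ab; clear; lra.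
  - by move=> t _; apply: cvgM; exact: ctr.
  - by move=> t _; apply: cvgM; [exact: cw|apply: cvgM; exact: ctr].
  - by move=> t _; rewrite mulr_ge0 ?hump_ge0 ?sqr_ge0.
  - move=> t tab; rewrite sqr_ge0 -[leLHS]mul1r ler_wpM2r ?sqr_ge0//.
    by apply: hump_ge1 => //; move: tab; rewrite /m /l; clear => /andP[h1 h2]; apply/andP; split; lra.
rewrite -(mulrA 2) -(mulrA K).
apply: (gram_bound (ka := fun k => K / (1 + dotp k v ^+ 2))).
- exact: cg.
- by move=> t _; exact: cw.
- by move=> t _; exact: hump_ge0.
- by move=> k; rewrite divr_ge0// ltW.
- move=> k; rewrite (@eq_J R (m - l) (m + l) _ (fun t => hump m l t * cos (dotp k p + dotp k v * t))).
    exact: hump_kernel.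
  by move=> t _; rewrite (dotp_affine gamE) [t * _]mulrC.
- move=> k; rewrite (@eq_J R (m - l) (m + l) _ (fun t => hump m l t * cos ((dotp k p - pi / 2) + dotp k v * t))).
    exact: hump_kernel.
  move=> t _; rewrite (dotp_affine gamE) -cosBpihalf [t * _]mulrC; congr (_ * cos _); ring.
- by move=> z _; rewrite -mulr_sumr ler_wpM2l// CP.
- move=> z _; rewrite -mulr_sumr ler_wpM2l//.
  rewrite (eq_bigr (fun z' => (1 + dotp (z - z') v ^+ 2)^-1)); first exact: CP.
  move=> z' _; congr (_ + _)^-1; rewrite -sqrrN; congr (_ ^+ 2).
  by rewrite /dotp /= !rmorphB /=; ring.
Qed.
End GeodesicSegment.

(** * The restriction estimates *)

Section Restriction.
Variable R : realType.
Local Notation I f := (\int[area R]_(x in @square R) f x).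
Local Notation J a b f := (\int[@lebesgue_measure R]_(t in `[a, b]) f t).
Local Notation cts a b f := (forall t : R, a <= t <= b -> {for t, continuous f}).

(** B_N^2 is of order log N for every N, while the final bound may only contain log lam. The excess
    is at most 16 * 4^j in window j; its square root 4 * 2^j is a weight that [cnorm_sum_bound]
    admits. *)
Lemma trunc_log_window (L N : nat) :
  ((trunc_log 2 N).+1 <= (trunc_log 2 L.+1).+1 * (16 * 4 ^ window L N))%N.
Proof.
set j := window L N; set t := trunc_log 2 L.+1.
have Lt : (L.+1 < 2 ^ t.+1)%N by exact: trunc_log_ltn.
have /andP[_ dj] := window_bounds L N.
have NL : (N < 2 ^ (t.+1 + 16 * j))%N.
  rewrite expnD; apply: leq_ltn_trans (_ : _ <= L.+1 * 2 ^ (16 * j))%N _; last first.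
    by rewrite ltn_pmul2r// expn_gt0.
  move: dj; rewrite -/j; move: (2 ^ (16 * j))%N => X; rewrite /ndist; clear; nia.
have tN : ((trunc_log 2 N).+1 <= t.+1 + 16 * j)%N.
  have [->|N0] := posnP N; first by rewrite trunc_log0 addSn.
  by rewrite -(ltn_exp2l (m := 2))//; apply: leq_ltn_trans NL; exact: trunc_logP.
apply: leq_trans tN _.
have : (j.+1 <= 4 ^ j)%N by exact: ltn_expl.
move: (4 ^ j)%N => Y; clear; nia.
Qed.

Lemma comp_gam_cts (u : R * R -> R) (gam : R -> R * R) (a b : R) :
  continuous u -> gam_cts gam a b -> cts a b (u \o gam).
Proof.
move=> cu [c1 c2] t tab; apply: continuous_comp; last exact: cu.
have h : (fun s => ((fst \o gam) s, (snd \o gam) s)) @ t --> ((fst \o gam) t, (snd \o gam) t).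
  exact: (cvg_pair (c1 t tab) (c2 t tab)).
move: h; rewrite (_ : (fun s => ((fst \o gam) s, _)) = gam) /=; first by rewrite -surjective_pairing.
by apply/funext => s /=; case: (gam s).
Qed.

(** The circle bounds, divided by K, serve as the weights of [cnorm_sum_bound]. They may grow with
    the distance of N from lam^2 and may depend on lam through K, while C is fixed beforehand. *)
Lemma real_eigen_restriction (V : R * R -> R) (gam : R -> R * R) (a b : R) :
  L2_torus V -> a <= b -> gam_cts gam a b ->
  exists2 C, 0 <= C & forall lam u (Bt : nat -> R) K, real_eigen V lam u -> 0 < K ->
    (forall N, 0 <= Bt N <= K * 2 ^+ window (Num.truncn (lam ^+ 2)) N) ->
    (forall N c c', J a b (fun t => trigp (circle N) c c' (gam t) ^+ 2)
       <= Bt N ^+ 2 * energy (circle N) c c') ->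
    J a b (fun t => u (gam t) ^+ 2) <= C * K ^+ 2 * I (fun x => u x ^+ 2).
Proof.
move=> hV ab cg; have [C C0 CP] := cnorm_sum_bound hV.
exists (2 * C ^+ 2) => [|lam u Bt K hu K0 BK BJ]; first by rewrite mulr_ge0// sqr_ge0.
have [cu lu _] := hu.
have U0 : 0 <= I (fun x => u x ^+ 2) by apply: I_ge0 => x _; exact: sqr_ge0.
have cug : cts a b (u \o gam).
  exact: comp_gam_cts cu cg.
have wP N : 0 <= Bt N / K <= 2 ^+ window (Num.truncn (lam ^+ 2)) N.
  have /andP[h1 h2] := BK N; apply/andP; split; first by rewrite divr_ge0// ltW.
  by rewrite ler_pdivrMr// mulrC.
have sB M : \sum_(N < M) Bt N * cnorm (fcos u) (fsin u) N
    <= K * (C * Num.sqrt (I (fun x => u x ^+ 2))).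
  rewrite (eq_bigr (fun N : 'I_M => K * (Bt N / K * cnorm (fcos u) (fsin u) N))); last first.
    by move=> N _; rewrite mulrA mulrCA mulfV ?mulr1// gt_eqF.
  rewrite -mulr_sumr; apply: ler_wpM2l; first exact: ltW.
  exact: (CP lam u (fun N => Bt N / K) hu wP).
have := curve_limit ab cg cug (fun N => (andP (BK N)).1) (fun N => BJ N _ _) sB
  (fun eps e0 => disc_approx hV hu e0).
move=> /le_trans; apply; rewrite !exprMn sqr_sqrtr//.
by rewrite le_eqVlt; apply/orP; left; apply/eqP; ring.
Qed.

Lemma sqr_normc (z : R[i]) : Normc.normc z ^+ 2 = complex.Re z ^+ 2 + complex.Im z ^+ 2.
Proof. by case: z => x y; rewrite /= sqr_sqrtr// addr_ge0 ?sqr_ge0. Qed.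

(** The speed is bounded on [a, b], so arc length is dominated by a multiple of dt; the real and
    imaginary parts then add up on both sides. *)
Lemma eigenfunction_restriction (V : R * R -> R) (gam : R -> R * R) (a b : R) :
  L2_torus V -> a <= b -> gam_cts gam a b -> cts a b (speed gam) ->
  exists2 C, 0 <= C & forall lam e (Bt : nat -> R) K, eigenfunction V (lam ^+ 2) e -> 0 < K ->
    (forall N, 0 <= Bt N <= K * 2 ^+ window (Num.truncn (lam ^+ 2)) N) ->
    (forall N c c', J a b (fun t => trigp (circle N) c c' (gam t) ^+ 2)
       <= Bt N ^+ 2 * energy (circle N) c c') ->
    normL2_curve gam a b e <= C * K * normL2_torus e.
Proof.
move=> hV ab cg cs; have [C C0 CP] := real_eigen_restriction hV ab cg.
have [S SP] := cts_bounded cs.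
exists (Num.sqrt (`|S| * C)) => [|lam e Bt K he K0 BK BJ]; first exact: sqrtr_ge0.
have [hr hi] := eigenfunction_real he.
have Jr := CP _ _ _ _ hr K0 BK BJ; have Ji := CP _ _ _ _ hi K0 BK BJ.
set ur := (fun x => complex.Re (e x)) in hr Jr; set ui := (fun x => complex.Im (e x)) in hi Ji.
have mD := @measurable_square R; have muD := @area_square_fin R.
have mJ := itv_measurable a b.
have iu u : real_eigen V lam u -> (area R).-integrable (@square R) (EFin \o (fun x => u x ^+ 2)).
  by move=> [_ /L2_torus_sqint[] _ iu _].
have torE : I (fun x => Normc.normc (e x) ^+ 2) = I (fun x => ur x ^+ 2) + I (fun x => ui x ^+ 2).
  rewrite -(I_D mD (iu _ hr) (iu _ hi)); congr (Rintegral _ _ _).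
  by apply/funext => x; rewrite sqr_normc.
have cug u : real_eigen V lam u -> cts a b (fun t => u (gam t) ^+ 2).
  move=> [cu _ _] t tab.
  have h : {for t, continuous (u \o gam)} by exact: (comp_gam_cts cu cg).
  by apply: cvgM; exact: h.
have cr := cug _ hr; have ci := cug _ hi.
have cri : cts a b (fun t => ur (gam t) ^+ 2 + ui (gam t) ^+ 2).
  by move=> t tab; apply: cvgD; [exact: cr|exact: ci].
rewrite /normL2_curve /normL2_torus torE.
rewrite -[K in leRHS](gtr0_norm K0) -(sqrtr_sqr K) -!sqrtrM ?mulr_ge0 ?sqr_ge0 ?(ltW K0)//.
apply: ler_wsqrtr.
rewrite (@eq_J R a b _ (fun t => (ur (gam t) ^+ 2 + ui (gam t) ^+ 2) * speed gam t)); last first.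
  by move=> t _; rewrite sqr_normc.
apply: (@le_trans _ _ (J a b (fun t => `|S| * (ur (gam t) ^+ 2 + ui (gam t) ^+ 2)))).
  apply: (I_le mJ).
  - by apply: cts_igb => t tab; apply: cvgM; [exact: cri|exact: cs].
  - by apply: cts_igb => t tab; apply: cvgMl_tmp; exact: cri.
  - move=> t /=; rewrite in_itv/= => tab; rewrite mulrC ler_wpM2r ?addr_ge0 ?sqr_ge0//.
    apply: le_trans (ler_norm _) _; apply: le_trans (SP t tab) _; exact: ler_norm.
rewrite (I_Z mJ _ (cts_igb cri)) (I_D mJ (cts_igb cr) (cts_igb ci)).
rewrite -!mulrA ler_wpM2l//; apply: le_trans (lerD Jr Ji) _.
by rewrite le_eqVlt; apply/orP; left; apply/eqP; ring.
Qed.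

(** For lam >= 10, lam^2 + 1 <= lam^3, so the logarithm to base 2 is at most 3 log_2 lam; the
    additional 1 is absorbed by a fourth multiple. *)
Lemma trunc_log_ln (lam : R) : 10 <= lam ->
  (trunc_log 2 (Num.truncn (lam ^+ 2)).+1).+1%:R <= 4 / ln 2 * ln lam.
Proof.
move=> lam10; set t := trunc_log 2 _.
have l0 : 0 < lam by exact: lt_le_trans lam10.
have ln20 : 0 < ln 2 :> R by rewrite ln_gt0// ltr1n.
have h : 2 ^+ t <= lam ^+ 3.
  apply: (@le_trans _ _ (Num.truncn (lam ^+ 2)).+1%:R).
    by rewrite -natrX ler_nat trunc_logP.
  rewrite -natr1; have : (Num.truncn (lam ^+ 2))%:R <= lam ^+ 2 by rewrite truncn_le sqr_ge0.
  move: (Num.truncn _)%:R => x; move: lam10; clear => h hx.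
  by rewrite [lam ^+ 3]exprS; have : 10 * lam ^+ 2 <= lam * lam ^+ 2; [rewrite ler_wpM2r ?sqr_ge0|nra].
have l2 : ln 2 <= ln lam by rewrite ler_ln ?posrE//; apply: le_trans lam10; rewrite ler_nat.
have : ln 2 *+ t <= ln lam *+ 3.
  by rewrite -!lnXn// ler_ln ?posrE// exprn_gt0.
rewrite -[ln 2 *+ t]mulr_natr -[ln lam *+ 3]mulr_natr => h3.
rewrite mulrAC ler_pdivlMr// -natr1.
move: h3 l2; clear; move: (ln 2) (ln lam) (t%:R : R) => x y z h1 h2; lra.
Qed.

Lemma curved_speed_cts (gam : R -> R * R) (a b : R) : regular_segment gam a b ->
  gam_cts gam a b /\ cts a b (speed gam).
Proof.
move=> [_ sx sy _]; split.
  by split=> t tab; [exact: is_derive_continuous (smooth_near_is_derive sx 0 tab)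
    |exact: is_derive_continuous (smooth_near_is_derive sy 0 tab)].
move=> t tab.
have c1 := is_derive_continuous (smooth_near_is_derive sx 1 tab).
have c2 := is_derive_continuous (smooth_near_is_derive sy 1 tab).
apply: (@continuous_comp R R R (fun t => derive1 (fst \o gam) t ^+ 2 + derive1 (snd \o gam) t ^+ 2) Num.sqrt).
  by apply: cvgD; apply: cvgM.
exact: sqrt_continuous.
Qed.

Lemma geodesic_speed_cts (gam : R -> R * R) (a b : R) : geodesic gam ->
  gam_cts gam a b /\ cts a b (speed gam).
Proof.
move=> /geodesic_affine[p [v [gamE _ sE]]]; split; first exact: (affine_cts gamE).
by move=> t _; rewrite (_ : speed gam = cst (Num.sqrt (v.1 ^+ 2 + v.2 ^+ 2)));
  [exact: cvg_cst|apply/funext].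
Qed.

End Restriction.

Theorem theorem1p3 (R : realType) (V : R * R -> R) (hV : L2_torus V) :
  (forall (gam : R -> R * R) (a b : R),
     curved_segment gam a b \/ closed_geodesic_segment gam a b ->
     exists C : R, forall (lam : R) (e : R * R -> R[i]),
       10 <= lam -> eigenfunction V (lam ^+ 2) e ->
       normL2_curve gam a b e <= C * normL2_torus e)
  /\
  (forall (gam : R -> R * R) (a b : R),
     geodesic_segment gam a b ->
     exists C : R, forall (lam : R) (e : R * R -> R[i]),
       10 <= lam -> eigenfunction V (lam ^+ 2) e ->
       normL2_curve gam a b e <= C * Num.sqrt (ln lam) * normL2_torus e).
Proof.
split=> gam a b h.
- have [ab [cg cs] [B B0 BP]] : [/\ a <= b,
      gam_cts gam a b /\ (forall t : R, a <= t <= b -> {for t, continuous (speed gam)}) &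
      exists2 B, 0 <= B & forall N c c',
        \int[@lebesgue_measure R]_(t in `[a, b]) (trigp (circle N) c c' (gam t) ^+ 2)
          <= B * energy (circle N) c c'].
    case: h => [hg|hg].
      by have [rg _] := hg; have [ab _ _ _] := rg; split; [exact: ltW|exact: curved_speed_cts|exact: curved_circle_bound].
    have [[gg _] ab] := hg.
    by split; [exact: ltW|exact: geodesic_speed_cts|exact: closed_circle_bound].
  have [C C0 CP] := eigenfunction_restriction hV ab cg cs.
  have sB0 := sqrtr_ge0 B.
  (* The summand 1 makes the constant K positive even if B = 0. *)
  exists (C * (Num.sqrt B + 1)) => lam e _ he.
  apply: (CP lam e (fun=> Num.sqrt B)) => [||N|N c c'].
  + exact: he.
  + by rewrite ltr_wpDl.
  + by rewrite sB0 /= -[leLHS]mulr1 ler_pM// ?lerDl// exprn_ege1// ler1n.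
  + by rewrite /= sqr_sqrtr// BP.
have [gg ab] := h; have [B B0 BP] := geodesic_circle_bound gg ab.
have [cg cs] := geodesic_speed_cts a b gg.
have [C C0 CP] := eigenfunction_restriction hV (ltW ab) cg cs.
have ln20 : 0 < ln 2 :> R by rewrite ln_gt0// ltr1n.
(* The 4 is the square root of the 16 in [trunc_log_window], the 1 keeps K positive, and 4 / ln 2
   comes from [trunc_log_ln]. *)
exists (C * ((4 * Num.sqrt B + 1) * Num.sqrt (4 / ln 2))) => lam e lam10 he.
pose T : R := (trunc_log 2 (Num.truncn (lam ^+ 2)).+1).+1%:R.
have sB0 := sqrtr_ge0 B.
have K0 : 0 < (4 * Num.sqrt B + 1) * Num.sqrt T.
  by rewrite mulr_gt0 ?sqrtr_gt0 ?ltr0n// ltr_wpDl// mulr_ge0.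
have tor0 : 0 <= normL2_torus e by exact: sqrtr_ge0.
apply: (@le_trans _ _ (C * ((4 * Num.sqrt B + 1) * Num.sqrt T) * normL2_torus e)).
  apply: (CP lam e (fun N => Num.sqrt (B * (trunc_log 2 N).+1%:R))) => // [N|N c c'].
    rewrite sqrtr_ge0/=; set j := window _ N.
    have h4 : Num.sqrt (trunc_log 2 N).+1%:R <= Num.sqrt T * (4 * 2 ^+ j).
      rewrite -[4 * 2 ^+ j]ger0_norm ?mulr_ge0 ?exprn_ge0// -sqrtr_sqr -sqrtrM//.
      rewrite ler_wsqrtr// exprMn -exprM mulnC exprM.
      have := trunc_log_window (Num.truncn (lam ^+ 2)) N; rewrite -(ler_nat R).
      by rewrite -/j !natrM natrX /T -[2 ^+ 2]natrX -[4 ^+ 2]natrX.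
    rewrite sqrtrM//; apply: le_trans (ler_wpM2l sB0 h4) _.
    rewrite [leLHS](_ : _ = (4 * Num.sqrt B) * Num.sqrt T * 2 ^+ j); last by ring.
    by rewrite !ler_wpM2r ?exprn_ge0 ?sqrtr_ge0// lerDl.
  by rewrite /= sqr_sqrtr ?mulr_ge0// BP.
rewrite ler_wpM2r// -!mulrA ler_wpM2l// ler_wpM2l ?addr_ge0 ?mulr_ge0//.
rewrite -sqrtrM; last by rewrite divr_ge0// ltW.
apply: ler_wsqrtr.
exact: trunc_log_ln.
Qed.
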